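(* Assume that if $\bar{\mathcal E}^*\setminus\mathcal S^*\neq\emptyset$ then $\mathsf P_X^*$ is faithful to $\gamma^*$. Then $$\bar{\mathcal E}^*=\{\gamma'\in\Gamma^p:\ \gamma'\supseteq\gamma\ \text{for some }\gamma\in\Gamma^p\text{ with }\mathsf P_X^*\in\mathcal P(\gamma,n\mathcal G^* )\}=\bigcup_{\gamma\in\bar{\mathcal E}_R^*}\mathcal S^\gamma.$$ Moreover, $\bar{\mathcal E}^*=\mathcal S^*$ if and only if $\bar{\mathcal E}^*_R=\{\gamma^*\}$.
   Context: DAGs. Fix $p\in\mathbb N$, $[p]=\{1,\dots,p\}$. $\Gamma^p$ is the set of all directed acyclic graphs (DAGs) with node set $[p]$; $\mathrm{pa}^\gamma(j)$ is the set of parents of $j$ in $\gamma$. $\gamma'\supseteq\gamma$ means every directed edge of $\gamma$ is an edge of $\gamma'$; $\mathcal S^\gamma=\{\gamma'\in\Gamma^p:\gamma'\supseteq\gamma\}$ and $\mathcal S^*=\mathcal S^{\gamma^*}$. $\mathbb I(\gamma)$ is the set of conditional independence relations encoded by $\gamma$ via d-separation. True model. $\gamma^*\in\Gamma^p$ is fixed, $\mathrm{pa}^*(j)=\mathrm{pa}^{\gamma^*}(j)$, and $X=(X_1,\dots,X_p)$ satisfies $X_j=\sum_{k\in\mathrm{pa}^*(j)}\beta^*_{jk}X_k+\epsilon_j$, $j\in[p]$, with all $\beta^*_{jk}$ non-zero reals and $\epsilon_1,\dots,\epsilon_p$ independent, where $\epsilon_j\mid\lambda_j\sim N(0,\lambda_j^2)$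 and $\lambda_j\sim\mathsf Q_j^*$ independently, $\mathsf Q_j^*$ a probability distribution on $(0,\infty)$. Standing assumption: $\mathsf E_*[\lambda_j]<\infty$ for all $j$. $n\mathcal G^*=\{j:\lambda_j\text{ is non-degenerate}\}=\{j:\epsilon_j\text{ is non-Gaussian}\}$. $\mathsf P_X^*$ is the law of $X$, $\mathsf E_*$ expectation under the true model. $\mathbb I(\mathsf P_X^* )$ is the set of conditional independence relations among $X_1,\dots,X_p$ holding under $\mathsf P_X^*$; $\mathsf P_X^*$ is faithful to $\gamma^*$ if $\mathbb I(\mathsf P_X^* )\subseteq\mathbb I(\gamma^* )$. Represented families. For $\gamma\in\Gamma^p$, $n\mathcal G\subseteq[p]$, $\mathcal P(\gamma,n\mathcal G)$ is the set of laws of random vectors $X$ such that $X_j=\sum_{k\in\mathrm{pa}^\gamma(j)}\beta_{jk}X_k+\eta_j$, $j\in[p]$, for some non-zero reals $\beta_{jk}$ and some mutually independent non-degenerate errors $\eta_1,\dots,\eta_p$ with $\eta_j$ non-Gaussian if and only if $j\in n\mathcal G$. Risk. For $\gamma\in\Gamma^p$, real $b=(b_{jk}:j\in[p],k\in\mathrm{pa}^\gamma(j))$ and $\theta\in(0,\infty)^p$, let $f^\gamma(x\mid b,\theta)=\prod_{j\in[p]}\frac1{2\theta_j}\exp\big(-\frac1{\theta_j}|x_j-\sum_{k\in\mathrm{pa}^\gamma(j)}b_{jk}x_k|\big)$, $h_\gamma=\min_{(b,\theta)}\big(-\mathsf E_*[\log f^\gamma(X\mid b,\theta)]\big)$ and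 $h_*=h_{\gamma^*}$. $\bar{\mathcal E}^*=\{\gamma\in\Gamma^p:h_\gamma=h_*\}$. Minimal risk equivalence class. $\bar{\mathcal E}_R^*$ is the set of $\gamma\in\Gamma^p$ satisfying: (1) for every $j\in n\mathcal G^*$, $\mathrm{pa}^\gamma(j)=\mathrm{pa}^*(j)$; and (2) for every $j\notin n\mathcal G^*$ there exist non-zero reals $\beta^\gamma_{jk}$, $k\in\mathrm{pa}^\gamma(j)$, such that $\eta_j^\gamma:=X_j-\sum_{k\in\mathrm{pa}^\gamma(j)}\beta^\gamma_{jk}X_k$ is a linear combination of the Gaussian errors $\epsilon_i$, $i\notin n\mathcal G^*$, and the $\eta^\gamma_j$, $j\notin n\mathcal G^*$, are pairwise independent. *)

(* Defs.v *)
From HB Require Import structures.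
From mathcomp Require Import all_boot all_order all_algebra.
From mathcomp Require Import all_classical all_reals all_analysis.

Set Implicit Arguments.
Unset Strict Implicit.
Unset Printing Implicit Defensive.

Import Order.TTheory GRing.Theory Num.Theory.
Import numFieldNormedType.Exports.

Local Open Scope classical_set_scope.
Local Open Scope ring_scope.

(** ** Directed acyclic graphs on 'I_p *)

Definition edge (p : nat) (E : {set 'I_p * 'I_p}) : rel 'I_p :=
  fun i j => (i, j) \in E.

(* A boolean form of the absence of directed cycles; see [acyclicP]. *)
Definition acyclic (p : nat) (E : {set 'I_p * 'I_p}) : bool :=
  [forall i, forall j, edge E i j ==> ~~ connect (edge E) j i].

Lemma acyclicP (p : nat) (E : {set 'I_p * 'I_p}) :
  reflect (forall c : seq 'I_p, c != [::] -> ~~ cycle (edge E) c) (acyclic E).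
Proof.
apply: (iffP forallP) => [acE [//|i c] _|nocyc i].
- rewrite /cycle rcons_path; apply/negP => /andP[pc ei].
  move: (acE (last i c)) => /forallP/(_ i); rewrite ei /= => /negP; apply.
  by apply/connectP; exists c.
- apply/forallP => j; apply/implyP => eij; apply/negP => /connectP[c pc ic].
  have /negP := nocyc (j :: c) isT; apply.
  by rewrite /cycle rcons_path pc -ic.
Qed.

Record dag (p : nat) := Dag {
  edges :> {set 'I_p * 'I_p};
  edges_acyclic : acyclic edges }.


Definition parents (p : nat) (g : dag p) (j : 'I_p) : {set 'I_p} :=
  [set k | edge g k j]%SET.

Definition supergraphs (p : nat) (g : dag p) : set (dag p) :=
  [set g' | edges g \subset edges g'].

(** ** d-separation *)

Definition adjacent (p : nat) (g : dag p) : rel 'I_p :=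
  fun i j => edge g i j || edge g j i.

Definition collider (p : nat) (g : dag p) (u v w : 'I_p) : bool :=
  edge g u v && edge g w v.

(* s = [:: a; ...; b] is a path of distinct nodes in the skeleton of g;
   it is blocked by C when one of its inner nodes v blocks it.  [connect] is
   reflexive, so v counts among its own descendants. *)
Definition blocked (p : nat) (g : dag p) (C : {set 'I_p}) (s : seq 'I_p) : Prop :=
  exists s1 s2 u v w, s = s1 ++ [:: u; v; w] ++ s2 /\
    if collider g u v w then [disjoint connect (edge g) v & C]%B else v \in C.

Definition d_separated (p : nat) (g : dag p) (A B C : {set 'I_p}) : Prop :=
  forall (a b : 'I_p) (s : seq 'I_p), a \in A -> b \in B ->
    path (adjacent g) a s -> uniq (a :: s) -> last a s = b ->
    blocked g C (a :: s).

(* The triple (A, B, C) stands for the relation "X_A independent of X_B given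
   X_C", for pairwise disjoint A, B, C. *)
Definition ci_triple (p : nat) : Type :=
  ({set 'I_p} * {set 'I_p} * {set 'I_p})%type.

Definition disjoint_triple (p : nat) (t : ci_triple p) : Prop :=
  let: (A, B, C) := t in
  [/\ [disjoint A & B]%B, [disjoint A & C]%B & [disjoint B & C]%B].

Definition graph_ci (p : nat) (g : dag p) : set (ci_triple p) :=
  [set t | disjoint_triple t /\ let: (A, B, C) := t in d_separated g A B C].

(** ** Independence and conditional independence *)

Definition independent2 d (T : measurableType d) (R : realType)
    (P : probability T R) (Y Z : T -> R) : Prop :=
  forall A B : set R, measurable A -> measurable B ->
    P (Y @^-1` A `&` Z @^-1` B) = (P (Y @^-1` A) * P (Z @^-1` B))%E.

Definition mutually_independent d (T : measurableType d) (R : realType)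
    (P : probability T R) (I : finType) (Y : I -> T -> R) : Prop :=
  forall (J : {set I}) (A : I -> set R), (forall i, measurable (A i)) ->
    P (\bigcap_(i in [set` J]) (Y i @^-1` A i)) =
    (\prod_(i in J) P (Y i @^-1` A i))%E.

(* f is a version of the conditional probability of E given the sub-sigma-algebra
   G. *)
Definition is_cond_prob d (T : measurableType d) (R : realType)
    (P : probability T R) (G : set (set T)) (E : set T) (f : T -> R) : Prop :=
  [/\ forall B : set R, measurable B -> G (f @^-1` B),
      P.-integrable setT (EFin \o f) &
      forall D, G D -> (\int[P]_(x in D) (f x)%:E)%E = P (E `&` D)].

Definition sigma_coord (R : realType) (p : nat) (A : {set 'I_p}) :
    set (set (p.-tuple R)) :=
  <<s [set E | exists2 i, i \in A & exists2 B : set R, measurable B &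
         E = (fun x : p.-tuple R => tnth x i) @^-1` B] >>.

(* Pr(E, F | X_C) = Pr(E | X_C) Pr(F | X_C) almost surely, for all events E of
   sigma(X_A) and F of sigma(X_B). *)
Definition cond_independent (R : realType) (p : nat)
    (mu : probability (p.-tuple R) R) (A B C : {set 'I_p}) : Prop :=
  forall E F, sigma_coord A E -> sigma_coord B F ->
    exists e f : p.-tuple R -> R,
      [/\ is_cond_prob mu (sigma_coord C) E e,
          is_cond_prob mu (sigma_coord C) F f &
          is_cond_prob mu (sigma_coord C) (E `&` F) (fun x => e x * f x)].

Definition law_ci (R : realType) (p : nat) (mu : probability (p.-tuple R) R) :
    set (ci_triple p) :=
  [set t | disjoint_triple t /\
           let: (A, B, C) := t in cond_independent mu A B C].

Definition faithful (R : realType) (p : nat) (mu : probability (p.-tuple R) R)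
    (g : dag p) : Prop := law_ci mu `<=` graph_ci g.

(** ** Structural equation models *)

Definition degenerate d (T : measurableType d) (R : realType)
    (P : probability T R) (Y : T -> R) : Prop :=
  exists c : R, {ae P, forall w, Y w = c}.

Definition gaussian d (T : measurableType d) (R : realType)
    (P : probability T R) (Y : T -> R) : Prop :=
  exists m s : R, 0 < s /\
    forall A : set R, measurable A -> P (Y @^-1` A) = normal_prob m s A.

Definition residual (R : realType) (p : nat) (g : dag p)
    (b : 'I_p -> 'I_p -> R) (x : p.-tuple R) (j : 'I_p) : R :=
  tnth x j - \sum_(k in parents g j) b j k * tnth x k.

(* Only the entries b j k with k a parent of j are coefficients; the others are
   ignored throughout. *)
Definition linear_sem d (T : measurableType d) (R : realType)
    (P : probability T R) (p : nat) (g : dag p) (b : 'I_p -> 'I_p -> R)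
    (X : T -> p.-tuple R) (eta : 'I_p -> T -> R) : Prop :=
  (forall j k, k \in parents g j -> b j k != 0) /\
  {ae P, forall w, forall j,
     tnth (X w) j = \sum_(k in parents g j) b j k * tnth (X w) k + eta j w}.

Record true_model d (T : measurableType d) (R : realType) (P : probability T R)
    (p : nat) (gstar : dag p) (bstar : 'I_p -> 'I_p -> R)
    (X : {RV P >-> p.-tuple R}) (eps lambda : 'I_p -> {RV P >-> R})
    (Q : 'I_p -> probability R R) : Prop := TrueModel {
  true_sem : linear_sem P gstar bstar X (fun j => eps j : T -> R);
  eps_independent : mutually_independent P (fun j => eps j : T -> R);
  lambda_independent : mutually_independent P (fun j => lambda j : T -> R);
  Q_positive : forall j, Q j `]0, +oo[%classic = 1%E;
  lambda_law : forall j (B : set R), measurable B ->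
    distribution P (lambda j) B = Q j B;
  (* The conditional law of eps j given lambda j = s is N(0, s^2);
     [normal_prob m s] is parametrized by the standard deviation s. *)
  eps_given_lambda : forall j (A B : set R), measurable A -> measurable B ->
    P (eps j @^-1` A `&` lambda j @^-1` B) =
    (\int[Q j]_(s in B) normal_prob 0 s A)%E;
  lambda_mean : forall j, ('E_P[lambda j] < +oo)%E }.

(* A centered normal scale mixture is Gaussian iff its mixing law is degenerate,
   so these are also the nodes j whose error eps j is not Gaussian. *)
Definition nonGaussian_nodes d (T : measurableType d) (R : realType)
    (P : probability T R) (p : nat) (lambda : 'I_p -> T -> R) : {set 'I_p} :=
  [set j | `[< ~ degenerate P (lambda j) >]]%SET.

Definition represented_laws (R : realType) (p : nat) (g : dag p)
    (nG : {set 'I_p}) : set (probability (p.-tuple R) R) :=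
  [set mu | exists d (T : measurableType d) (P : probability T R)
      (Y : {RV P >-> p.-tuple R}) (eta : 'I_p -> {RV P >-> R})
      (b : 'I_p -> 'I_p -> R),
    [/\ forall A, measurable A -> mu A = distribution P Y A,
        linear_sem P g b Y (fun j => eta j : T -> R),
        mutually_independent P (fun j => eta j : T -> R),
        forall j, ~ degenerate P (eta j) &
        forall j, ~ gaussian P (eta j) <-> j \in nG]].

(** ** Laplace risk *)

Definition laplace_density (R : realType) (p : nat) (g : dag p)
    (b : 'I_p -> 'I_p -> R) (theta : 'I_p -> R) (x : p.-tuple R) : R :=
  \prod_(j < p) ((2 * theta j)^-1 *
                 expR (- ((theta j)^-1 * `|residual g b x j|))).

Definition risks d (T : measurableType d) (R : realType) (P : probability T R)
    (p : nat) (X : T -> p.-tuple R) (g : dag p) : set (\bar R) :=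
  [set r | exists (b : 'I_p -> 'I_p -> R) (theta : 'I_p -> R),
     (forall j, 0 < theta j) /\
     r = (- 'E_P[fun w => ln (laplace_density g b theta (X w))])%E].

(* h is the minimum (and is attained) of the risk over (b, theta). *)
Definition is_min_risk d (T : measurableType d) (R : realType)
    (P : probability T R) (p : nat) (X : T -> p.-tuple R) (g : dag p)
    (h : \bar R) : Prop :=
  risks P X g h /\ lbound (risks P X g) h.

Definition risk_class d (T : measurableType d) (R : realType)
    (P : probability T R) (p : nat) (X : T -> p.-tuple R) (gstar : dag p) :
    set (dag p) :=
  [set g | exists h, is_min_risk P X g h /\ is_min_risk P X gstar h].

(** ** Minimal risk equivalence class *)

Definition minimal_risk_class d (T : measurableType d) (R : realType)
    (P : probability T R) (p : nat) (X : T -> p.-tuple R)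
    (eps : 'I_p -> T -> R) (gstar : dag p) (nG : {set 'I_p}) : set (dag p) :=
  [set g |
    (forall j, j \in nG -> parents g j = parents gstar j) /\
    exists b : 'I_p -> 'I_p -> R,
      let eta j w := residual g b (X w) j in
      [/\ forall j k, j \notin nG -> k \in parents g j -> b j k != 0,
          forall j, j \notin nG -> exists c : 'I_p -> R,
            {ae P, forall w, eta j w = \sum_(i | i \notin nG) c i * eps i w} &
          forall i j, i \notin nG -> j \notin nG -> i != j ->
            independent2 P (eta i) (eta j)]].

(* Main.v *)
Require Import Defs.
From HB Require Import structures.
From mathcomp Require Import all_boot all_order all_algebra.
From mathcomp Require Import all_classical all_reals all_analysis.
From mathcomp Require Import fingroup perm measurable_realfun ring lra.

Set Implicit Arguments.
Unset Strict Implicit.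
Unset Printing Implicit Defensive.

Import Order.TTheory GRing.Theory Num.Theory.
Import numFieldNormedType.Exports.

Local Open Scope classical_set_scope.
Local Open Scope ring_scope.

(* Write the residuals of a DAG g with coefficients b as A eps, where
   A = (I - B) (I - B')^-1, with B' the true coefficients, has determinant 1.  Given the scales lambda, (A eps)_j is
   centered normal, so E|(A eps)_j| is, up to a constant, the mean of
   sqrt(sum_i A_ji^2 lambda_i^2), which is at least sqrt(sum_i A_ji^2 m_i^2) for
   m = E lambda.  Minimizing the risk over theta leaves the product of these means,
   which by Hadamard's inequality is at least the product of the m_i, its value for
   the true model.  Equality holds iff A is "decoupling": its rows are orthogonal for
   the weights m^2 and a non-Gaussian error never shares a row with another error.
   Leibniz' formula and acyclicity show that such an A fixes the non-Gaussian nodes;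
   the remaining residuals are orthogonal combinations of independent normal
   variables, hence independent.  Conversely independent residuals give a decoupling
   A by a Darmois-Skitovich theorem, which for scale mixtures only needs
   Cauchy-Schwarz and Chebyshev's inequality. *)

(** * Gaussian integrals *)

(** The model makes the family [eps] independent and the family [lambda] independent, and couples
    [eps j] with [lambda j] for one j at a time. Conditioning on all scales at once is therefore
    replaced by statements about laws: [scale_mixture P Y L] says that [Y] is distributed as [L]
    times an independent standard normal variable, and linear combinations preserve this because
    planar rotations preserve the normal law. The characteristic function of such a mixture is a
    mean of positive values that decrease strictly with the scale. This is why equality cases
    suffice for Darmois-Skitovich: in an equality between products whose factors satisfy
    inequalities, all factors must agree. Product formulas are proved for nonnegative integrands;
    bounded ones such as [cos] are first raised by 1. The classes of graphs are never compared
    directly. Each is compared with [decoupled g]: some coefficients, non-zero on all edges of g,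
    give a decoupling A. A risk minimizer may vanish on some edges of g'; deleting them produces the
    g below g', whence a union of supergraph sets. *)

Section normal_integral.
Context {R : realType}.
Local Notation leb := (@lebesgue_measure R).
Local Notation N01 := (normal_prob (0 : R) 1).

(** The Radon-Nikodym derivative of the normal law is determined only up to null sets; it is a.e.
    [normal_pdf] because both have the same integral over every measurable set. *)
Lemma ge0_integral_normal_prob (m s : R) (f : R -> \bar R) :
  measurable_fun setT f -> (forall x, 0 <= f x)%E ->
  (\int[normal_prob m s]_x f x = \int[leb]_x (f x * (normal_pdf m s x)%:E))%E.
Proof.
move=> mf f0.
have dom := normal_prob_dominates m s.
rewrite -(Radon_Nikodym_SigmaFinite.change_of_variables dom f0 measurableT mf).
apply: ae_eq_integral => //.
- apply: emeasurable_funM => //; apply: measurable_int.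
  exact: Radon_Nikodym_SigmaFinite.f_integrable.
- apply: emeasurable_funM => //; apply/measurable_EFinP.
  exact: measurable_normal_pdf.
- apply: ae_eqe_mul2l; apply: integral_ae_eq => //.
  + exact: Radon_Nikodym_SigmaFinite.f_integrable.
  + by apply/measurable_EFinP; exact: measurable_normal_pdf.
  + by move=> E _ mE; rewrite -Radon_Nikodym_SigmaFinite.f_integral.
Qed.

Lemma measurable_affine (a b : R) : measurable_fun [set: R] (fun x : R => a * x + b).
Proof. by apply: measurable_funD => //; exact: mulrl_measurable. Qed.

Lemma ge0_integral_affine (a b : R) (f : R -> \bar R) : a != 0 ->
  measurable_fun setT f -> (forall x, 0 <= f x)%E ->
  (\int[leb]_x f x = `|a|%:E * \int[leb]_x f (a * x + b)%R)%E.
Proof.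
move=> a0 mf f0.
pose h : R -> measurableTypeR R := fun x => a * x + b.
have mh : measurable_fun [set: measurableTypeR R] h.
  exact: measurable_affine.
have na : 0 <= `|a| by [].
(* The image of Lebesgue measure under the inverse affine map is recovered from intervals: |a| times
   the length of the preimage of ]x, y] is y - x. For a < 0 the preimage is closed on the left and
   open on the right, with the same length. *)
have E : forall A, measurable A ->
    leb A = mscale (NngNum na) (pushforward leb h) A.
  move=> A mA.
  apply: (lebesgue_measure_unique
    (mu := mscale (NngNum na) (pushforward leb h))) => //.
  move=> _ [[x y] /= _ <-].
  rewrite /mscale/= /pushforward.
  have [a_gt0|a_lt0|] := ltrgt0P a; last by move/eqP; rewrite (negPf a0).
  - have -> : h @^-1` `]x, y]%classic = `](x - b) / a, (y - b) / a]%classic.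
      apply/seteqP; split => z; rewrite /h /= !in_itv/=;
        rewrite ltr_pdivrMr// ler_pdivlMr// ltrBlDr lerBrDr (mulrC z)//.
    rewrite !lebesgue_measure_itv/= !lte_fin ltr_pM2r ?invr_gt0// ltrD2r.
    case: ifP => // xy; last by rewrite mule0.
    rewrite -EFinB -EFinM; congr EFin; field => //.
  - have -> : h @^-1` `]x, y]%classic = `[(y - b) / a, (x - b) / a[%classic.
      apply/seteqP; split => z; rewrite /h /= !in_itv/=;
        by rewrite ltr_ndivlMr// ler_ndivrMr// ltrBlDr lerBrDr (mulrC z)// andbC.
    rewrite !lebesgue_measure_itv/= !lte_fin ltr_nM2r ?invr_lt0// ltrD2r.
    case: ifP => // xy; last by rewrite mule0.
    rewrite -EFinB -EFinM; congr EFin; field => //.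
rewrite (@eq_measure_integral _ _ _ _ (mscale (NngNum na) (pushforward leb h))); last first.
  by move=> A mA _; exact: E.
rewrite ge0_integral_mscale//=; congr (_ * _)%E.
by rewrite ge0_integral_pushforward.
Qed.

Lemma normal_pdf1E (x : R) :
  normal_pdf 0 1 x = normal_peak 1 * expR (- (x ^+ 2 / 2)).
Proof.
rewrite normal_pdfE ?oner_neq0// /normal_fun subr0 expr1n mulNr.
by [].
Qed.

Lemma normal_pdfN (x : R) : normal_pdf 0 1 (- x) = normal_pdf 0 1 x :> R.
Proof. by rewrite !normal_pdf1E sqrrN. Qed.

Lemma normal_peak_scale (s : R) : s != 0 -> normal_peak s = `|s|^-1 * normal_peak 1.
Proof.
move=> s0; rewrite /normal_peak expr1n mul1r -mulrnAr.
by rewrite sqrtrM ?sqr_ge0// sqrtr_sqr invfM.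
Qed.

(** Substitute x = s y + m: the factor |s| of the substitution cancels the |s|^-1 of the normalizing
    constant, so s may be negative. *)
Lemma ge0_integral_normal_scale (m s : R) (f : R -> \bar R) : s != 0 ->
  measurable_fun setT f -> (forall x, 0 <= f x)%E ->
  (\int[normal_prob m s]_x f x = \int[N01]_y f (s * y + m)%R)%E.
Proof.
move=> s0 mf f0.
have mfs : measurable_fun [set: R] (fun y : R => f (s * y + m)%R).
  by apply: measurableT_comp => //; exact: measurable_affine.
rewrite (ge0_integral_normal_prob m s mf f0).
rewrite (ge0_integral_normal_prob 0 1 mfs (fun y => f0 _)).
rewrite (ge0_integral_affine m s0); last 2 first.
- apply: emeasurable_funM => //; apply/measurable_EFinP.
  exact: measurable_normal_pdf.
- by move=> x; rewrite mule_ge0// lee_fin normal_pdf_ge0.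
rewrite -ge0_integralZl//; last 2 first.
- apply: emeasurable_funM => //; apply/measurable_EFinP.
  by apply: measurableT_comp (measurable_affine s m); exact: measurable_normal_pdf.
- by move=> x _; rewrite mule_ge0// lee_fin normal_pdf_ge0.
apply: eq_integral => x _.
rewrite muleCA; congr (_ * _)%E.
rewrite -EFinM; congr EFin.
rewrite normal_pdf1E normal_pdfE// /normal_fun addrK normal_peak_scale// !mulrA.
rewrite divff ?normr_eq0// mul1r; congr (_ * expR _).
by field.
Qed.

Lemma integral_normalN (f : R -> \bar R) :
  measurable_fun setT f -> (forall x, 0 <= f x)%E ->
  (\int[N01]_x f (- x)%R = \int[N01]_x f x)%E.
Proof.
move=> mf f0; have N10 : (-1 : R) != 0 by rewrite oppr_eq0 oner_neq0.
rewrite !ge0_integral_normal_prob//; last first.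
  by apply: measurableT_comp => //; exact: oppr_measurable.
rewrite [RHS](ge0_integral_affine 0 N10).
- rewrite normrN1 mul1e; apply: eq_integral => x _.
  by rewrite addr0 mulN1r normal_pdfN.
- apply: emeasurable_funM => //; apply/measurable_EFinP.
  exact: measurable_normal_pdf.
- by move=> x; rewrite mule_ge0// lee_fin normal_pdf_ge0.
Qed.

End normal_integral.

(** * Rotation invariance of the planar standard normal law *)

Section planar_rotation.
Context {R : realType}.
Local Notation leb := (@lebesgue_measure R).
Local Notation N01 := (normal_prob (0 : R) 1).
Local Notation phi := (@normal_pdf R 0 1).

Let mphi : measurable_fun [set: R] phi.
Proof. exact: measurable_normal_pdf. Qed.

Let phi0 x : 0 <= phi x. Proof. exact: normal_pdf_ge0. Qed.

Let leb_tonelli (F : R * R -> \bar R) :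
  measurable_fun setT F -> (forall z, 0 <= F z)%E ->
  (\int[leb]_x \int[leb]_y F (x, y) = \int[leb]_y \int[leb]_x F (x, y))%E.
Proof.
move=> mF F0.
exact: (@fubini_tonelli _ _ (measurableTypeR R) (measurableTypeR R) R leb leb F).
Qed.

Let integral_normal2 (f : R * R -> \bar R) :
  measurable_fun setT f -> (forall z, 0 <= f z)%E ->
  (\int[N01]_x \int[N01]_y f (x, y) =
   \int[leb]_x \int[leb]_y (f (x, y) * (phi x * phi y)%:E))%E.
Proof.
move=> mf f0.
rewrite ge0_integral_normal_prob; last 2 first.
- exact: (measurable_fun_fubini_tonelli_F (m2 := N01) f).
- by move=> x; exact: integral_ge0.
apply: eq_integral => x _.
have mfx : measurable_fun [set: R] (fun y => f (x, y)).
  by apply: measurableT_comp => //; exact: pair1_measurable.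
rewrite ge0_integral_normal_prob//.
rewrite -ge0_integralZr//; last 3 first.
- by apply: emeasurable_funM => //; exact/measurable_EFinP.
- by move=> y _; rewrite mule_ge0// lee_fin.
- by rewrite lee_fin.
by apply: eq_integral => y _; rewrite -muleA -EFinM (mulrC (phi y)).
Qed.

(** For c != 0 a rotation is made of two one-dimensional affine substitutions: x = (x' - s y) / c
    with y fixed, then, after exchanging the integrals, y = c y' + s x with x fixed. The factors
    1/|c| and |c| cancel, and the density depends on x^2 + y^2 only. *)
Let rotation_neq0 (c s : R) (f : R * R -> \bar R) :
  c != 0 -> c ^+ 2 + s ^+ 2 = 1 ->
  measurable_fun setT f -> (forall z, 0 <= f z)%E ->
  (\int[N01]_x \int[N01]_y f (c * x + s * y, c * y - s * x)%R =
   \int[N01]_x \int[N01]_y f (x, y))%E.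
Proof.
move=> c0 cs mf f0.
have cV0 : c^-1 != 0 by rewrite invr_eq0.
pose lin a b := fun z : R * R => a * z.1 + b * z.2.
have mlin a b : measurable_fun [set: R * R] (lin a b).
  apply: measurable_funD; apply: measurableT_comp => //; exact: mulrl_measurable.
have mf' (g h : R * R -> R) : measurable_fun setT g -> measurable_fun setT h ->
    measurable_fun setT (fun z => f (g z, h z)).
  move=> mg mh; apply: measurableT_comp => //.
  exact/measurable_fun_pairP.
have mE (g h : R * R -> R) : measurable_fun setT g -> measurable_fun setT h ->
    measurable_fun setT (fun z => (phi (g z) * phi (h z))%:E).
  move=> mg mh; apply/measurable_EFinP; apply: measurable_funM;
  by apply: measurableT_comp mphi _.
have m1 : measurable_fun [set: R * R] (fun z : R * R => z.1) by exact: measurable_fst.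
have m2 : measurable_fun [set: R * R] (fun z : R * R => z.2) by exact: measurable_snd.
pose F1 (z : R * R) := (f (c * z.1 + s * z.2, c * z.2 - s * z.1)%R *
  (phi z.1 * phi z.2)%:E)%E.
have mF1 : measurable_fun setT F1.
  apply: emeasurable_funM; last exact: mE.
  apply: mf'; first exact: (mlin c s).
  by have := mlin (- s) c; apply: eq_measurable_fun => z _; rewrite /lin mulNr addrC.
have F10 z : (0 <= F1 z)%E by rewrite mule_ge0// lee_fin mulr_ge0.
pose F2 (z : R * R) := (f (z.1, c^-1 * z.2 - c^-1 * s * z.1)%R *
  (phi (c^-1 * z.1 - c^-1 * s * z.2) * phi z.2)%:E)%E.
have mF2 : measurable_fun setT F2.
  apply: emeasurable_funM.
    apply: mf' => //.
    have := mlin (- (c^-1 * s)) (c^-1); apply: eq_measurable_fun => z _.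
    by rewrite /lin mulNr addrC.
  apply: mE => //.
  have := mlin (c^-1) (- (c^-1 * s)); apply: eq_measurable_fun => z _.
  by rewrite /lin mulNr.
have F20 z : (0 <= F2 z)%E by rewrite mule_ge0// lee_fin mulr_ge0.
rewrite [RHS](integral_normal2 mf f0).
have mfr : measurable_fun setT
    (fun z : R * R => f (c * z.1 + s * z.2, c * z.2 - s * z.1)%R).
  apply: mf'; first exact: (mlin c s).
  by have := mlin (- s) c; apply: eq_measurable_fun => z _; rewrite /lin mulNr addrC.
rewrite [LHS](integral_normal2 mfr (fun z => f0 _)) /=.
transitivity (\int[leb]_y \int[leb]_x F1 (x, y))%E; first exact: leb_tonelli.
transitivity (\int[leb]_y \int[leb]_x (`|c^-1|%:E * F2 (x, y)))%E.
  apply: eq_integral => y _.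
  have mF1y : measurable_fun [set: R] (fun x => F1 (x, y)).
    by apply: measurableT_comp => //; exact: pair2_measurable.
  rewrite (ge0_integral_affine (- (c^-1 * s * y)) cV0)// -ge0_integralZl//.
  - apply: eq_integral => x _; congr (_ * _)%E; rewrite /F1 /F2/=.
    congr (f (_, _) * _)%E.
    + by field.
    + by rewrite -[in RHS](mul1r y) -cs; field.
  - exact: (measurableT_comp mF1y (measurable_affine _ _)).
have mF2c : measurable_fun setT (fun z => `|c^-1|%:E * F2 z)%E.
  by apply: emeasurable_funM.
transitivity (\int[leb]_x \int[leb]_y (`|c^-1|%:E * F2 (x, y)))%E.
  apply/esym/(leb_tonelli mF2c).
  by move=> z; rewrite mule_ge0.
apply: eq_integral => x _.
have mF2x : measurable_fun [set: R] (fun y => F2 (x, y)).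
  by apply: measurableT_comp => //; exact: pair1_measurable.
rewrite ge0_integralZl// (ge0_integral_affine (s * x) c0)// muleA -EFinM.
rewrite normfV mulVf ?normr_eq0// mul1e.
apply: eq_integral => y _; rewrite /F2/=.
congr (f (_, _) * _%:E)%E; first by field.
rewrite !normal_pdf1E mulrACA -expRD [RHS]mulrACA -expRD; congr (_ * expR _).
have -> : c^-1 * x - c^-1 * s * (c * y + s * x) = c * x - s * y.
  by rewrite -[in X in c^-1 * X - _](mul1r x) -cs; field.
have -> : x ^+ 2 = (c ^+ 2 + s ^+ 2) * x ^+ 2 by rewrite cs mul1r.
have -> : y ^+ 2 = (c ^+ 2 + s ^+ 2) * y ^+ 2 by rewrite cs mul1r.
by field.
Qed.

Lemma normal_rotation (c s : R) (f : R * R -> \bar R) :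
  c ^+ 2 + s ^+ 2 = 1 ->
  measurable_fun setT f -> (forall z, 0 <= f z)%E ->
  (\int[N01]_x \int[N01]_y f (c * x + s * y, c * y - s * x)%R =
   \int[N01]_x \int[N01]_y f (x, y))%E.
Proof.
have [->|c0] := eqVneq c 0; last exact: rotation_neq0.
(* When c = 0, s is 1 or -1 and the rotation is an exchange of coordinates combined with a
   reflection. *)
rewrite expr0n add0r => /eqP; rewrite sqrf_eq1 => s1 mf f0.
pose g (z : R * R) := f (s * z.2, - s * z.1)%R.
have mg : measurable_fun setT g.
  apply: measurableT_comp => //; apply/measurable_fun_pairP; split.
    exact: (measurableT_comp (mulrl_measurable s) measurable_snd).
  exact: (measurableT_comp (mulrl_measurable (- s)) measurable_fst).
transitivity (\int[N01]_x \int[N01]_y g (x, y))%E.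
  apply: eq_integral => x _; apply: eq_integral => y _.
  by rewrite /g/= !mul0r !add0r mulNr.
rewrite (fubini_tonelli (m1 := N01) (m2 := N01) g)//; last first.
  by move=> z; exact: f0.
have sE (h : R -> \bar R) (e : R) : (e == 1) || (e == -1) ->
    measurable_fun setT h -> (forall x, 0 <= h x)%E ->
    (\int[N01]_x h (e * x)%R = \int[N01]_x h x)%E.
  move=> /orP[]/eqP-> mh h0.
    by under eq_integral do rewrite mul1r.
  by under eq_integral do rewrite mulN1r; exact: integral_normalN.
transitivity (\int[N01]_y \int[N01]_x f (s * y, x)%R)%E.
  apply: eq_integral => y _; rewrite /g/=.
  rewrite (sE (fun x => f (s * y, x)%R))//.
    by case/orP: s1 => /eqP->; rewrite ?opprK eqxx ?orbT.
  by apply: measurableT_comp => //; exact: pair1_measurable.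
rewrite (sE (fun y => \int[N01]_x f (y, x))%E)//.
- exact: (measurable_fun_fubini_tonelli_F (m2 := N01) f).
- by move=> x; exact: integral_ge0.
Qed.

End planar_rotation.

(** * Independence and scale mixtures *)

Section joint_law.
Context d (T : measurableType d) (R : realType) (P : probability T R).

Lemma integral_indep d1 d2 (S1 : measurableType d1) (S2 : measurableType d2)
    (V : T -> S1) (W : T -> S2) (f : S1 * S2 -> \bar R) :
  measurable_fun setT V -> measurable_fun setT W ->
  (forall A B, measurable A -> measurable B ->
    P (V @^-1` A `&` W @^-1` B) = (P (V @^-1` A) * P (W @^-1` B))%E) ->
  measurable_fun setT f -> (forall z, 0 <= f z)%E ->
  (\int[P]_w f (V w, W w) = \int[P]_w \int[P]_w' f (V w, W w'))%E.
Proof.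
move=> mV mW VW mf f0.
have mVW : measurable_fun setT (fun w => (V w, W w)).
  exact/measurable_fun_pairP.
pose V' : {mfun T >-> S1} := HB.pack V (isMeasurableFun.Build _ _ _ _ V mV).
pose W' : {mfun T >-> S2} := HB.pack W (isMeasurableFun.Build _ _ _ _ W mW).
pose VW' : {mfun T >-> (S1 * S2)%type} :=
  HB.pack (fun w => (V w, W w)) (isMeasurableFun.Build _ _ _ _ _ mVW).
transitivity (\int[distribution P VW']_z f z)%E.
  by rewrite ge0_integral_distribution.
transitivity (\int[distribution P V' \x distribution P W']_z f z)%E.
  apply: eq_measure_integral => A mA _; apply/esym.
  by apply: product_measure_unique => // B C mB mC; exact: VW.
rewrite fubini_tonelli1// ge0_integral_distribution//; last 2 first.
- exact: measurable_fun_fubini_tonelli_F.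
- by move=> x; exact: integral_ge0.
apply: eq_integral => w _ /=.
rewrite /fubini_F ge0_integral_distribution//.
by apply: measurableT_comp => //; exact: pair1_measurable.
Qed.

End joint_law.

(** * Independence of disjoint groups of variables *)

Section grouping.
Context d (T : measurableType d) (R : realType) (P : probability T R).
Context (I : finType) (Y : I -> T -> R).
Hypothesis mY : forall i, measurable_fun setT (Y i).
Hypothesis indepY : mutually_independent P Y.

Definition cylinders (S : {set I}) : set (set T) :=
  [set E | exists2 A : I -> set R, forall i, measurable (A i) &
    E = \bigcap_(i in [set` S]) (Y i @^-1` A i)].

Lemma cylinders_measurable S : cylinders S `<=` measurable.
Proof.
move=> _ [A mA ->]; apply: fin_bigcap_measurable; first exact: finite_finset.
by move=> i _; rewrite -[X in measurable X]setTI; exact: mY.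
Qed.

Lemma sigma_cylinders_measurable S : <<s cylinders S >> `<=` measurable.
Proof.
exact: smallest_sub (@sigma_algebra_measurable _ T) (@cylinders_measurable S).
Qed.

Lemma cylindersI S : setI_closed (cylinders S).
Proof.
move=> _ _ [A mA ->] [B mB ->]; exists (fun i => A i `&` B i).
  by move=> i; exact: measurableI.
by rewrite -bigcapI; apply: eq_bigcapr => i _; rewrite preimage_setI.
Qed.

Lemma cylindersT S : cylinders S setT.
Proof.
exists (fun=> setT) => //; apply/esym.
by rewrite bigcapT// => i _; rewrite preimage_setT.
Qed.

(** As functions of E, the probability of E and D together and [P E * P D] are finite measures that
    agree on the cylinders, a family closed under intersection; so they agree on the sigma-algebra
    it generates. *)
Let extend (S : {set I}) (D : set T) : measurable D ->
  (forall E, cylinders S E -> P (E `&` D) = (P E * P D)%E) ->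
  forall E, <<s cylinders S >> E -> P (E `&` D) = (P E * P D)%E.
Proof.
move=> mD PD E sE.
have PDfin : P D \is a fin_num by exact: fin_num_measure.
have PD0 : 0 <= fine (P D) by rewrite fine_ge0.
have -> : (P E * P D)%E = mscale (NngNum PD0) P E.
  by rewrite /mscale/= fineK// muleC.
rewrite -[LHS]/(mrestr P mD E).
apply: (g_sigma_algebra_measure_unique (cylinders S) _ (fun=> setT)) => //.
- exact: cylinders_measurable.
- by move=> i; exact: cylindersT.
- by rewrite bigcup_const//; exists 0%N.
- exact: cylindersI.
- by move=> A SA; rewrite /= /mrestr PD// muleC /mscale/= fineK.
- move=> _ /=; rewrite /mrestr setTI.
  by rewrite (le_lt_trans (probability_le1 P mD))// ltry.
Qed.

(** [extend] is applied to each side in turn. For two cylinders, the two families of Borel sets are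
    glued into one over the union of the disjoint index sets. *)
Lemma indep_groups (S S' : {set I}) (E F : set T) : [disjoint S & S']%B ->
  <<s cylinders S >> E -> <<s cylinders S' >> F -> P (E `&` F) = (P E * P F)%E.
Proof.
move=> dSS' sE sF.
apply: extend sE; first exact: sigma_cylinders_measurable sF.
move=> {}E cE; rewrite setIC muleC; apply: extend sF.
  exact: cylinders_measurable cE.
case: cE => A mA -> {}F [B mB ->].
have -> : \bigcap_(i in [set` S']) (Y i @^-1` B i) `&`
          \bigcap_(i in [set` S]) (Y i @^-1` A i) =
          \bigcap_(i in [set` S' :|: S]) (Y i @^-1` (if i \in S then A i else B i)).
  apply/seteqP; split => w.
  - move=> [wB wA] i /=; rewrite inE; case: ifPn => [iS _|iS]; first exact: wA.
    by rewrite orbF => iS'; exact: wB.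
  - move=> H; split => i /= iS.
    + have /= := H i; rewrite inE iS => /(_ isT).
      by rewrite (disjointFl dSS' iS).
    + by have /= := H i; rewrite inE iS orbT => /(_ isT).
rewrite !indepY//; last by move=> i; case: ifP.
have -> : (\prod_(i in S' :|: S) P (Y i @^-1` (if i \in S then A i else B i)) =
    \prod_(i in [predU S' & S]) P (Y i @^-1` (if i \in S then A i else B i)))%E.
  by apply: eq_bigl => i; rewrite inE.
rewrite bigU//; last by rewrite disjoint_sym.
congr (_ * _)%E; apply: eq_bigr => i iS; last by rewrite iS.
by rewrite (disjointFl dSS' iS).
Qed.

End grouping.

Lemma finset_ind (I : finType) (Q : {set I} -> Prop) : Q finset.set0 ->
  (forall k (S : {set I}), k \notin S -> Q S -> Q (k |: S)%SET) -> forall S, Q S.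
Proof.
move=> Q0 QU S; elim: {S}_.+1 {-2}S (ltnSn #|S|) => // n IH S; rewrite ltnS => Sn.
have [->//|[k kS]] := set_0Vmem S.
rewrite -(finset.setD1K kS); apply: QU; first by rewrite !inE eqxx.
by apply: IH; rewrite (leq_trans _ Sn)// [X in (_ < X)%N](cardsD1 k) kS.
Qed.

Lemma integral_prob_cst d (T : measurableType d) (R : realType)
  (P : probability T R) (r : \bar R) : (\int[P]__ r = r)%E.
Proof.
transitivity (r * P setT)%E; last by rewrite probability_setT mule1.
exact: (integral_cst P measurableT r).
Qed.

Section adapted.
Context d (T : measurableType d) (R : realType) (P : probability T R).
Context (I : finType) (Y : I -> T -> R).
Hypothesis mY : forall i, measurable_fun setT (Y i).
Hypothesis indepY : mutually_independent P Y.

(** Measurability for the sigma-algebra generated by the [Y i] with i in S. Attaching this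
    sigma-algebra to the source type lets the closure properties of measurable functions apply as
    they stand. *)
Definition adapted d' (U : measurableType d') (S : {set I}) (Z : T -> U) :=
  @measurable_fun _ _ (g_sigma_algebraType (cylinders Y S)) U setT Z.

Lemma adapted_preimage d' (U : measurableType d') S (Z : T -> U) B :
  adapted S Z -> measurable B -> <<s cylinders Y S >> (Z @^-1` B).
Proof.
by move=> aZ mB; have := aZ measurableT _ mB; rewrite setTI.
Qed.

Lemma adapted_measurable d' (U : measurableType d') S (Z : T -> U) :
  adapted S Z -> measurable_fun setT Z.
Proof.
move=> aZ _ B mB; rewrite setTI.
exact: (sigma_cylinders_measurable mY (adapted_preimage aZ mB)).
Qed.

Lemma adapted_coord (S : {set I}) i : i \in S -> adapted S (Y i).
Proof.
move=> iS _ B mB; rewrite setTI; apply: sub_sigma_algebra.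
exists (fun j => if j == i then B else setT); first by move=> j; case: ifP.
apply/seteqP; split => w /=.
- by move=> YB j _ /=; case: eqP => // ->.
- by move=> /(_ i iS) /=; rewrite eqxx.
Qed.

Lemma adapted_sum (S : {set I}) (h : I -> R -> R) :
  (forall i, measurable_fun setT (h i)) ->
  adapted S (fun w => \sum_(i in S) h i (Y i w)).
Proof.
move=> mh; rewrite (_ : (fun w => _) =
    fun w => \sum_i if i \in S then h i (Y i w) else 0); last first.
  by apply/funext => w; exact: big_mkcond.
apply: measurable_sum => i; case: (boolP (i \in S)) => iS //.
exact: (measurableT_comp (mh i) (adapted_coord iS)).
Qed.

Lemma adapted_prod (S : {set I}) (h : I -> R -> R) :
  (forall i, measurable_fun setT (h i)) ->
  adapted S (fun w => \prod_(i in S) h i (Y i w)).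
Proof.
move=> mh; rewrite (_ : (fun w => _) =
    fun w => \prod_i if i \in S then h i (Y i w) else 1); last first.
  by apply/funext => w; exact: big_mkcond.
apply: measurable_prod => i _; case: (boolP (i \in S)) => iS //.
exact: (measurableT_comp (mh i) (adapted_coord iS)).
Qed.

Lemma indep_adapted d1 d2 (U1 : measurableType d1) (U2 : measurableType d2)
    (S S' : {set I}) (Z : T -> U1) (Z' : T -> U2) A B :
  [disjoint S & S']%B -> adapted S Z -> adapted S' Z' ->
  measurable A -> measurable B ->
  P (Z @^-1` A `&` Z' @^-1` B) = (P (Z @^-1` A) * P (Z' @^-1` B))%E.
Proof.
move=> SS' aZ aZ' mA mB.
by apply: (indep_groups mY indepY SS'); exact: adapted_preimage.
Qed.

Lemma integral_indep_adapted d1 d2 (U1 : measurableType d1) (U2 : measurableType d2)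
    (S S' : {set I}) (Z : T -> U1) (Z' : T -> U2) (f : U1 * U2 -> \bar R) :
  [disjoint S & S']%B -> adapted S Z -> adapted S' Z' ->
  measurable_fun setT f -> (forall z, 0 <= f z)%E ->
  (\int[P]_w f (Z w, Z' w) = \int[P]_w \int[P]_w' f (Z w, Z' w'))%E.
Proof.
move=> SS' aZ aZ'; apply: integral_indep.
- exact: adapted_measurable aZ.
- exact: adapted_measurable aZ'.
- by move=> A B; exact: (indep_adapted SS' aZ aZ').
Qed.

Lemma integral_prod_indep (S : {set I}) (h : I -> R -> R) :
  (forall i, measurable_fun setT (h i)) -> (forall i x, 0 <= h i x) ->
  (\int[P]_w (\prod_(i in S) h i (Y i w))%:E =
   \prod_(i in S) \int[P]_w (h i (Y i w))%:E)%E.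
Proof.
move=> mh h0; elim/finset_ind: S => [|k S kS IH].
  rewrite big_set0; under eq_integral do rewrite big_set0.
  exact: integral_prob_cst.
rewrite finset.big_setU1//= -IH.
(* The absolute values make [f] nonnegative on the whole plane, as the product formula requires; on
   the nonnegative values of [h k] and [Z] they change nothing. *)
pose f (z : R * R) : \bar R := (`|z.1| * `|z.2|)%:E.
have mf : measurable_fun setT f.
  by apply/measurable_EFinP; apply: measurable_funM; exact: measurableT_comp.
pose Z w := \prod_(i in S) h i (Y i w).
have Z0 w : 0 <= Z w by exact: prodr_ge0.
transitivity (\int[P]_w f (h k (Y k w), Z w))%E.
  by apply: eq_integral => w _; rewrite finset.big_setU1//= /f/= !ger0_norm.
rewrite (@integral_indep_adapted _ _ _ _ [set k]%SET S (fun w => h k (Y k w)) Z)//.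
- rewrite -ge0_integralZr//.
  + apply: eq_integral => w _; rewrite -ge0_integralZl//.
    * by apply: eq_integral => w' _; rewrite /f/= !ger0_norm.
    * by apply/measurable_EFinP; exact: (adapted_measurable (adapted_prod mh)).
    * by move=> w' _; rewrite lee_fin; exact: Z0.
    * by rewrite lee_fin.
  + by apply/measurable_EFinP; exact: measurableT_comp.
  + by move=> w _; rewrite lee_fin.
  + by apply: integral_ge0 => w _; rewrite lee_fin; exact: Z0.
- by rewrite disjoints1.
- by apply: (measurableT_comp (mh k)); apply: adapted_coord; rewrite inE.
- exact: adapted_prod.
- by move=> z; rewrite lee_fin mulr_ge0.
Qed.

End adapted.

(** * Sums of normal variables and of their scale mixtures *)

Section normal_convolution.
Context {R : realType}.
Local Notation N01 := (normal_prob (0 : R) 1).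

(** With r the root on the right, the rotation of cosine t/r and sine u/r turns t x + u y into r
    times the first coordinate, and the second coordinate integrates out. *)
Lemma normal_convolution (t u : R) (f : R -> \bar R) :
  measurable_fun setT f -> (forall x, 0 <= f x)%E ->
  (\int[N01]_x \int[N01]_y f (t * x + u * y)%R =
   \int[N01]_x f (Num.sqrt (t ^+ 2 + u ^+ 2) * x)%R)%E.
Proof.
move=> mf f0.
pose r := Num.sqrt (t ^+ 2 + u ^+ 2).
have r2 : r ^+ 2 = t ^+ 2 + u ^+ 2 by rewrite sqr_sqrtr// addr_ge0// sqr_ge0.
have [r0|rn0] := eqVneq r 0.
  move: r2; rewrite -/r r0 expr0n => /esym/eqP.
  rewrite paddr_eq0 ?sqr_ge0// !sqrf_eq0 => /andP[/eqP-> /eqP->].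
  apply: eq_integral => x _.
  under eq_integral do rewrite !mul0r add0r.
  by rewrite integral_prob_cst mul0r.
have cs : (t / r) ^+ 2 + (u / r) ^+ 2 = 1.
  by rewrite !expr_div_n -mulrDl -r2 divff// sqrf_eq0.
have mg : measurable_fun [set: R * R] (fun z : R * R => f (r * z.1)%R).
  apply: measurableT_comp => //.
  exact: (measurableT_comp (mulrl_measurable r) measurable_fst).
have := normal_rotation cs mg (fun z => f0 _) => /=.
under [in X in _ = X -> _]eq_integral do rewrite integral_prob_cst.
move=> <-; apply: eq_integral => x _; apply: eq_integral => y _.
by congr f; field.
Qed.

End normal_convolution.

Lemma measurable_sqrt (R : realType) : measurable_fun [set: R] (@Num.sqrt R).
Proof. by apply: continuous_measurable_fun; exact: sqrt_continuous. Qed.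

Section scale_mixture.
Context d (T : measurableType d) (R : realType) (P : probability T R).
Local Notation N01 := (normal_prob (0 : R) 1).

(** [Y] is distributed as [L] times an independent standard normal variable. Test functions state
    this without any variable realizing the normal factor, and without constraining the joint law of
    [Y] and [L]. *)
Definition scale_mixture (Y L : T -> R) :=
  forall f : R -> \bar R, measurable_fun setT f -> (forall x, 0 <= f x)%E ->
    (\int[P]_w f (Y w) = \int[P]_w \int[N01]_y f (L w * y)%R)%E.

Context (I : finType) (eps lam : I -> T -> R).
Hypothesis meps : forall i, measurable_fun setT (eps i).
Hypothesis mlam : forall i, measurable_fun setT (lam i).
Hypothesis indep_eps : mutually_independent P eps.
Hypothesis indep_lam : mutually_independent P lam.
Hypothesis mix : forall i, scale_mixture (eps i) (lam i).

(** Induction on S. The new term is independent of the partial sum, so each is replaced by its own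
    mixture; at fixed scales the two normal factors merge by [normal_convolution]; independence of
    the scales then puts [lam k] and the partial variance [V] back on the same sample point. *)
Let scale_sum (S : {set I}) (a : I -> R) :
  scale_mixture (fun w => \sum_(i in S) a i * eps i w)
    (fun w => Num.sqrt (\sum_(i in S) a i ^+ 2 * lam i w ^+ 2)).
Proof.
elim/finset_ind: S => [|k S kS IH] f mf f0.
  apply: eq_integral => w _.
  under [RHS]eq_integral do rewrite big_set0 sqrtr0 mul0r.
  by rewrite integral_prob_cst big_set0.
pose Y w := \sum_(i in S) a i * eps i w.
pose V w := \sum_(i in S) a i ^+ 2 * lam i w ^+ 2.
have V0 w : 0 <= V w by apply: sumr_ge0 => i _; rewrite mulr_ge0 ?sqr_ge0.
have aY : adapted eps S Y.
  by apply: (adapted_sum _ (h := fun i x => a i * x)) => // i; exact: mulrl_measurable.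
have aV : adapted lam S V.
  apply: (adapted_sum _ (h := fun i x => a i ^+ 2 * x ^+ 2)) => // i.
  by apply: (measurableT_comp (mulrl_measurable _)); exact: exprn_measurable.
have mY := adapted_measurable meps aY.
have mV := adapted_measurable mlam aV.
have ak (Z : I -> T -> R) : adapted Z [set k]%SET (Z k).
  by apply: adapted_coord; rewrite inE.
have dkS : [disjoint [set k]%SET & S]%B by rewrite disjoints1.
pose f1 (z : R * R) := f (a k * z.1 + z.2)%R.
have mf1 : measurable_fun setT f1.
  apply: measurableT_comp => //; apply: measurable_funD => //.
  exact: (measurableT_comp (mulrl_measurable _) measurable_fst).
pose g u := (\int[P]_w f (a k * u + Y w)%R)%E.
have g0 u : (0 <= g u)%E by exact: integral_ge0.
have mfY : measurable_fun [set: R * T] (fun z => f (a k * z.1 + Y z.2)%R).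
  apply: measurableT_comp => //; apply: measurable_funD => //.
    exact: (measurableT_comp (mulrl_measurable _) measurable_fst).
  exact: (measurableT_comp mY measurable_snd).
have mg : measurable_fun [set: R] g.
  exact: (measurable_fun_fubini_tonelli_F (m2 := P) (fun z : R * T => f (a k * z.1 + Y z.2)%R)).
transitivity (\int[P]_w g (eps k w))%E.
  transitivity (\int[P]_w f1 (eps k w, Y w))%E.
    by apply: eq_integral => w _; rewrite finset.big_setU1.
  by apply: (integral_indep_adapted meps indep_eps dkS (ak eps) aY mf1) => z; exact: f0.
rewrite (mix k mg g0).
pose h (z : R * R) := (\int[N01]_x f (Num.sqrt (a k ^+ 2 * z.1 ^+ 2 + `|z.2|) * x)%R)%E.
have h0 z : (0 <= h z)%E by exact: integral_ge0.
have mh : measurable_fun setT h.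
  apply: (measurable_fun_fubini_tonelli_F (m2 := N01)
    (fun z : (R * R) * R => f (Num.sqrt (a k ^+ 2 * z.1.1 ^+ 2 + `|z.1.2|) * z.2)%R)) => //.
  apply: measurableT_comp => //; apply: measurable_funM => //.
  apply: (measurableT_comp (@measurable_sqrt R)); apply: measurable_funD.
    apply: (measurableT_comp (mulrl_measurable _)).
    apply: (measurableT_comp (exprn_measurable 2)).
    exact: (measurableT_comp measurable_fst measurable_fst).
  apply: measurableT_comp => //.
  exact: (measurableT_comp measurable_snd measurable_fst).
transitivity (\int[P]_w \int[P]_w' h (lam k w, V w'))%E; last first.
  transitivity (\int[P]_w h (lam k w, V w))%E.
    exact/esym/(integral_indep_adapted mlam indep_lam dkS (ak lam) aV mh h0).
  apply: eq_integral => w _; apply: eq_integral => y _.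
  by rewrite finset.big_setU1//= ger0_norm.
apply: eq_integral => w _.
have mLY : measurable_fun [set: R * T] (fun z => f (a k * (lam k w * z.1) + Y z.2)%R).
  apply: measurableT_comp => //; apply: measurable_funD => //.
    apply: (measurableT_comp (mulrl_measurable _)).
    exact: (measurableT_comp (mulrl_measurable _) measurable_fst).
  exact: (measurableT_comp mY measurable_snd).
have mLV : measurable_fun [set: R * (T * R)]
    (fun z => f (a k * (lam k w * z.1) + Num.sqrt (V z.2.1) * z.2.2)%R).
  apply: measurableT_comp => //; apply: measurable_funD => //.
    apply: (measurableT_comp (mulrl_measurable _)).
    exact: (measurableT_comp (mulrl_measurable _) measurable_fst).
  apply: measurable_funM.
    apply: (measurableT_comp (@measurable_sqrt R)).
    apply: (measurableT_comp mV).
    exact: (measurableT_comp measurable_fst measurable_snd).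
  exact: (measurableT_comp measurable_snd measurable_snd).
transitivity (\int[N01]_y \int[P]_w' \int[N01]_x
    f (a k * (lam k w * y) + Num.sqrt (V w') * x)%R)%E.
  apply: eq_integral => y _; rewrite /g.
  apply: (IH (fun x => f (a k * (lam k w * y) + x)%R)) => //.
  by apply: measurableT_comp => //; exact: measurable_funD.
pose F (z : R * T) := (\int[N01]_x
    f (a k * (lam k w * z.1) + Num.sqrt (V z.2) * x)%R)%E.
have mF : measurable_fun setT F.
  apply: (measurable_fun_fubini_tonelli_F (m2 := N01)
    (fun z : (R * T) * R => f (a k * (lam k w * z.1.1) + Num.sqrt (V z.1.2) * z.2)%R)) => //.
  apply: measurableT_comp => //; apply: measurable_funD => //.
    apply: (measurableT_comp (mulrl_measurable _)).
    apply: (measurableT_comp (mulrl_measurable _)).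
    exact: (measurableT_comp measurable_fst measurable_fst).
  apply: measurable_funM => //.
  apply: (measurableT_comp (@measurable_sqrt R)).
  apply: (measurableT_comp mV).
  exact: (measurableT_comp measurable_snd measurable_fst).
have F0 z : (0 <= F z)%E by exact: integral_ge0.
apply: etrans (fubini_tonelli (m1 := N01) (m2 := P) F mF F0) _.
apply: eq_integral => w' _.
transitivity (\int[N01]_y \int[N01]_x
    f ((a k * lam k w) * y + Num.sqrt (V w') * x)%R)%E.
  by apply: eq_integral => y _; rewrite /F; apply: eq_integral => x _; rewrite mulrA.
rewrite normal_convolution// /h; apply: eq_integral => x _ /=.
by rewrite exprMn sqr_sqrtr// ger0_norm.
Qed.

Theorem scale_mixture_sum (a : I -> R) :
  scale_mixture (fun w => \sum_i a i * eps i w)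
    (fun w => Num.sqrt (\sum_i a i ^+ 2 * lam i w ^+ 2)).
Proof.
have bigT (F : I -> T -> R) :
    (fun w => \sum_(i in finset.setT) F i w) = fun w => \sum_i F i w.
  by apply/funext => w; apply: eq_bigl => i; rewrite finset.in_setT.
have := scale_sum finset.setT a.
rewrite (bigT (fun i w => a i * eps i w)).
by have /(congr1 (fun g w => Num.sqrt (g w))) /= -> :=
  bigT (fun i w => a i ^+ 2 * lam i w ^+ 2).
Qed.

End scale_mixture.

(** * Characteristic functions of normal scale mixtures *)

Section bounded_functions.
Context d (T : measurableType d) (R : realType) (P : probability T R).
Implicit Types f g : T -> R.

Definition bounded_measurable f :=
  measurable_fun setT f /\ exists M, forall x, `|f x| <= M.
Local Notation bm := bounded_measurable.

Lemma bm_cst c : bm (fun=> c).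
Proof. by split=> //; exists `|c|. Qed.

Lemma bmD f g : bm f -> bm g -> bm (fun x => f x + g x).
Proof.
move=> [mf [M fM]] [mg [N gN]]; split; first exact: measurable_funD.
by exists (M + N) => x; rewrite (le_trans (ler_normD _ _))// lerD.
Qed.

Lemma bmM f g : bm f -> bm g -> bm (fun x => f x * g x).
Proof.
move=> [mf [M fM]] [mg [N gN]]; split; first exact: measurable_funM.
by exists (M * N) => x; rewrite normrM ler_pM.
Qed.

Lemma bmN f : bm f -> bm (fun x => - f x).
Proof.
move=> [mf [M fM]]; split; first exact: measurableT_comp.
by exists M => x; rewrite normrN.
Qed.

Lemma bmB f g : bm f -> bm g -> bm (fun x => f x - g x).
Proof. by move=> bf bg; exact: bmD (bmN bg). Qed.

Lemma bmX f n : bm f -> bm (fun x => f x ^+ n).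
Proof.
move=> bf; elim: n => [|n IH]; first exact: bm_cst.
by under eq_fun do rewrite exprS; exact: bmM.
Qed.

Lemma bm_integrable f : bm f -> P.-integrable setT (EFin \o f).
Proof.
move=> [mf [M fM]]; apply: measurable_bounded_integrable => //.
  by rewrite (le_lt_trans (probability_le1 P measurableT))// ltry.
exists M; split; first exact: num_real.
by move=> y My x _; exact: le_trans (fM x) (ltW My).
Qed.

Lemma bm_intD f g : bm f -> bm g ->
  \int[P]_w (f w + g w) = \int[P]_w f w + \int[P]_w g w.
Proof. by move=> bf bg; rewrite RintegralD//; exact: bm_integrable. Qed.

Lemma bm_intB f g : bm f -> bm g ->
  \int[P]_w (f w - g w) = \int[P]_w f w - \int[P]_w g w.
Proof. by move=> bf bg; rewrite RintegralB//; exact: bm_integrable. Qed.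

Lemma bm_intZ c f : bm f -> \int[P]_w (c * f w) = c * \int[P]_w f w.
Proof. by move=> bf; rewrite RintegralZl//; exact: bm_integrable. Qed.

Lemma Rint_cst c : \int[P]_w c = c.
Proof. by rewrite /Rintegral integral_prob_cst. Qed.

Lemma bm_intE f : bm f -> (\int[P]_w (f w)%:E)%E = (\int[P]_w f w)%:E.
Proof.
move=> bf; rewrite /Rintegral fineK//.
by apply: integrable_fin_num => //; exact: bm_integrable.
Qed.

Lemma bm_int_le f g : bm f -> bm g -> (forall w, f w <= g w) ->
  \int[P]_w f w <= \int[P]_w g w.
Proof. by move=> bf bg fg; apply: le_Rintegral => //; exact: bm_integrable. Qed.

Lemma bm_int0 f : bm f -> (forall w, 0 <= f w) -> \int[P]_w f w = 0 ->
  {ae P, forall w, f w = 0}.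
Proof.
move=> bf f0 If0; have := bm_intE bf; rewrite If0 => If.
have /ae_eq_integral_abs : (\int[P]_w `|(f w)%:E| = 0)%E.
  by rewrite -[RHS]If; apply: eq_integral => w _; rewrite gee0_abs// lee_fin.
move=> /(_ measurableT) []; first by apply/measurable_EFinP; case: bf.
move=> N [mN PN sub]; exists N; split => // w fw; apply: sub => /= H.
by apply: fw; have /eqP := H I; rewrite eqe => /eqP.
Qed.

(* By integrating 2 W <= p X + Y / p for p = E W / E X. *)
Lemma bm_cauchy_schwarz (X Y W : T -> R) : bm X -> bm Y -> bm W ->
  (forall w, 0 <= X w) -> (forall w, 0 <= Y w) -> (forall w, 0 <= W w) ->
  (forall w, W w ^+ 2 = X w * Y w) ->
  (\int[P]_w W w) ^+ 2 <= \int[P]_w X w * \int[P]_w Y w.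
Proof.
move=> bX bY bW X0 Y0 W0 WXY.
set EW := \int[P]_w W w; set EX := \int[P]_w X w; set EY := \int[P]_w Y w.
have EW0 : 0 <= EW by exact: Rintegral_ge0.
have EX0 : 0 <= EX by exact: Rintegral_ge0.
have EY0 : 0 <= EY by exact: Rintegral_ge0.
have AG p q : 0 <= p -> 0 <= q -> p * q = 1 -> 2 * EW <= p * EX + q * EY.
  move=> p0 q0 pq; rewrite -!bm_intZ// -bm_intD; last 2 first.
  - by apply: bmM => //; exact: bm_cst.
  - by apply: bmM => //; exact: bm_cst.
  apply: bm_int_le.
  - by apply: bmM => //; exact: bm_cst.
  - by apply: bmD; apply: bmM => //; exact: bm_cst.
  move=> w; rewrite -ler_sqr ?nnegrE ?addr_ge0 ?mulr_ge0//.
  rewrite exprMn WXY -subr_ge0.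
  have -> : (p * X w + q * Y w) ^+ 2 - 2 ^+ 2 * (X w * Y w) =
    (p * X w - q * Y w) ^+ 2 + 4 * (p * q - 1) * X w * Y w by ring.
  by rewrite pq subrr mulr0 !mul0r addr0 sqr_ge0.
have [EW_0|EWn0] := eqVneq EW 0; first by rewrite EW_0 expr0n mulr_ge0.
have EW_gt0 : 0 < EW by rewrite lt_neqAle eq_sym EWn0.
have [EX_0|EXn0] := eqVneq EX 0.
  have q0 : 0 <= EW / (EY + 1) by rewrite divr_ge0// addr_ge0.
  have Y1 : 0 < EY + 1 by rewrite ltr_wpDl.
  have := AG ((EY + 1) / EW) (EW / (EY + 1)).
  rewrite EX_0 mulr0 add0r => /(_ _ q0).
  rewrite divr_ge0 ?addr_ge0// => /(_ isT) H.
  have : 2 * EW <= EW / (EY + 1) * EY.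
    by apply: H; field; rewrite EWn0 gt_eqF.
  have : EW / (EY + 1) * EY <= EW.
    rewrite mulrAC ler_pdivrMr// ler_pM2l// lerDl//.
  move=> h1 h2; have := le_trans h2 h1; rewrite mulr_natl mulr2n gerDl.
  by rewrite leNgt EW_gt0.
have EX_gt0 : 0 < EX by rewrite lt_neqAle eq_sym EXn0.
have := AG (EW / EX) (EX / EW).
rewrite !divr_ge0// => /(_ isT isT).
have -> : EW / EX * (EX / EW) = 1 by rewrite mulrA divfK // divff.
move=> /(_ erefl); rewrite divfK// => H.
have : EW <= EX / EW * EY by move: H; lra.
by rewrite mulrAC ler_pdivlMr// expr2.
Qed.

(** Integrate the last hypothesis first in w', then in w: [f] and [g] vary in the same direction, so
    their covariance is nonnegative. *)
Lemma bm_chebyshev f g : bm f -> bm g ->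
  (forall w w', 0 <= (f w - f w') * (g w - g w')) ->
  \int[P]_w f w * \int[P]_w g w <= \int[P]_w (f w * g w).
Proof.
move=> bf bg fg.
set Ef := \int[P]_w f w; set Eg := \int[P]_w g w.
set Efg := \int[P]_w (f w * g w).
have bfg : bm (fun w => f w * g w) by exact: bmM.
have bc c : bm (fun=> c) by exact: bm_cst.
have H w : 0 <= f w * g w - f w * Eg - g w * Ef + Efg.
  have -> : f w * g w - f w * Eg - g w * Ef + Efg =
      \int[P]_w' ((f w * g w - f w * g w') + (f w' * g w' - g w * f w')).
    rewrite bm_intD ?bm_intB ?bm_intZ ?Rint_cst//.
    - by rewrite -/Ef -/Eg -/Efg; ring.
    - by apply: bmM => //.
    - by apply: bmM => //.
    - by apply: bmB => //; exact: bmM.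
    - by apply: bmB => //; exact: bmM.
  apply: Rintegral_ge0 => w' _; apply: le_trans (fg w w') _.
  by rewrite le_eqVlt; apply/orP; left; apply/eqP; ring.
have : 0 <= \int[P]_w ((f w * g w - Eg * f w) + (Efg - Ef * g w)).
  apply: Rintegral_ge0 => w _; apply: le_trans (H w) _.
  by rewrite le_eqVlt; apply/orP; left; apply/eqP; ring.
rewrite bm_intD ?bm_intB ?bm_intZ ?Rint_cst//.
- by rewrite -/Ef -/Eg -/Efg; lra.
- exact: bmM.
- exact: bmM.
- by apply: bmB => //; exact: bmM.
- by apply: bmB => //; exact: bmM.
Qed.

(** The product formula for nonnegative integrands is applied to f + 1 and g + 1; after expansion
    the extra terms cancel. *)
Lemma bm_int_mul_indep (X Y : T -> R) (f g : R -> R) :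
  measurable_fun setT X -> measurable_fun setT Y -> independent2 P X Y ->
  measurable_fun setT f -> measurable_fun setT g ->
  (forall x, `|f x| <= 1) -> (forall x, `|g x| <= 1) ->
  \int[P]_w (f (X w) * g (Y w)) = \int[P]_w f (X w) * \int[P]_w g (Y w).
Proof.
move=> mX mY XY mf mg f1 g1.
have bf : bm (fun w => f (X w)) by split; [exact: measurableT_comp|exists 1].
have bg : bm (fun w => g (Y w)) by split; [exact: measurableT_comp|exists 1].
have f10 x : 0 <= f x + 1.
  by rewrite -lerBlDr sub0r (lerNnormlW (f1 x)).
have g10 x : 0 <= g x + 1.
  by rewrite -lerBlDr sub0r (lerNnormlW (g1 x)).
have bc c : bm (fun=> c) by exact: bm_cst.
have bf1 : bm (fun w => f (X w) + 1) by exact: bmD.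
have bg1 : bm (fun w => g (Y w) + 1) by exact: bmD.
pose h (z : R * R) := ((f z.1 + 1) * (g z.2 + 1))%:E.
have mh : measurable_fun setT h.
  apply/measurable_EFinP; apply: measurable_funM; apply: measurable_funD => //.
    exact: (measurableT_comp mf measurable_fst).
  exact: (measurableT_comp mg measurable_snd).
have h0 z : (0 <= h z)%E by rewrite lee_fin mulr_ge0.
have IE w : (\int[P]_w' h (X w, Y w') =
    ((\int[P]_w g (Y w) + 1) * (f (X w) + 1))%:E)%E.
  rewrite /h/= bm_intE ?bm_intZ ?bm_intD// ?Rint_cst 1?mulrC//.
  exact: bmM.
have := integral_indep mX mY XY mh h0.
under [in X in _ = X -> _]eq_integral do rewrite IE.
rewrite !bm_intE; [|exact: bmM|exact: bmM].
move=> []; rewrite bm_intZ// bm_intD// Rint_cst.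
have -> : \int[P]_w ((f (X w) + 1) * (g (Y w) + 1)) =
  \int[P]_w ((f (X w) * g (Y w) + f (X w)) + (g (Y w) + 1)).
  by apply: eq_Rintegral => w _; ring.
have bfg : bm (fun w => f (X w) * g (Y w)) by exact: bmM.
rewrite (bm_intD (bmD bfg bf) bg1) (bm_intD bfg bf) (bm_intD bg (bc 1)) Rint_cst.
lra.
Qed.

End bounded_functions.

Section bounded_scale_mixture.
Context d (T : measurableType d) (R : realType) (P : probability T R).
Local Notation N01 := (normal_prob (0 : R) 1).

(** Again f + 1 replaces f. Measurability in w of the inner integral also comes from Tonelli's
    theorem for f + 1. *)
Lemma bm_int_scale_mixture (Y L : T -> R) (f : R -> R) :
  measurable_fun setT Y -> measurable_fun setT L -> scale_mixture P Y L ->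
  measurable_fun setT f -> (forall x, `|f x| <= 1) ->
  \int[P]_w f (Y w) = \int[P]_w (\int[N01]_y f (L w * y)).
Proof.
move=> mY mL YL mf f1.
have f10 x : 0 <= f x + 1 by rewrite -lerBlDr sub0r (lerNnormlW (f1 x)).
have bf d' (T' : measurableType d') (Z : T' -> R) : measurable_fun setT Z ->
    bounded_measurable (fun w => f (Z w)).
  by move=> mZ; split; [exact: measurableT_comp|exists 1].
have bL c : @bounded_measurable _ (measurableTypeR R) R (fun y => f (c * y)).
  by split; [exact: (measurableT_comp mf (mulrl_measurable c))|exists 1].
have mf1 : measurable_fun setT (fun x => (f x + 1)%:E).
  by apply/measurable_EFinP; exact: measurable_funD.
have IE w : (\int[N01]_y (f (L w * y) + 1)%:E =
    (\int[N01]_y f (L w * y) + 1)%:E)%E.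
  rewrite bm_intE; last exact: bmD (bL _) (bm_cst _ _).
  by rewrite bm_intD ?Rint_cst//; exact: bm_cst.
have bI : bounded_measurable (fun w => \int[N01]_y f (L w * y)).
  split.
    have -> : (fun w => \int[N01]_y f (L w * y)) =
        (fun w => fine (\int[N01]_y (f (L w * y) + 1)%:E)%E - 1).
      by apply/funext => w; rewrite IE/= addrK.
    apply: measurable_funB => //; apply: measurableT_comp => //.
    apply: (measurable_fun_fubini_tonelli_F (m2 := N01)
      (fun z : T * R => (f (L z.1 * z.2) + 1)%:E)); last by move=> z; exact: f10.
    apply: (measurableT_comp mf1); apply: measurable_funM => //.
    exact: (measurableT_comp mL measurable_fst).
  exists 1 => w; rewrite ler_norml; apply/andP; split.
    apply: (@le_trans _ _ (\int[N01]_y (-1))); first by rewrite Rint_cst.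
    apply: bm_int_le => //.
    - exact: bm_cst.
    - by move=> y; exact: lerNnormlW (f1 _).
  apply: (@le_trans _ _ (\int[N01]_y 1)); last by rewrite Rint_cst.
  apply: bm_int_le => //.
  - exact: bm_cst.
  - by move=> y; rewrite (le_trans (ler_norm _)).
have := YL _ mf1 f10.
under [in X in _ = X -> _]eq_integral do rewrite IE.
rewrite !bm_intE; last 2 first.
- by apply: bmD => //; exact: bm_cst.
- by apply: bmD (bm_cst _ _); exact: bf.
move=> []; rewrite !bm_intD ?Rint_cst//; last 3 first.
- exact: bm_cst.
- exact: bf.
- exact: bm_cst.
exact: addIr.
Qed.

End bounded_scale_mixture.

(** * The characteristic function of the standard normal law *)

Section normal_characteristic_function.
Context {R : realType}.
Local Notation leb := (@lebesgue_measure R).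
Local Notation N01 := (normal_prob (0 : R) 1).
Local Notation mR := (measurableTypeR R).

Let mabs : measurable_fun [set: R] (fun y : R => `|y|).
Proof. exact: normr_measurable. Qed.

Lemma normal_mean_abs_fin : (\int[N01]_y `|y|%:E < +oo)%E.
Proof.
rewrite ge0_integral_normal_prob//; last exact/measurable_EFinP.
(* [c] is the ratio of the peaks of the centered normal densities of variances 1 and 2. Since |y| <=
   1 + y^2/4 <= exp(y^2/4), |y| times the first density is at most [c] times the second. *)
pose c : R := normal_peak 1 / normal_peak (Num.sqrt 2).
have s20 : Num.sqrt (2 : R) != 0 by rewrite gt_eqF// sqrtr_gt0.
have p2 : 0 < normal_peak (Num.sqrt (2 : R)) by exact: normal_peak_gt0.
have c0 : 0 <= c by rewrite divr_ge0// normal_peak_ge0.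
apply: (@le_lt_trans _ _ (\int[leb]_y (c%:E * (normal_pdf 0 (Num.sqrt 2) y)%:E))%E).
  apply: ge0_le_integral => //.
  - by move=> y _; rewrite mule_ge0// lee_fin normal_pdf_ge0.
  - apply: emeasurable_funM; apply/measurable_EFinP; first exact: mabs.
    exact: measurable_normal_pdf.
  - by apply: emeasurable_funM => //; apply/measurable_EFinP; exact: measurable_normal_pdf.
  - move=> y _; rewrite -!EFinM lee_fin normal_pdf1E normal_pdfE// /normal_fun subr0.
    rewrite sqr_sqrtr// [in leRHS]mulrA /c divfK ?lt0r_neq0// mulrCA ler_wpM2l ?normal_peak_ge0//.
    have -> : - (y ^+ 2 / 2) = - (y ^+ 2 / 4) + - y ^+ 2 / (2 *+ 2).
      by rewrite -mulr_natr; field.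
    rewrite expRD mulrA ler_piMl ?expR_ge0//.
    rewrite expRN ler_pdivrMr ?expR_gt0// mul1r.
    apply: le_trans (expR_ge1Dx _).
    rewrite -(real_normK (num_real y)); set z := `|y|.
    have : 0 <= (z / 2 - 1) ^+ 2 by exact: sqr_ge0.
    by nra.
rewrite ge0_integralZl//; last 2 first.
- by apply/measurable_EFinP; exact: measurable_normal_pdf.
- by move=> y _; rewrite lee_fin normal_pdf_ge0.
by rewrite integral_normal_pdf mule1 ltry.
Qed.

(** The number sqrt(2/pi). It enters every residual mean as a common factor, through its finiteness
    and its positivity. *)
Definition normal_mean_abs : R := \int[N01]_y `|y|.

Lemma normal_mean_absE : (\int[N01]_y `|y|%:E = normal_mean_abs%:E)%E.
Proof.
rewrite /normal_mean_abs /Rintegral fineK// ge0_fin_numE ?normal_mean_abs_fin//.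
exact: integral_ge0.
Qed.

Lemma normal_prob_set1 (x : R) : N01 [set x] = 0%E.
Proof.
have /null_content_dominatesP := normal_prob_dominates (0 : R) 1.
by apply => //; exact: lebesgue_measure_set1.
Qed.

(** The normal density is positive everywhere, so null sets of the normal law are Lebesgue null;
    contradictions can then be drawn from the length of an interval. *)
Lemma normal_ae_eq0 (f : R -> R) : measurable_fun setT f -> (forall x, 0 <= f x) ->
  (\int[N01]_x (f x)%:E = 0)%E -> {ae leb, forall x, f x = 0}.
Proof.
move=> mf f0; rewrite ge0_integral_normal_prob//; last exact/measurable_EFinP.
have pp x : 0 < normal_pdf 0 1 x :> R.
  by rewrite normal_pdf1E mulr_gt0 ?expR_gt0// normal_peak_gt0// oner_neq0.
have mp : measurable_fun [set: mR] (fun x : mR => ((f x)%:E * (normal_pdf 0 1 x)%:E)%E).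
  apply: emeasurable_funM; apply/measurable_EFinP => //.
  exact: measurable_normal_pdf.
move=> If; have /ae_eq_integral_abs : (\int[leb]_x `|(f x)%:E * (normal_pdf 0 1 x)%:E| = 0)%E.
  rewrite -[RHS]If; apply: eq_integral => x _; rewrite gee0_abs// mule_ge0// lee_fin//.
  exact: normal_pdf_ge0.
move=> /(_ measurableT mp) [N [mN PN sub]]; exists N; split => // x /= fx.
apply: sub => /= H; apply: fx; have /eqP := H I.
by rewrite -EFinM eqe mulf_eq0 (gt_eqF (pp x)) orbF => /eqP.
Qed.

Lemma normal_mean_abs_gt0 : 0 < normal_mean_abs.
Proof.
rewrite lt_neqAle Rintegral_ge0// andbT; apply/eqP => k0.
have : (\int[N01]_y `|y|%:E = 0)%E by rewrite normal_mean_absE -k0.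
move=> /normal_ae_eq0 []; [exact: mabs|by []|].
move=> N [mN N0 sub].
have : (leb `]0%R, 1%R]%classic <= leb N)%E.
  apply: le_measure; [exact: mem_set|exact: mem_set|].
  move=> y /=; rewrite in_itv/= => /andP[y0 _]; apply: sub => /= /eqP.
  by rewrite normr_eq0 gt_eqF.
rewrite N0 lebesgue_measure_itv/= lte_fin ltr01 sube0 lee_fin.
by rewrite leNgt ltr01.
Qed.

(** The characteristic function exp(- t^2/2), real because the law is symmetric. Its properties are
    drawn from the functional equation [normal_charM] instead of a closed form. *)
Definition normal_char (t : R) : R := \int[N01]_y cos (t * y).
Local Notation K := normal_char.

Let measurable_cos : measurable_fun [set: R] (@cos R).
Proof. by apply: continuous_measurable_fun; exact: continuous_cos. Qed.

Let measurable_sin : measurable_fun [set: R] (@sin R).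
Proof. by apply: continuous_measurable_fun; exact: continuous_sin. Qed.

Lemma bm_cos (c : R) : @bounded_measurable _ mR R (fun y => cos (c * y)).
Proof.
split; first exact: (measurableT_comp measurable_cos (mulrl_measurable c)).
by exists 1 => y; exact: cos_max.
Qed.

Lemma bm_sin (c : R) : @bounded_measurable _ mR R (fun y => sin (c * y)).
Proof.
split; first exact: (measurableT_comp measurable_sin (mulrl_measurable c)).
by exists 1 => y; exact: sin_max.
Qed.

Lemma normal_char0 : K 0 = 1.
Proof. by rewrite /K; under eq_Rintegral do rewrite mul0r cos0; rewrite Rint_cst. Qed.

Lemma normal_charN t : K (- t) = K t.
Proof. by apply: eq_Rintegral => y _; rewrite mulNr cosN. Qed.

Lemma normal_char_abs t : K `|t| = K t.
Proof. by have [_//|_] := ger0P t; exact: normal_charN. Qed.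

Lemma normal_char_le1 t : K t <= 1.
Proof.
apply: (@le_trans _ _ (\int[N01]_y 1)); last by rewrite Rint_cst.
apply: bm_int_le; [exact: bm_cos|exact: bm_cst|move=> y; exact: cos_le1].
Qed.

Lemma normal_sin_char (t : R) : \int[N01]_y sin (t * y) = 0.
Proof.
have mf : measurable_fun setT (fun y : R => (sin (t * y) + 1)%:E).
  apply/measurable_EFinP; apply: measurable_funD => //.
  exact: (measurableT_comp measurable_sin (mulrl_measurable t)).
have f0 y : (0 <= (sin (t * y) + 1)%:E)%E.
  by rewrite lee_fin -lerBlDr sub0r sin_geN1.
have := integral_normalN mf f0.
have bs : @bounded_measurable _ mR R (fun y => sin (t * - y)).
  have := bm_sin (- t); congr bounded_measurable; apply/funext => y.
  by rewrite mulrN mulNr.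
rewrite !bm_intE; last 2 first.
- exact: bmD (bm_sin _) (bm_cst _ _).
- exact: bmD bs (bm_cst _ _).
rewrite (bm_intD _ bs (bm_cst _ 1)) (bm_intD _ (bm_sin t) (bm_cst _ 1)).
move=> [/addIr].
have -> : \int[N01]_y sin (t * - y) = \int[N01]_y (-1 * sin (t * y)).
  by apply: eq_Rintegral => y _; rewrite mulrN sinN mulN1r.
by rewrite (bm_intZ _ _ (bm_sin t)); lra.
Qed.

(** By [normal_convolution] the left side is the double integral of cos (t x + u y); in the addition
    formula the product of sines integrates to 0 by symmetry. *)
Lemma normal_charM t u : K (Num.sqrt (t ^+ 2 + u ^+ 2)) = K t * K u.
Proof.
pose f (y : R) := (cos y + 1)%:E.
have mf : measurable_fun setT f.
  by apply/measurable_EFinP; exact: measurable_funD.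
have f0 y : (0 <= f y)%E by rewrite lee_fin -lerBlDr sub0r cos_geN1.
have := normal_convolution t u mf f0.
rewrite bm_intE; last exact: bmD (bm_cos _) (bm_cst _ _).
rewrite (bm_intD _ (bm_cos _) (bm_cst _ 1)) Rint_cst -/(K _).
have bc (x : R) : @bounded_measurable _ mR R (fun y => cos (t * x) * cos (u * y)).
  exact: bmM (bm_cst _ _) (bm_cos _).
have bs (x : R) : @bounded_measurable _ mR R (fun y => sin (t * x) * sin (u * y)).
  exact: bmM (bm_cst _ _) (bm_sin _).
have IE x : (\int[N01]_y f (t * x + u * y)%R = (K u * cos (t * x) + 1)%:E)%E.
  transitivity (\int[N01]_y
      ((cos (t * x) * cos (u * y) - sin (t * x) * sin (u * y)) + 1)%:E)%E.
    by apply: eq_integral => y _; rewrite /f cosD.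
  rewrite bm_intE; last exact: bmD (bmB (bc x) (bs x)) (bm_cst _ _).
  rewrite (bm_intD _ (bmB (bc x) (bs x)) (bm_cst _ 1)) (bm_intB _ (bc x) (bs x)).
  rewrite (bm_intZ _ _ (bm_cos u)) (bm_intZ _ _ (bm_sin u)) normal_sin_char Rint_cst.
  by rewrite mulr0 subr0 mulrC.
under eq_integral do rewrite IE.
have bK : @bounded_measurable _ mR R (fun x => K u * cos (t * x)).
  exact: bmM (bm_cst _ _) (bm_cos _).
rewrite bm_intE; last exact: bmD bK (bm_cst _ _).
rewrite (bm_intD _ bK (bm_cst _ 1)) (bm_intZ _ _ (bm_cos t)) Rint_cst.
by move=> [/addIr <-]; rewrite mulrC.
Qed.

Lemma normal_char_sqr t : K t = K (t / Num.sqrt 2) ^+ 2.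
Proof.
rewrite expr2 -normal_charM expr_div_n sqr_sqrtr// -splitr sqrtr_sqr.
by rewrite normal_char_abs.
Qed.

Lemma normal_char_ge0 t : 0 <= K t.
Proof. by rewrite normal_char_sqr sqr_ge0. Qed.

Lemma one_sub_cos_le (x : R) : 1 - cos x <= `|x|.
Proof.
wlog x0 : x / 0 <= x.
  move=> H; have [/H//|x0] := leP 0 x.
  by rewrite -normrN -cosN; apply: H; rewrite oppr_ge0 ltW.
have [c _ cE] : exists2 c, c \in `[0, x] & cos x - cos 0 = - sin c * (x - 0).
  apply: MVT_segment => //.
  exact/continuous_subspaceT/continuous_cos.
rewrite ger0_norm//; move: cE; rewrite cos0 subr0 => cE.
rewrite -opprB cE mulNr opprK ler_piMl// sin_le1//.
Qed.

Lemma normal_char_lower t : 1 - `|t| * normal_mean_abs <= K t.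
Proof.
have iabs : N01.-integrable [set: mR] (EFin \o (fun y : mR => `|y|)).
  apply/integrableP; split; first exact/measurable_EFinP.
  rewrite (le_lt_trans _ normal_mean_abs_fin)//.
  by under eq_integral do rewrite /= normr_id.
have itabs : N01.-integrable [set: mR] (EFin \o (fun y : mR => `|t| * `|y|)).
  by rewrite (_ : _ \o _ = fun y => `|t|%:E * (`|y|)%:E)%E//; exact: integrableZl.
rewrite -RintegralZl// -[X in X - _](@Rint_cst _ _ _ N01 1).
rewrite -RintegralB//; last exact: (bm_integrable N01 (bm_cst _ 1)).
apply: le_Rintegral => //.
- rewrite (_ : _ \o _ = (EFin \o (fun y : mR => 1%R)) \- (EFin \o (fun y : mR => (`|t| * `|y|)%R)))%E//.
  by apply: integrableB => //; exact: (bm_integrable N01 (bm_cst _ 1)).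
- exact: (bm_integrable N01 (bm_cos t)).
- move=> y _; rewrite lerBlDr -lerBlDl -normrM.
  exact: one_sub_cos_le.
Qed.

(** K t is the fourth power of K (t/2), so a zero would propagate to every t / 2^n, while
    [normal_char_lower] makes K positive near 0. *)
Lemma normal_char_gt0 t : 0 < K t.
Proof.
rewrite lt_neqAle normal_char_ge0 andbT eq_sym; apply/eqP => Kt0.
have K2 n : K (t / 2 ^+ n) = 0.
  elim: n => [|n IH]; first by rewrite expr0 divr1.
  move: IH; rewrite normal_char_sqr => /eqP; rewrite sqrf_eq0 => /eqP.
  rewrite normal_char_sqr => /eqP; rewrite sqrf_eq0 => /eqP.
  rewrite -mulrA -invfM -[Num.sqrt 2 * _]expr2 sqr_sqrtr// -mulrA -invfM.
  by rewrite -exprSr.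
pose M := `|t| * normal_mean_abs.
have M0 : 0 <= M by rewrite mulr_ge0// ltW// normal_mean_abs_gt0.
have [n Mn] : exists n, M < 2 ^+ n.
  exists (Num.truncn M).+1; apply: (lt_le_trans (truncnS_gt M)).
  by rewrite -natrX ler_nat ltnW// ltn_expl.
have := normal_char_lower (t / 2 ^+ n).
rewrite K2 normrM normfV (ger0_norm (exprn_ge0 n (ler0n R 2))) mulrAC -/M.
rewrite subr_le0 ler_pdivlMr ?exprn_gt0// mul1r leNgt.
by rewrite Mn.
Qed.

(** Equality forces cos (t y) = 1 for almost every y. This fails on all of ]0, 1/|t|], where |t| y
    stays in ]0, 1], hence below pi. *)
Lemma normal_char_lt1 t : t != 0 -> K t < 1.
Proof.
move=> t0; rewrite lt_neqAle normal_char_le1 andbT; apply/eqP => Kt1.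
have b1 : @bounded_measurable _ mR R (fun y => 1 - cos (t * y)).
  exact: bmB (bm_cst _ _) (bm_cos _).
have : (\int[N01]_y (1 - cos (t * y))%:E = 0)%E.
  by rewrite (bm_intE _ b1) (bm_intB _ (bm_cst _ 1) (bm_cos t)) Rint_cst -/(K t) Kt1 subrr.
move=> /normal_ae_eq0 [].
- by case: b1.
- by move=> y; rewrite subr_ge0 cos_le1.
move=> N [mN N0 sub].
have tV0 : 0 < `|t|^-1 by rewrite invr_gt0 normr_gt0.
have : (leb `]0%R, (`|t|^-1)%R]%classic <= leb N)%E.
  apply: le_measure; [exact: mem_set|exact: mem_set|].
  move=> y /=; rewrite in_itv/= => /andP[y0 yt]; apply: sub => /= /eqP.
  rewrite subr_eq0 eq_sym -cos_norm normrM (gtr0_norm y0).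
  have z0 : 0 < `|t| * y by rewrite mulr_gt0// normr_gt0.
  have z1 : `|t| * y <= 1 by rewrite -ler_pdivlMl ?normr_gt0// mulr1.
  rewrite -cos0 lt_eqF// ltr_cos// in_itv/= ?lexx ?pi_ge0// ltW//=.
  by rewrite (le_trans z1)// (le_trans _ (pi_ge2 R))// ler1n.
rewrite N0 lebesgue_measure_itv/= lte_fin tV0 sube0 lee_fin.
by rewrite leNgt tV0.
Qed.

(** K u is K t times K (sqrt (u^2 - t^2)), and the second factor is less than 1. *)
Lemma normal_char_lt t u : `|t| < `|u| -> K u < K t.
Proof.
move=> tu.
have tu2 : 0 < u ^+ 2 - t ^+ 2.
  by rewrite subr_gt0 -(real_normK (num_real t)) -(real_normK (num_real u)) ltr_pXn2r// nnegrE.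
rewrite -[K u]normal_char_abs -sqrtr_sqr.
have -> : u ^+ 2 = t ^+ 2 + Num.sqrt (u ^+ 2 - t ^+ 2) ^+ 2.
  by rewrite sqr_sqrtr ?ltW// addrC subrK.
rewrite normal_charM gtr_pMr ?normal_char_gt0// normal_char_lt1//.
by rewrite gt_eqF// sqrtr_gt0.
Qed.

Lemma normal_char_inj t u : K t = K u -> `|t| = `|u|.
Proof.
by move=> Ktu; have [/normal_char_lt|/normal_char_lt|//] := ltgtP `|t| `|u|;
  rewrite Ktu ltxx.
Qed.

Lemma normal_char_sqrt_sum (I : finType) (s : I -> R) :
  K (Num.sqrt (\sum_i s i ^+ 2)) = \prod_i K (s i).
Proof.
suff [] : 0 <= \sum_i s i ^+ 2 /\
    K (Num.sqrt (\sum_i s i ^+ 2)) = \prod_i K (s i) by [].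
elim/big_ind2: _ => [|x y x' y' [x0 <-] [x'0 <-]|i _].
- by rewrite sqrtr0 normal_char0.
- split; first exact: addr_ge0.
  by rewrite -normal_charM !sqr_sqrtr.
- by rewrite sqr_ge0 sqrtr_sqr normal_char_abs.
Qed.

End normal_characteristic_function.

Lemma eq_prod_le (R : realType) (I : finType) (f g : I -> R) :
  (forall i, 0 < g i) -> (forall i, g i <= f i) ->
  \prod_i f i = \prod_i g i -> forall i, f i = g i.
Proof.
move=> g0 gf fg i; apply/eqP; rewrite eq_le gf andbT leNgt; apply/negP => gfi.
have f0 j : 0 < f j by exact: lt_le_trans (gf j).
have : \prod_j g j < \prod_j f j; last by rewrite fg ltxx.
rewrite (bigD1 i)//= [ltRHS](bigD1 i)//=.
apply: (@lt_le_trans _ _ (f i * \prod_(j | j != i) g j)).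
  by rewrite ltr_pM2r// prodr_gt0.
by rewrite ler_pM2l// ler_prod// => j _; rewrite (ltW (g0 j)) gf.
Qed.

(** * Transforms of mixing scales *)

Section scale_mixture_transform.
Context d (T : measurableType d) (R : realType) (P : probability T R).
Local Notation N01 := (normal_prob (0 : R) 1).
Local Notation K := (@normal_char R).

Lemma normal_char_le (t u : R) : `|t| <= `|u| -> K u <= K t.
Proof.
rewrite le_eqVlt => /predU1P[tu|/normal_char_lt/ltW//].
by rewrite -(normal_char_abs u) -tu normal_char_abs.
Qed.

Lemma measurable_normal_char : measurable_fun setT K.
Proof.
have bc (t : R) := bmD (bm_cos t) (bm_cst (measurableTypeR R) (1 : R)).
have -> : K = fun t => fine (\int[N01]_y (cos (t * y) + 1)%:E)%E - 1.
  apply/funext => t; rewrite bm_intE//.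
  by rewrite (bm_intD _ (bm_cos t) (bm_cst _ 1)) Rint_cst/= addrK.
apply: measurable_funB => //; apply: measurableT_comp => //.
apply: (measurable_fun_fubini_tonelli_F (m2 := N01)
  (fun z : R * R => (cos (z.1 * z.2) + 1)%:E)); last first.
  by move=> z; rewrite lee_fin -lerBlDr sub0r cos_geN1.
apply/measurable_EFinP; apply: measurable_funD => //.
apply: (@measurableT_comp _ _ _ _ _ _ (@cos R)).
  by apply: continuous_measurable_fun; exact: continuous_cos.
exact: measurable_funM.
Qed.

Section one_variable.
Variable Y : T -> R.
Hypothesis mY : measurable_fun setT Y.

(** When [Y] is a mixing scale, this is the characteristic function at [c] of the corresponding
    normal scale mixture. *)
Definition mixture_char (c : R) : R := \int[P]_w K (c * Y w).
Local Notation L := mixture_char.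

Lemma bm_normal_char (c : R) : bounded_measurable (fun w => K (c * Y w)).
Proof.
split.
  apply: (measurableT_comp measurable_normal_char).
  exact: (measurableT_comp (mulrl_measurable c)).
by exists 1 => w; rewrite ger0_norm ?normal_char_ge0 ?normal_char_le1.
Qed.

Lemma mixture_char0 : L 0 = 1.
Proof.
rewrite /L; under eq_Rintegral do rewrite mul0r normal_char0.
by rewrite Rint_cst.
Qed.

Lemma mixture_charN c : L (- c) = L c.
Proof. by apply: eq_Rintegral => w _; rewrite mulNr normal_charN. Qed.

Lemma mixture_char_gt0 c : 0 < L c.
Proof.
rewrite lt_neqAle Rintegral_ge0 ?andbT; last by move=> w _; exact: normal_char_ge0.
apply/eqP => /esym L0.
have [N [mN PN sub]] := bm_int0 (bm_normal_char c) (fun w => normal_char_ge0 _) L0.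
have : (P setT <= P N)%E.
  apply: le_measure; [exact: mem_set|exact: mem_set|] => w _; apply: sub => /= /eqP.
  by rewrite gt_eqF// normal_char_gt0.
by rewrite PN probability_setT lee_fin leNgt ltr01.
Qed.

(** With r^2 = u^2 + v^2, the functional equation gives K((u+v)Y) K((u-v)Y) = K(rY)^2 and K(rY) =
    K(uY) K(vY). Cauchy-Schwarz applies to the first identity, Chebyshev's inequality to the second,
    both factors being nonincreasing in |Y|. *)
Lemma mixture_charM_ge u v :
  (L u * L v) ^+ 2 <= L (u + v) * L (u - v).
Proof.
pose r := Num.sqrt (u ^+ 2 + v ^+ 2).
have r2 : r ^+ 2 = u ^+ 2 + v ^+ 2 by rewrite sqr_sqrtr// addr_ge0// sqr_ge0.
have W2 w : K (r * Y w) ^+ 2 = K ((u + v) * Y w) * K ((u - v) * Y w).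
  rewrite expr2 -!normal_charM; congr (K (Num.sqrt _)).
  by rewrite !exprMn r2; ring.
have WE w : K (r * Y w) = K (u * Y w) * K (v * Y w).
  rewrite -normal_charM -[LHS]normal_char_abs -sqrtr_sqr; congr (K (Num.sqrt _)).
  by rewrite !exprMn r2; ring.
have := bm_cauchy_schwarz P (bm_normal_char (u + v)) (bm_normal_char (u - v))
  (bm_normal_char r) (fun=> normal_char_ge0 _) (fun=> normal_char_ge0 _)
  (fun=> normal_char_ge0 _) W2.
apply: le_trans.
apply: lerXn2r; rewrite ?nnegrE.
- by rewrite mulr_ge0// ltW// mixture_char_gt0.
- by apply: Rintegral_ge0 => w _; exact: normal_char_ge0.
under eq_Rintegral do rewrite WE.
apply: bm_chebyshev; [exact: bm_normal_char|exact: bm_normal_char|].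
move=> w w'; have [ww'|/ltW ww'] := leP `|Y w| `|Y w'|.
  by apply: mulr_ge0; rewrite subr_ge0; apply: normal_char_le;
    rewrite !normrM ler_wpM2l.
by apply: mulr_le0; rewrite subr_le0; apply: normal_char_le;
  rewrite !normrM ler_wpM2l.
Qed.

(** With Z = K(Y), the hypothesis reads E Z^4 = (E Z)^4. The variances of Z and of Z^2 are
    nonnegative, so (E Z)^2 <= E Z^2 <= (E Z)^2. Thus Z has variance 0, and K is injective on
    nonnegative numbers. *)
Lemma mixture_char_eq_degenerate : L 2 = L 1 ^+ 4 ->
  {ae P, forall w, 0 <= Y w} -> degenerate P Y.
Proof.
move=> L2 Y0.
pose Z w := K (1 * Y w); pose mu := L 1; pose nu := \int[P]_w (Z w ^+ 2).
have bZ : bounded_measurable Z by exact: bm_normal_char.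
have bZ2 : bounded_measurable (fun w => Z w ^+ 2) by exact: bmX.
have bc (c : R) : bounded_measurable (fun _ : T => c) by exact: bm_cst.
have Z4 : \int[P]_w (Z w ^+ 4) = mu ^+ 4.
  rewrite -L2; apply: eq_Rintegral => w _.
  rewrite /Z mul1r (_ : 4%N = (2 * 2)%N)// exprM (expr2 (K _)) -normal_charM.
  rewrite expr2 -normal_charM sqr_sqrtr ?addr_ge0 ?sqr_ge0//.
  rewrite -[RHS]normal_char_abs -sqrtr_sqr; congr (K (Num.sqrt _)).
  by rewrite exprMn; ring.
have varZ : \int[P]_w ((Z w - mu) ^+ 2) = nu - mu ^+ 2.
  have -> : \int[P]_w ((Z w - mu) ^+ 2) =
      \int[P]_w ((Z w ^+ 2 + mu ^+ 2) - 2 * mu * Z w).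
    by apply: eq_Rintegral => w _; ring.
  rewrite (bm_intB _ (bmD bZ2 (bc _)) (bmM (bc _) bZ)) (bm_intD _ bZ2 (bc _)).
  rewrite (bm_intZ _ _ bZ) Rint_cst -/nu -/(L 1) -/mu; ring.
have varZ2 : \int[P]_w ((Z w ^+ 2 - nu) ^+ 2) = mu ^+ 4 - nu ^+ 2.
  have -> : \int[P]_w ((Z w ^+ 2 - nu) ^+ 2) =
      \int[P]_w ((Z w ^+ 4 + nu ^+ 2) - 2 * nu * Z w ^+ 2).
    by apply: eq_Rintegral => w _; ring.
  rewrite (bm_intB _ (bmD (bmX 4 bZ) (bc _)) (bmM (bc _) bZ2)).
  rewrite (bm_intD _ (bmX 4 bZ) (bc _)) (bm_intZ _ _ bZ2) Rint_cst -/nu Z4; ring.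
have v0 : 0 <= nu - mu ^+ 2.
  by rewrite -varZ; apply: Rintegral_ge0 => w _; exact: sqr_ge0.
have v20 : 0 <= mu ^+ 4 - nu ^+ 2.
  by rewrite -varZ2; apply: Rintegral_ge0 => w _; exact: sqr_ge0.
have numu : nu - mu ^+ 2 = 0.
  apply/eqP; rewrite eq_le v0 andbT subr_le0 -ler_sqr ?nnegrE ?sqr_ge0//; last first.
    by apply: le_trans (sqr_ge0 mu) _; rewrite -subr_ge0.
  by rewrite -exprM -subr_ge0.
have Zmu : {ae P, forall w, (Z w - mu) ^+ 2 = 0}.
  apply: bm_int0; [exact: bmX (bmB bZ (bc _))|by move=> w; exact: sqr_ge0|].
  by rewrite varZ.
(* The constant is |Y w| at one point outside the null set, which shows that E Z is a value of K. *)
have [m mE] : exists m, K m = mu /\ 0 <= m.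
  have : {ae P, forall w, Z w = mu}.
    by apply: filterS Zmu => w /eqP; rewrite sqrf_eq0 subr_eq0 => /eqP.
  move=> [N [mN PN sub]].
  have [w wN] : exists w, ~ N w.
    apply/not_existsP => H.
    have NT : N = setT by apply/seteqP; split => // w _; apply: contrapT.
    by move: PN; rewrite NT probability_setT => /eqP; rewrite eqe oner_eq0.
  exists `|Y w|; split => //; rewrite normal_char_abs; apply: contrapT => H.
  by apply: wN; apply: sub => /=; rewrite /Z mul1r.
exists m; apply: filterS2 Zmu Y0 => w /eqP; rewrite sqrf_eq0 subr_eq0 => /eqP.
rewrite /Z mul1r -mE.1 => /normal_char_inj; rewrite (ger0_norm mE.2) => + Yw.
by rewrite ger0_norm.
Qed.

End one_variable.
End scale_mixture_transform.

Lemma integral_prob_indic d (T : measurableType d) (R : realType)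
  (P : probability T R) (A : set T) :
  measurable A -> (\int[P]_w (\1_A w)%:E = P A)%E.
Proof. by move=> mA; rewrite integral_indic// setIT. Qed.

Lemma ae_exists d (T : measurableType d) (R : realType)
  (P : probability T R) (Q : T -> Prop) : {ae P, forall w, Q w} -> exists w, Q w.
Proof.
move=> [N [mN PN sub]]; apply: contrapT => nQ.
have : (P setT <= P N)%E.
  by apply: le_measure; [exact: mem_set|exact: mem_set|] => w _; apply: sub => /= Qw; apply: nQ; exists w.
by rewrite PN probability_setT lee_fin leNgt ltr01.
Qed.

(** * Gaussianity, degeneracy and absolute mean of a scale mixture *)

Section scale_mixture_facts.
Context d (T : measurableType d) (R : realType) (P : probability T R).
Local Notation N01 := (normal_prob (0 : R) 1).
Local Notation K := (@normal_char R).
Variables Y L : T -> R.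
Hypothesis mY : measurable_fun setT Y.
Hypothesis mL : measurable_fun setT L.
Hypothesis YL : scale_mixture P Y L.

Lemma measurable_scale_integral (f : R -> \bar R) :
  measurable_fun setT f -> (forall x, 0 <= f x)%E ->
  measurable_fun setT (fun w => \int[N01]_y f (L w * y)%R)%E.
Proof.
move=> mf f0.
apply: (measurable_fun_fubini_tonelli_F (m2 := N01)
  (fun z : T * R => f (L z.1 * z.2)%R)); last by move=> z.
apply: measurableT_comp => //; apply: measurable_funM => //.
exact: (measurableT_comp mL measurable_fst).
Qed.

Lemma scale_mixture_probE (A : set R) : measurable A ->
  P (Y @^-1` A) = (\int[P]_w \int[N01]_y (\1_A (L w * y))%:E)%E.
Proof.
move=> mA.
have mYA : measurable (Y @^-1` A) by rewrite -[X in measurable X]setTI; exact: mY.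
rewrite -(YL (f := fun x => (\1_A x)%:E)).
- rewrite -(integral_prob_indic P mYA).
  by apply: eq_integral => w _; rewrite !indicE.
- by apply/measurable_EFinP; exact: measurable_indic.
- by move=> x; rewrite lee_fin.
Qed.

Lemma scale_mixture_gaussian (s : R) : 0 < s -> {ae P, forall w, L w = s} ->
  gaussian P Y.
Proof.
move=> s0 Ls; exists 0, s; split => // A mA; rewrite scale_mixture_probE//.
have mI : measurable_fun setT (fun x => (\1_A x : R)%:E).
  by apply/measurable_EFinP; exact: measurable_indic.
have I0 (x : R) : (0 <= (\1_A x)%:E :> \bar R)%E by rewrite lee_fin.
transitivity (\int[P]_w \int[N01]_y (\1_A (s * y))%:E)%E.
  apply: ge0_ae_eq_integral => //.
  - exact: measurable_scale_integral mI I0.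
  - by move=> w _; exact: integral_ge0.
  - by move=> w _; exact: integral_ge0.
  - by apply: filterS Ls => w -> _.
rewrite integral_prob_cst.
transitivity (\int[normal_prob 0 s]_x (\1_A x)%:E)%E; last exact: integral_prob_indic.
rewrite (ge0_integral_normal_scale 0 (lt0r_neq0 s0) mI I0).
by apply: eq_integral => y _; rewrite addr0.
Qed.

(** For a fixed scale [L w] > 0 the product L w * y hits c only at y = c / L w, which has normal
    probability 0; so [Y] has no atom. *)
Lemma scale_mixture_nondegenerate :
  {ae P, forall w, 0 < L w} -> ~ degenerate P Y.
Proof.
move=> L0 [c Yc].
have mc : measurable [set c] by exact: measurable_set1.
have mI : measurable_fun setT (fun x => (\1_[set c] x : R)%:E).
  by apply/measurable_EFinP; exact: measurable_indic.
have I0 (x : R) : (0 <= (\1_[set c] x)%:E :> \bar R)%E by rewrite lee_fin.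
have PYc : P (Y @^-1` [set c]) = 0%E.
  rewrite scale_mixture_probE//.
  transitivity (\int[P]_w 0)%E; last by rewrite integral_prob_cst.
  apply: ge0_ae_eq_integral => //.
  - exact: measurable_scale_integral mI I0.
  - by move=> w _; exact: integral_ge0.
  - apply: filterS L0 => w L0 _.
    rewrite -[RHS](normal_prob_set1 (c / L w)).
    rewrite -[RHS](integral_prob_indic N01 (measurable_set1 (c / L w))).
    apply: eq_integral => y _; congr EFin; rewrite !indicE; congr (_ %:R).
    congr nat_of_bool; apply: asbool_equiv_eq; split => /= [<-|->].
      by rewrite mulrC mulKf// gt_eqF.
    by rewrite mulrC divfK// gt_eqF.
have mYc : measurable (Y @^-1` [set c]).
  by rewrite -[X in measurable X]setTI; exact: mY.
have Ync : {ae P, forall w, Y w <> c}.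
  by exists (Y @^-1` [set c]); split => // w /contrapT.
by have [w []] := ae_exists (filterI Yc Ync).
Qed.

Lemma scale_mixture_abs :
  (\int[P]_w `|Y w|%:E = (@normal_mean_abs R)%:E * \int[P]_w `|L w|%:E)%E.
Proof.
have mn : measurable_fun setT (fun x : R => `|x|%:E).
  by apply/measurable_EFinP; exact: normr_measurable.
have nLfin : measurable_fun setT (fun w => `|L w|%:E).
  by apply/measurable_EFinP; apply: measurableT_comp.
rewrite (YL mn) => [|x]; last by rewrite lee_fin.
rewrite -ge0_integralZl//; last by rewrite lee_fin ltW// normal_mean_abs_gt0.
apply: eq_integral => w _; rewrite muleC -normal_mean_absE -ge0_integralZl//.
by apply: eq_integral => y _; rewrite -EFinM normrM.
Qed.

(** The transform of [L] at t is the mean of cos (t Y), that is cos (t m) K (t s) for a normal law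
    of mean m and deviation s. It is positive for all t, which forces m = 0, as the cosine would
    vanish at t = pi / (2 m). Then its value at 2 is the fourth power of its value at 1, the
    criterion for degeneracy. *)
Lemma scale_mixture_gaussian_degenerate :
  {ae P, forall w, 0 <= L w} -> gaussian P Y -> degenerate P L.
Proof.
move=> L0 [m [s [s0 Ygauss]]].
apply: mixture_char_eq_degenerate => //.
have s_neq0 : s != 0 by exact: lt0r_neq0.
have mcos : measurable_fun [set: R] (@cos R).
  by apply: continuous_measurable_fun; exact: continuous_cos.
pose f t (y : R) := (cos (t * y) + 1)%:E.
have mf t : measurable_fun setT (f t).
  apply/measurable_EFinP; apply: measurable_funD => //.
  exact: (measurableT_comp mcos (mulrl_measurable t)).
have f0 t y : (0 <= f t y)%E by rewrite lee_fin -lerBlDr sub0r cos_geN1.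
have bY t : bounded_measurable (fun w => cos (t * Y w)).
  split; last by exists 1 => w; exact: cos_max.
  apply: (measurableT_comp mcos); exact: (measurableT_comp (mulrl_measurable t)).
have EY t : \int[P]_w cos (t * Y w) = cos (t * m) * K (t * s).
  pose Y' : {mfun T >-> measurableTypeR R} :=
    HB.pack (Y : T -> measurableTypeR R)
      (@isMeasurableFun.Build _ _ T (measurableTypeR R) Y mY).
  have : (\int[P]_w f t (Y w) = \int[N01]_y f t (s * y + m)%R)%E.
    rewrite -(ge0_integral_normal_scale m s_neq0 (mf t) (f0 t)).
    transitivity (\int[distribution P Y']_x f t x)%E.
      exact/esym/(ge0_integral_distribution Y' (mf t) (f0 t)).
    by apply: (@eq_measure_integral _ _ _ _ (normal_prob m s)) => A mA _; exact: Ygauss.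
  rewrite bm_intE; last exact: bmD (bY t) (bm_cst _ _).
  rewrite (bm_intD _ (bY t) (bm_cst _ 1)) Rint_cst.
  have bc := bmM (bm_cst (measurableTypeR R) (cos (t * m))) (bm_cos (t * s)).
  have bs := bmM (bm_cst (measurableTypeR R) (sin (t * m))) (bm_sin (t * s)).
  have -> : (\int[N01]_y f t (s * y + m)%R = \int[N01]_y
    ((cos (t * m) * cos (t * s * y) - sin (t * m) * sin (t * s * y)) + 1)%:E)%E.
    apply: eq_integral => y _; congr (_ + 1)%:E; rewrite mulrDr cosD mulrA.
    by rewrite mulrC [in X in _ - X]mulrC.
  rewrite bm_intE; last exact: bmD (bmB bc bs) (bm_cst _ _).
  rewrite (bm_intD _ (bmB bc bs) (bm_cst _ 1)) (bm_intB _ bc bs).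
  rewrite (bm_intZ _ _ (bm_cos _)) (bm_intZ _ _ (bm_sin _)) normal_sin_char Rint_cst.
  by rewrite mulr0 subr0 => -[/addIr].
have EL t : \int[P]_w cos (t * Y w) = mixture_char P L t.
  rewrite (bm_int_scale_mixture mY mL YL (f := fun y => cos (t * y))).
  - apply: eq_Rintegral => w _; apply: eq_Rintegral => y _.
    by rewrite mulrA.
  - exact: (measurableT_comp mcos (mulrl_measurable t)).
  - by move=> x; exact: cos_max.
have m0 : m = 0.
  apply/eqP/negPn/negP => m0.
  have := mixture_char_gt0 P mL (pi / 2 / m).
  by rewrite -EL EY divfK// cos_pihalf mul0r ltxx.
have LE t : mixture_char P L t = K (t * s) by rewrite -EL EY m0 mulr0 cos0 mul1r.
rewrite !LE mul1r (_ : 4%N = (2 * 2)%N)// exprM (expr2 (K _)) -normal_charM.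
rewrite expr2 -normal_charM sqr_sqrtr ?addr_ge0 ?sqr_ge0//.
rewrite -[LHS]normal_char_abs -sqrtr_sqr; congr (K (Num.sqrt _)).
by rewrite exprMn; ring.
Qed.

End scale_mixture_facts.

(** * Darmois-Skitovich for normal scale mixtures *)

Section darmois_skitovich.
Context d (T : measurableType d) (R : realType) (P : probability T R).
Local Notation N01 := (normal_prob (0 : R) 1).
Local Notation K := (@normal_char R).
Context (I : finType) (eps lam : I -> T -> R).
Hypothesis meps : forall i, measurable_fun setT (eps i).
Hypothesis mlam : forall i, measurable_fun setT (lam i).
Hypothesis indep_eps : mutually_independent P eps.
Hypothesis indep_lam : mutually_independent P lam.
Hypothesis mix : forall i, scale_mixture P (eps i) (lam i).
Local Notation L i := (mixture_char P (lam i)).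

Definition combination (a : I -> R) (w : T) : R := \sum_i a i * eps i w.
Definition mixing_scale (a : I -> R) (w : T) : R :=
  Num.sqrt (\sum_i a i ^+ 2 * lam i w ^+ 2).

Lemma measurable_combination a : measurable_fun setT (combination a).
Proof.
apply: measurable_sum => i.
exact: (measurableT_comp (mulrl_measurable _) (meps i)).
Qed.

Lemma measurable_mixing_scale a : measurable_fun setT (mixing_scale a).
Proof.
apply: (measurableT_comp (@measurable_sqrt R)); apply: measurable_sum => i.
apply: (measurableT_comp (mulrl_measurable _)).
exact: (measurableT_comp (exprn_measurable 2)).
Qed.

Lemma combination_mixture a : scale_mixture P (combination a) (mixing_scale a).
Proof. exact: scale_mixture_sum. Qed.

Let mcos : measurable_fun [set: R] (@cos R).
Proof. by apply: continuous_measurable_fun; exact: continuous_cos. Qed.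

Let msin : measurable_fun [set: R] (@sin R).
Proof. by apply: continuous_measurable_fun; exact: continuous_sin. Qed.

(** Once the combination is known to be a mixture, independence is used on the scales: K of the root
    of a sum of squares is a product, and the independent [lam i] split its mean. *)
Lemma combination_cos a : \int[P]_w cos (combination a w) = \prod_i L i (a i).
Proof.
rewrite (bm_int_scale_mixture (measurable_combination a)
  (measurable_mixing_scale a) (combination_mixture a) mcos (@cos_max R)).
have -> : \int[P]_w \int[N01]_y cos (mixing_scale a w * y) =
    \int[P]_w (\prod_(i in finset.setT) K (a i * lam i w)).
  apply: eq_Rintegral => w _; rewrite -/(K _) /mixing_scale.
  rewrite (_ : \sum_i _ = \sum_i (a i * lam i w) ^+ 2); last first.
    by apply: eq_bigr => i _; rewrite exprMn.
  by rewrite normal_char_sqrt_sum; apply: eq_bigl => i; rewrite finset.in_setT.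
rewrite /Rintegral (integral_prod_indep mlam indep_lam finset.setT
  (h := fun i x => K (a i * x))); last 2 first.
- move=> i; apply: (measurableT_comp (@measurable_normal_char R)).
  exact: mulrl_measurable.
- by move=> i x; exact: normal_char_ge0.
have -> : (\prod_(i in finset.setT) \int[P]_w (K (a i * lam i w))%:E =
    \prod_i (L i (a i))%:E)%E.
  apply: eq_big => i; first by rewrite finset.in_setT.
  by move=> _; rewrite bm_intE//; exact: bm_normal_char.
by rewrite prodEFin.
Qed.

Lemma combination_sin a : \int[P]_w sin (combination a w) = 0.
Proof.
rewrite (bm_int_scale_mixture (measurable_combination a)
  (measurable_mixing_scale a) (combination_mixture a) msin (@sin_max R)).
under eq_Rintegral do rewrite normal_sin_char.
by rewrite Rint_cst.
Qed.

Lemma combinationZ c a w : c * combination a w = combination (fun i => c * a i) w.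
Proof. by rewrite /combination mulr_sumr; apply: eq_bigr => i _; rewrite mulrA. Qed.

Lemma combinationD a b w :
  combination a w + combination b w = combination (fun i => a i + b i) w.
Proof. by rewrite -big_split; apply: eq_bigr => i _; rewrite mulrDl. Qed.

Lemma mixture_char_cst i (m c : R) : {ae P, forall w, lam i w = m} ->
  L i c = K (c * m).
Proof.
move=> lamm; rewrite -[RHS](Rint_cst P); congr fine.
apply: ge0_ae_eq_integral => //.
- by apply/measurable_EFinP; have [] := bm_normal_char (mlam i) c.
- by move=> w _; rewrite lee_fin normal_char_ge0.
- by move=> w _; rewrite lee_fin normal_char_ge0.
- by apply: filterS lamm => w -> _.
Qed.

Opaque normal_char mixture_char.

Section pair.
Variables a b : I -> R.
Hypothesis indep_ab : independent2 P (combination a) (combination b).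

(** The Darmois-Skitovich functional equation. The product of sines in the addition formula
    disappears because the sine of a combination has mean 0. *)
Let factor x y : \prod_i L i (x * a i + y * b i) =
  \prod_i L i (x * a i) * \prod_i L i (y * b i).
Proof.
rewrite -!combination_cos.
have mS (f : R -> R) (c : R) : measurable_fun [set: R] f ->
    measurable_fun [set: R] (fun z : R => f (c * z)).
  by move=> mf; exact: (measurableT_comp mf (mulrl_measurable c)).
have H := bm_int_mul_indep (measurable_combination a) (measurable_combination b)
  indep_ab.
have Hc := H _ _ (mS _ x mcos) (mS _ y mcos) (fun=> cos_max _) (fun=> cos_max _).
have Hs := H _ _ (mS _ x msin) (mS _ y msin) (fun=> sin_max _) (fun=> sin_max _).
have bc c e : bounded_measurable (fun w => cos (c * combination e w)).
  split; last by exists 1 => w; exact: cos_max.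
  exact: (measurableT_comp (mS _ c mcos) (measurable_combination e)).
have bs c e : bounded_measurable (fun w => sin (c * combination e w)).
  split; last by exists 1 => w; exact: sin_max.
  exact: (measurableT_comp (mS _ c msin) (measurable_combination e)).
transitivity (\int[P]_w (cos (x * combination a w) * cos (y * combination b w) -
    sin (x * combination a w) * sin (y * combination b w))).
  by apply: eq_Rintegral => w _; rewrite -combinationD -!combinationZ cosD.
rewrite (bm_intB _ (bmM (bc x a) (bc y b)) (bmM (bs x a) (bs y b))) Hc Hs.
have -> : \int[P]_w sin (x * combination a w) = 0.
  by under eq_Rintegral do rewrite combinationZ; exact: combination_sin.
rewrite mul0r subr0.
by congr (_ * _); apply: eq_Rintegral => w _; rewrite combinationZ.
Qed.

(** Multiply [factor x y] by [factor x (- y)]. In the resulting equality of products each left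
    factor is at least the right one by [mixture_charM_ge], so all are equal. For x = 1 / a i and y
    = 1 / b i, the one at i reads L 2 * L 0 = (L 1)^4, with L 0 = 1. *)
Lemma darmois_skitovich_degenerate i :
  (forall i, {ae P, forall w, 0 <= lam i w}) ->
  a i * b i != 0 -> degenerate P (lam i).
Proof.
move=> lam0; rewrite mulf_eq0 negb_or => /andP[ai bi].
apply: mixture_char_eq_degenerate => //.
pose x := (a i)^-1; pose y := (b i)^-1.
have := @eq_prod_le _ I
  (fun k => L k (x * a k + y * b k) * L k (x * a k - y * b k))
  (fun k => (L k (x * a k) * L k (y * b k)) ^+ 2).
move=> /(_ _ _ _ i).
rewrite [x * a i]mulVf// [y * b i]mulVf// subrr mixture_char0 mulr1.
rewrite (_ : 1 + 1 = 2)// => ->.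
- by rewrite -expr2 -exprM.
- by move=> k; rewrite exprn_gt0// mulr_gt0// mixture_char_gt0.
- by move=> k; exact: mixture_charM_ge.
- have E1 : \prod_k L k (x * a k - y * b k) =
      \prod_k L k (x * a k) * \prod_k L k (y * b k).
    rewrite (eq_bigr (fun k => L k (x * a k + (- y) * b k))); last first.
      by move=> k _; rewrite mulNr.
    rewrite (factor x (- y)); congr (_ * _).
    by apply: eq_bigr => k _; rewrite mulNr mixture_charN.
  transitivity ((\prod_k L k (x * a k) * \prod_k L k (y * b k)) ^+ 2).
    by rewrite expr2 -{1}(factor x y) -E1; exact: big_split.
  rewrite prodrXl; congr (_ ^+ 2); apply/esym; exact: big_split.
Qed.

(** [factor] at (1, 1) and (1, -1) gives equal products for a + b and a - b. Indices with a i * b i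
    = 0 contribute the same positive factor to both, transforms being even. The other scales are
    constant, so injectivity of K leaves an equality of sums of (a + b)^2 m^2 and (a - b)^2 m^2, and
    polarization concludes. *)
Lemma darmois_skitovich_orthogonal (m : I -> R) :
  (forall i, a i * b i != 0 -> {ae P, forall w, lam i w = m i}) ->
  \sum_i a i * b i * m i ^+ 2 = 0.
Proof.
move=> lamm.
have Lm i c : a i * b i != 0 -> L i c = K (c * m i).
  by move=> abi; exact: mixture_char_cst (lamm i abi).
have E : \prod_i L i (a i + b i) = \prod_i L i (a i - b i).
  transitivity (\prod_i L i (1 * a i + 1 * b i)).
    by apply: eq_bigr => k _; rewrite !mul1r.
  transitivity (\prod_i L i (1 * a i + -1 * b i)); last first.
    by apply: eq_bigr => k _; rewrite mul1r mulN1r.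
  apply: etrans (factor 1 1) _; apply: etrans (esym (factor 1 (-1))).
  congr (_ * _); apply: eq_bigr => k _.
  by rewrite mul1r mulN1r mixture_charN.
pose J i := a i * b i != 0.
pose s (e : R) i := if J i then (a i + e * b i) * m i else 0.
have sE e : e = 1 \/ e = -1 -> \prod_i L i (a i + e * b i) =
    K (Num.sqrt (\sum_i s e i ^+ 2)) * \prod_(i | ~~ J i) L i (a i + b i).
  move=> e1; rewrite normal_char_sqrt_sum (bigID J)/=; congr (_ * _).
    rewrite [RHS](bigID J)/= [X in _ = _ * X]big1 ?mulr1; last first.
      by move=> i nJ; rewrite /s (negPf nJ) normal_char0.
    by apply: eq_bigr => i Ji; rewrite /s Ji Lm.
  apply: eq_bigr => i; rewrite /J negbK mulf_eq0 => /orP[]/eqP->.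
    rewrite !add0r; case: e1 => ->; first by rewrite mul1r.
    by rewrite mulN1r mixture_charN.
  by rewrite mulr0.
have E2 : K (Num.sqrt (\sum_i s 1 i ^+ 2)) = K (Num.sqrt (\sum_i s (-1) i ^+ 2)).
  have : \prod_i L i (a i + 1 * b i) = \prod_i L i (a i + -1 * b i).
    transitivity (\prod_i L i (a i + b i)).
      by apply: eq_bigr => i _; rewrite mul1r.
    by apply: etrans E _; apply: eq_bigr => i _; rewrite mulN1r.
  move=> H; have {}H := etrans (esym (sE 1 (or_introl erefl)))
    (etrans H (sE (-1) (or_intror erefl))).
  set q := (X in _ = _ * X) in H.
  have q0 : q != 0.
    apply: lt0r_neq0; apply: prodr_gt0 => i _; exact: mixture_char_gt0.
  exact: (mulIf q0 H).
have s0 e : 0 <= \sum_i s e i ^+ 2 by apply: sumr_ge0 => i _; exact: sqr_ge0.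
have E3 : \sum_i s 1 i ^+ 2 = \sum_i s (-1) i ^+ 2.
  move: (s0 1) (s0 (-1)) (normal_char_inj E2).
  move: (\sum_i s 1 i ^+ 2) (\sum_i s (-1) i ^+ 2) => u v u0 v0.
  by rewrite !ger0_norm ?sqrtr_ge0// => /(congr1 (fun z => z ^+ 2)); rewrite !sqr_sqrtr.
have : 4 * (\sum_i a i * b i * m i ^+ 2) = 0.
  rewrite -[RHS](subrr (\sum_i s (-1) i ^+ 2)) -{1}E3 -sumrB mulr_sumr.
  apply: eq_bigr => i _; rewrite /s; case: ifPn => Ji; first by ring.
  move: Ji; rewrite /J negbK => /eqP->; rewrite mul0r mulr0 expr0n subrr//.
by move/eqP; rewrite mulf_eq0 pnatr_eq0/= => /eqP.
Qed.

End pair.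
End darmois_skitovich.

(** * Unipotent matrices supported by a DAG and column rotations *)

(** If s moves i, then s i -> i is an edge, while following the orbit of i back to i yields a path
    from i to s i: a directed cycle. *)
Lemma acyclic_perm (p : nat) (g : dag p) (s : {perm 'I_p}) :
  (forall i, s i = i \/ edge g (s i) i) -> s = 1%g.
Proof.
move=> sE; apply/permP => i; rewrite perm1.
have [//|ei] := sE i.
have iter_conn n : connect (edge g) ((s ^+ n.+1)%g i) (s i).
  elim: n => [|n IH]; first by rewrite expg1.
  rewrite expgSr permM; apply: connect_trans IH.
  have [->|e] := sE ((s ^+ n.+1)%g i); first exact: connect0.
  exact: connect1.
have : connect (edge g) i (s i).
  have := iter_conn #[s]%g.-1; rewrite prednK ?order_gt0//.
  by rewrite expg_order perm1.
move: (edges_acyclic g) => /forallP/(_ (s i))/forallP/(_ i)/implyP/(_ ei).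
by move=> /negP.
Qed.

Section unipotent.
Context {R : realType} {p : nat}.
Implicit Types (M D S A : 'M[R]_p) (g : dag p).

(** Rows are children and columns are parents, as in I - B. In a topological order such a matrix is
    unit lower triangular, but no order is chosen: acyclicity acts through permutations. *)
Definition unipotent g M :=
  (forall i, M i i = 1) /\ (forall i j, i != j -> M i j != 0 -> edge g j i).

Lemma det_neq0_perm M : \det M != 0 -> exists s : {perm 'I_p}, forall i, M i (s i) != 0.
Proof.
move=> dM.
suff /existsP[s /forallP sM] : [exists s : {perm 'I_p}, [forall i, M i (s i) != 0]].
  by exists s.
apply: contraNT dM; rewrite negb_exists => /forallP H.
rewrite /determinant big1// => s _.
have := H s; rewrite negb_forall => /existsP[i]; rewrite negbK => /eqP Mi.
by rewrite (bigD1 i)//= Mi mul0r mulr0.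
Qed.

Lemma unipotent_perm g M (s : {perm 'I_p}) :
  unipotent g M -> (forall i, M i (s i) != 0) -> s = 1%g.
Proof.
move=> [_ Mg] Ms; apply: (@acyclic_perm _ g) => i.
by have [->|si] := eqVneq (s i) i; [left|right; apply: Mg => //; rewrite eq_sym].
Qed.

(** A permutation with a non-zero Leibniz term moves points along edges only, so it is the
    identity. *)
Lemma det_unipotent g M : unipotent g M -> \det M = 1.
Proof.
move=> uM; rewrite /determinant (bigD1 1%g)//= [X in _ + X]big1 ?addr0.
  by rewrite odd_perm1 mul1r big1// => i _; rewrite perm1 uM.1.
move=> s s1; have /existsP[i] : [exists i, M i (s i) == 0].
  apply: contraNT s1; rewrite negb_exists => /forallP H.
  by apply/eqP; exact: unipotent_perm uM H.
by move=> /eqP Mi; rewrite (bigD1 i)//= Mi mul0r mulr0.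
Qed.

(* The condition under which the product of the E|(A eps)_j| attains its lower
   bound: rows orthogonal for the weights m^2, and no row mixing a non-Gaussian
   error with another one. *)
Definition decoupling (nG : {set 'I_p}) (m : 'I_p -> R) A :=
  (forall j k, j != k -> \sum_i A j i * A k i * m i ^+ 2 = 0) /\
  (forall j i k, i \in nG -> A j i != 0 -> k != i -> A j k = 0).

(* A D with the rows of the non-Gaussian nodes replaced by unit vectors is still
   unipotent; expanding the determinant of the correspondingly modified S
   produces a permutation supported by S, which has to be trivial. *)
Lemma decoupling_nonGaussian (nG : {set 'I_p}) (m : 'I_p -> R) (gD gS : dag p) D S A :
  (forall i, m i != 0) -> unipotent gD D -> unipotent gS S ->
  D = A *m S -> decoupling nG m A ->
  forall i, i \in nG ->
    A i i = 1 /\ forall k, k != i -> A i k = 0 /\ A k i = 0.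
Proof.
move=> m0 uD uS DAS [orth single].
have dA : \det A != 0.
  have := det_unipotent uD; rewrite DAS det_mulmx (det_unipotent uS) mulr1 => ->.
  exact: oner_neq0.
have exj i : exists j, A j i != 0.
  have [s sA] := det_neq0_perm dA.
  by exists ((s^-1)%g i); have := sA ((s^-1)%g i); rewrite permKV.
(* For i in [nG], [f i] turns out to be the only row that charges column i; the aim is f i = i. *)
pose f i := xchoose (exj i).
have fA i : A (f i) i != 0 := xchooseP (exj i).
have sumA i j k : i \in nG -> A j i != 0 ->
    \sum_l A j l * A k l * m l ^+ 2 = A j i * A k i * m i ^+ 2.
  move=> iG Aji; rewrite (bigD1 i)//= big1 ?addr0// => l li.
  by rewrite (single j i l)// !mul0r.
have uniqA i j k : i \in nG -> A j i != 0 -> A k i != 0 -> j = k.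
  move=> iG Aj Ak; apply/eqP; apply: contraT => jk.
  have := orth j k jk; rewrite (sumA i)// => /eqP.
  by rewrite !mulf_eq0 (negPf Aj) (negPf Ak) !(negPf (m0 i)).
pose J := [set f i | i in nG]%SET.
pose D' := \matrix_(j, k) if j \in J then (j == k)%:R else D j k.
(* Row [f i] of A is A (f i) i times the unit vector at i, so this choice of row i of S' makes row
   [f i] of the product the unit vector at [f i]. *)
pose S' := \matrix_(i, k) if i \in nG then (A (f i) i)^-1 * (f i == k)%:R else S i k.
have uD' : unipotent gD D'.
  split=> [i|i j ij]; rewrite mxE; case: ifP => _.
  - by rewrite eqxx.
  - exact: uD.1.
  - by rewrite (negPf ij) eqxx.
  - exact: uD.2.
have D'E : D' = A *m S'.
  apply/matrixP => j k; rewrite !mxE; case: ifPn => [/imsetP[i iG jE]|jJ].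
    rewrite (bigD1 i)//= big1 ?addr0 => [|l li].
      by rewrite mxE iG jE mulrA divff// mul1r.
    by rewrite jE (single (f i) i l)// ?mul0r// fA.
  rewrite DAS mxE; apply: eq_bigr => i _; rewrite mxE; case: ifPn => // iG.
  have [->|Aji] := eqVneq (A j i) 0; first by rewrite !mul0r.
  by move: jJ; rewrite (uniqA i j (f i))// imset_f.
have dS' : \det S' != 0.
  have := det_unipotent uD'; rewrite D'E det_mulmx => dd.
  by apply: contra_eq_neq dd => ->; rewrite mulr0 eq_sym oner_neq0.
have [s sS'] := det_neq0_perm dS'.
have sG i : i \in nG -> s i = f i.
  move=> iG; have := sS' i; rewrite mxE iG.
  by case: (eqVneq (f i) (s i)) => // _; rewrite mulr0 eqxx.
have DfE i k : i \in nG -> D (f i) k = A (f i) i * S i k.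
  move=> iG; rewrite DAS mxE (bigD1 i)//= big1 ?addr0// => l li.
  by rewrite (single (f i) i l)// ?mul0r// fA.
(* On [nG] the move s i = f i is supported by S itself: the diagonal entry of D at [f i] is 1, and
   it equals A (f i) i * S i (f i). *)
have s1 : s = 1%g.
  apply: (unipotent_perm uS) => i; have [iG|iG] := boolP (i \in nG).
    rewrite sG//; have := DfE i (f i) iG; rewrite uD.1 => dd.
    by apply: contra_eq_neq dd => ->; rewrite mulr0 oner_neq0.
  by have := sS' i; rewrite mxE (negPf iG).
have fi i : i \in nG -> f i = i by move=> iG; rewrite -sG// s1 perm1.
move=> i iG; have Aii : A i i != 0 by have := fA i; rewrite fi.
split.
  by have := DfE i i iG; rewrite fi// uD.1 uS.1 mulr1.
move=> k ki; split; first exact: single iG Aii ki.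
apply/eqP; apply: contraNT ki => Aki.
by rewrite (uniqA i k i).
Qed.

End unipotent.

(** * Triangularization by column rotations *)

Section column_rotations.
Context {R : rcfType} {p : nat}.
Implicit Types W : 'M[R]_p.

Definition rotate (i k : 'I_p) (c s : R) (y : 'I_p -> R) : 'I_p -> R :=
  fun l => if l == i then c * y i + s * y k
           else if l == k then c * y k - s * y i else y l.

Definition col_rotate i k c s W : 'M[R]_p :=
  \matrix_(a, b) rotate i k c s (W a) b.

Lemma sum_rotate i k (c s : R) (y z : 'I_p -> R) : i != k -> c ^+ 2 + s ^+ 2 = 1 ->
  \sum_l rotate i k c s y l * rotate i k c s z l = \sum_l y l * z l.
Proof.
move=> ik cs; have ki : k != i by rewrite eq_sym.
rewrite (bigD1 i)//= (bigD1 k)//= [RHS](bigD1 i)//= [in RHS](bigD1 k)//= !addrA.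
congr (_ + _); last first.
  by apply: eq_bigr => l /andP[/negPf li /negPf lk]; rewrite /rotate li lk.
rewrite /rotate !eqxx (negPf ki).
rewrite -[RHS]mul1r -cs; ring.
Qed.

(** Confines the rotations of the triangularization to pairs of coordinates in [G]; for the
    independence of residuals these are the standard normal ones. *)
Definition block_supported (G : {set 'I_p}) W :=
  forall a b, a != b -> W a b != 0 -> (a \in G) && (b \in G).

Lemma block_supported_rotate (G : {set 'I_p}) i k c s W : i \in G -> k \in G ->
  block_supported G W -> block_supported G (col_rotate i k c s W).
Proof.
move=> iG kG sW a b ab; rewrite mxE /rotate.
have H (x y : R) : x * W a i + y * W a k != 0 -> a \in G.
  move=> xy; have [->//|ai] := eqVneq a i; have [->//|ak] := eqVneq a k.
  have [Wai|/(sW _ _ ai)/andP[]//] := eqVneq (W a i) 0.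
  have [Wak|/(sW _ _ ak)/andP[]//] := eqVneq (W a k) 0.
  by move: xy; rewrite Wai Wak !mulr0 addr0 eqxx.
case: (eqVneq b i) => [-> /H ->//|_]; case: (eqVneq b k) => [->|_]; last exact: sW.
by rewrite addrC -mulNr => /H ->.
Qed.

(** Givens triangularization. Entries above the diagonal are cleared in row-major order: [Z n] says
    that those at positions a p + b < n vanish, and N bounds the number of positions left. A
    non-zero entry at (a, b) puts both a and b in [G], so the rotation that clears it is allowed. *)
Lemma rotation_ind (G : {set 'I_p}) (Q : 'M[R]_p -> Prop) :
  (forall W, block_supported G W -> (forall a b : 'I_p, (a < b)%N -> W a b = 0) -> Q W) ->
  (forall W i k c s, i != k -> i \in G -> k \in G -> c ^+ 2 + s ^+ 2 = 1 ->
     Q (col_rotate i k c s W) -> Q W) ->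
  forall W, block_supported G W -> Q W.
Proof.
move=> Qtri Qrot.
pose Z n W := forall a b : 'I_p, (a < b)%N -> (a * p + b < n)%N -> W a b = 0.
suff H N n W : (p * p <= n + N)%N -> Z n W -> block_supported G W -> Q W.
  by move=> W; apply: (H (p * p)%N 0%N).
elim: N n W => [|N IH] n W; first rewrite addn0 => pn Zn sW.
  apply: Qtri => // a b ab; apply: Zn => //; apply: leq_trans pn.
  apply: (@leq_trans (a.+1 * p)).
    by rewrite mulSnr ltn_add2l ltn_ord.
  by rewrite leq_mul2r ltn_ord orbT.
rewrite addnS -addSn => pn Zn sW.
have Znext W' : (forall a b : 'I_p, (a < b)%N -> (a * p + b < n)%N -> W' a b = 0) ->
    (forall a b : 'I_p, (a < b)%N -> (a * p + b = n)%N -> W' a b = 0) -> Z n.+1 W'.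
  move=> h1 h2 a b ab; rewrite ltnS leq_eqVlt => /predU1P[]; first exact: h2.
  exact: h1.
have [/existsP[a /existsP[b /and3P[ab /eqP abn Wab]]]|/existsPn none] :=
  boolP [exists a : 'I_p, exists b : 'I_p,
    [&& (a < b)%N, (a * p + b)%N == n & W a b != 0]]; last first.
  apply: (IH n.+1) => //; apply: Znext => // a b ab abn.
  apply/eqP; apply: contraT => Wab.
  have /existsPn/(_ b) := none a.
  by rewrite ab abn eqxx Wab.
have anb : a != b by apply: contraTneq ab => ->; rewrite ltnn.
have /andP[aG bG] := sW _ _ anb Wab.
pose r := Num.sqrt (W a a ^+ 2 + W a b ^+ 2).
have rr : 0 < W a a ^+ 2 + W a b ^+ 2.
  by rewrite ltr_wpDl ?sqr_ge0// exprn_even_gt0.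
have r0 : r != 0 by rewrite gt_eqF// sqrtr_gt0.
have r2 : r ^+ 2 = W a a ^+ 2 + W a b ^+ 2 by rewrite sqr_sqrtr// ltW.
apply: (Qrot W a b (W a a / r) (W a b / r)) => //.
  by rewrite !expr_div_n -mulrDl -r2 divff// expf_neq0.
apply: (IH n.+1) => //; last exact: block_supported_rotate.
have bp := ltn_ord b.
have idx (a' b' : 'I_p) : (a' * p + b' <= n)%N -> (a' < a)%N \/ (a' = a /\ (b' <= b)%N).
  move=> le; have [lt|gt|/ord_inj eq] := ltngtP a' a; first by left.
    have : (n < a' * p)%N.
      rewrite -abn; apply: leq_trans (_ : (a.+1 * p <= _)%N).
        by rewrite mulSnr ltn_add2l.
      by rewrite leq_mul2r gt orbT.
    by move=> /leq_trans/(_ (leq_addr b' _)); rewrite ltnNge le.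
  by right; split => //; move: le; rewrite -abn eq leq_add2l.
have Zlow (a' c : 'I_p) : (a' < a)%N -> (a' < c)%N -> W a' c = 0.
  move=> lt lt'; apply: Zn => //; rewrite -abn.
  apply: leq_trans (_ : (a'.+1 * p <= _)%N).
    by rewrite mulSnr ltn_add2l ltn_ord.
  by apply: leq_trans (leq_addr _ _); rewrite leq_mul2r lt orbT.
(* Zeros already obtained survive: an earlier row vanishes in both columns a and b, and in row a
   only these two columns change. *)
suff H (a' b' : 'I_p) : (a' < b')%N -> (a' * p + b' <= n)%N ->
    col_rotate a b (W a a / r) (W a b / r) W a' b' = 0.
  by apply: Znext => a' b' lt; [move/ltnW|move=> eq]; apply: H => //; rewrite eq.
move=> lt /idx[lt'|[a'a le]]; rewrite mxE /rotate.
  have Wa : W a' a = 0 by exact: Zlow.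
  have Wb : W a' b = 0 by apply: Zlow => //; exact: ltn_trans ab.
  rewrite Wa Wb !mulr0 addr0 subr0; case: ifP => // _; case: ifP => // _.
  exact: Zlow.
move: lt; rewrite a'a => lt.
have -> : (b' == a) = false.
  by apply/negbTE/eqP => ba; move: lt; rewrite ba ltnn.
case: (eqVneq b' b) => [_|b'b]; first by field.
apply: Zn => //; rewrite -abn ltn_add2l ltn_neqAle le andbT.
by apply: contra b'b => /eqP/ord_inj->.
Qed.

End column_rotations.

(** * Hadamard's inequality and its equality case *)

Section hadamard.
Context {R : realType} {p : nat}.
Implicit Types W : 'M[R]_p.

Definition gram W a b : R := \sum_l W a l * W b l.

Lemma gramE W a b : (W *m W^T) a b = gram W a b.
Proof. by rewrite mxE; apply: eq_bigr => l _; rewrite mxE. Qed.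

Lemma gram_rotate i k c s W a b : i != k -> c ^+ 2 + s ^+ 2 = 1 ->
  gram (col_rotate i k c s W) a b = gram W a b.
Proof.
move=> ik cs; rewrite [RHS]/gram -(sum_rotate _ _ ik cs).
by apply: eq_bigr => l _; rewrite !mxE.
Qed.

Lemma det_sqr_gram W : \det W ^+ 2 = \det (\matrix_(a, b) gram W a b).
Proof.
rewrite expr2 -{2}det_tr -det_mulmx; congr (\det _).
by apply/matrixP => a b; rewrite gramE mxE.
Qed.

Lemma gram_ge_diag W a : W a a ^+ 2 <= gram W a a.
Proof.
rewrite /gram (bigD1 a)//= -expr2 lerDl sumr_ge0// => l _.
by rewrite -expr2 sqr_ge0.
Qed.

Lemma gram_eq_diag W a b : gram W a a = W a a ^+ 2 -> a != b -> W a b = 0.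
Proof.
rewrite /gram (bigD1 a)//= -expr2 => /eqP; rewrite -subr_eq0 addrAC subrr add0r.
rewrite psumr_eq0 => [/allP/(_ b (mem_index_enum _))/implyP H ab|l _]; last first.
  by rewrite -expr2 sqr_ge0.
by apply/eqP; have := H; rewrite eq_sym ab -expr2 sqrf_eq0 => /(_ isT).
Qed.

Lemma det_sqr_triangular W : (forall a b : 'I_p, (a < b)%N -> W a b = 0) ->
  \det W ^+ 2 = \prod_a W a a ^+ 2.
Proof.
move=> tri; rewrite det_trig ?prodrXl//.
by apply/is_trig_mxP.
Qed.

Lemma triangular_gram_diag W : (forall a b : 'I_p, (a < b)%N -> W a b = 0) ->
  \det W != 0 -> \prod_a gram W a a = \det W ^+ 2 ->
  forall a b, a != b -> W a b = 0.
Proof.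
move=> tri dW; rewrite det_sqr_triangular// => eqP' a b; apply: gram_eq_diag.
apply: (@eq_prod_le R 'I_p (fun a => gram W a a) (fun a => W a a ^+ 2)) => //.
- move=> c; rewrite exprn_even_gt0//; apply: contra dW => /eqP Wc.
  rewrite -sqrf_eq0 det_sqr_triangular//.
  by rewrite (bigD1 c)//= Wc expr0n mul0r.
- by move=> c; exact: gram_ge_diag.
Qed.

(** Column rotations preserve the Gram matrix, hence the squared determinant and the row norms, so W
    may be taken lower triangular. There the squared determinant is the product of the squared
    diagonal entries, each at most the squared norm of its row; equality makes W diagonal. *)
Lemma hadamard W : \det W != 0 -> \det W ^+ 2 <= \prod_a gram W a a /\
  (\prod_a gram W a a = \det W ^+ 2 -> forall a b, a != b -> gram W a b = 0).
Proof.
apply: (@rotation_ind _ _ finset.setT (fun W => \det W != 0 ->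
  \det W ^+ 2 <= \prod_a gram W a a /\
  (\prod_a gram W a a = \det W ^+ 2 -> forall a b, a != b -> gram W a b = 0))).
- move=> {}W _ tri dW; split.
    rewrite det_sqr_triangular//; apply: ler_prod => a _.
    by rewrite sqr_ge0 gram_ge_diag.
  move=> eqd a b ab; have diag := triangular_gram_diag tri dW eqd.
  rewrite /gram big1// => l _.
  have [<-|al] := eqVneq a l; last by rewrite diag// mul0r.
  by rewrite (diag b a) ?mulr0// eq_sym.
- move=> {}W i k c s ik _ _ cs IH dW.
  have dE : \det (col_rotate i k c s W) ^+ 2 = \det W ^+ 2.
    rewrite !det_sqr_gram; congr (\det _); apply/matrixP => a b.
    by rewrite !mxE gram_rotate.
  have gE a b := gram_rotate W a b ik cs.
  have [] := IH _.
    by rewrite -sqrf_eq0 dE sqrf_eq0.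
  rewrite dE; under eq_bigr do rewrite gE.
  move=> le eqd; split => // /eqd H a b ab; rewrite -gE; exact: H.
- by move=> a b _ _; rewrite !finset.in_setT.
Qed.

Lemma gram_orthogonal_det W : (forall a b, a != b -> gram W a b = 0) ->
  \det W ^+ 2 = \prod_a gram W a a.
Proof.
move=> orth; rewrite det_sqr_gram.
have -> : \matrix_(a, b) gram W a b = diag_mx (\row_a gram W a a).
  apply/matrixP => a b; rewrite !mxE; case: (eqVneq a b) => [->|ab] //=.
  exact: orth.
by rewrite det_diag; apply: eq_bigr => a _; rewrite mxE.
Qed.

End hadamard.

(** * Decoupling inside a supergraph *)

Section supergraph.
Context {R : realType} {p : nat}.
Implicit Types (M D S A V : 'M[R]_p) (g : dag p).

Lemma connect_antisym g i j : connect (edge g) i j -> connect (edge g) j i -> i = j.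
Proof.
move=> /connectP[[|x s] /=]; first by move=> _ ->.
move=> /andP[ix xs] ej ji.
have xj : connect (edge g) x j by apply/connectP; exists s.
move: (edges_acyclic g) => /forallP/(_ i)/forallP/(_ x)/implyP/(_ ix).
by rewrite (connect_trans xj ji).
Qed.

(** Row i of M V = 1 expresses V i j, for i != j, through the V k j with k a parent of i; the
    induction is on the number of ancestors of i. *)
Lemma unipotent_inv_support g M V : unipotent g M -> M *m V = 1%:M ->
  forall i j, V i j != 0 -> connect (edge g) j i.
Proof.
move=> uM MV i j.
pose anc i := [set l | connect (edge g) l i]%SET.
have [n] := ubnP #|anc i|; elim: n i => // n IH i; rewrite ltnS => ltn Vij.
have [->|ij] := eqVneq i j; first exact: connect0.
have : [exists k, [&& k != i, M i k != 0 & V k j != 0]].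
  apply: contraNT Vij; rewrite negb_exists => /forallP H.
  have := congr1 (fun Z : 'M[R]_p => Z i j) MV.
  rewrite !mxE (negPf ij) (bigD1 i)//= uM.1 mul1r big1 ?addr0 => [->//|k ki].
  by have := H k; rewrite ki/= negb_and !negbK => /orP[]/eqP->; rewrite ?mul0r ?mulr0.
move=> /existsP[k /and3P[ki Mik Vkj]].
have eki : edge g k i by apply: uM.2 => //; rewrite eq_sym.
apply: connect_trans (connect1 eki); apply: IH => //.
apply: leq_trans (_ : (#|anc i| <= n)%N) => //.
apply: proper_card; apply/properP; split.
  by apply/fintype.subsetP => l; rewrite !inE => lk; exact: connect_trans lk (connect1 eki).
exists i; rewrite !inE ?connect0//; apply/negP => ik.
by have := connect_antisym ik (connect1 eki); move/eqP; rewrite eq_sym (negPf ki).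
Qed.

Lemma unipotent_mul_support g M V A : unipotent g M ->
  (forall i j, V i j != 0 -> connect (edge g) j i) -> A = M *m V ->
  forall i j, A i j != 0 -> connect (edge g) j i.
Proof.
move=> uM Vg -> i j; rewrite mxE => Aij.
have /existsP[k /andP[Mik Vkj]] : [exists k, (M i k != 0) && (V k j != 0)].
  apply: contraNT Aij; rewrite negb_exists => /forallP H.
  by rewrite big1// => k _; have := H k; rewrite negb_and !negbK => /orP[]/eqP->;
    rewrite ?mul0r ?mulr0.
apply: connect_trans (Vg _ _ Vkj) _.
have [->|ik] := eqVneq i k; first exact: connect0.
by apply: connect1; exact: uM.2.
Qed.

(* With both D and S supported by g, A and its inverse only charge ancestors; as
   the rows of A are orthogonal, the inverse has the support of the transpose. *)
Lemma decoupling_supergraph g (nG : {set 'I_p}) (m : 'I_p -> R) D S A :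
  (forall i, m i != 0) -> unipotent g D -> unipotent g S ->
  D = A *m S -> decoupling nG m A -> A = 1%:M.
Proof.
move=> m0 uD uS DAS [orth _].
have Du : D \in unitmx by rewrite unitmxE (det_unipotent uD) unitr1.
have Su : S \in unitmx by rewrite unitmxE (det_unipotent uS) unitr1.
have AE : A = D *m invmx S by rewrite DAS mulmxK.
pose A' := S *m invmx D.
have A'A : A' *m A = 1%:M by rewrite /A' AE !mulmxA mulmxKV// mulmxV.
have sA := unipotent_mul_support uD (unipotent_inv_support uS (mulmxV Su)) AE.
have sA' := unipotent_mul_support uS (unipotent_inv_support uD (mulmxV Du))
  (erefl A').
pose q j := \sum_l A j l * A j l * m l ^+ 2.
have A'E i j : A' i j * q j = A j i * m i ^+ 2.
  have : A' *m (A *m (\matrix_(l, k) (A k l * m l ^+ 2))) =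
         \matrix_(l, k) (A k l * m l ^+ 2) by rewrite mulmxA A'A mul1mx.
  move=> /(congr1 (fun Z : 'M[R]_p => Z i j)); rewrite [RHS]mxE => <-.
  rewrite [RHS]mxE (bigD1 j)//= big1 ?addr0 => [|k kj].
    by congr (_ * _); rewrite mxE; apply: eq_bigr => l _; rewrite mxE mulrA.
  rewrite [X in _ * X](_ : _ = 0) ?mulr0// mxE -[RHS](orth k j kj).
  by apply: eq_bigr => l _; rewrite mxE mulrA.
have diag i j : i != j -> A i j = 0.
  move=> ij; apply/eqP; apply: contraT => Aij.
  have A'ji : A' j i != 0.
    apply: contraNneq Aij => A'0; have := A'E j i; rewrite A'0 mul0r => /esym/eqP.
    by rewrite !mulf_eq0 !(negPf (m0 j)) !orbF.
  by have := connect_antisym (sA _ _ Aij) (sA' _ _ A'ji) => /eqP; rewrite eq_sym (negPf ij).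
apply/matrixP => i j; rewrite mxE; case: (eqVneq i j) => [<-|/diag//].
have := uD.1 i; rewrite DAS mxE (bigD1 i)//= uS.1 mulr1 big1 ?addr0// => k ki.
by rewrite diag ?mul0r// eq_sym.
Qed.

End supergraph.

(** * Orthogonal transformations of independent normal variables *)

Section gaussian_rotation.
Context d (T : measurableType d) (R : realType) (P : probability T R) (p : nat).
Local Notation N01 := (normal_prob (0 : R) 1).
Implicit Types Y : 'I_p -> T -> R.

Lemma mutually_independentT Y :
  (forall A : 'I_p -> set R, (forall i, measurable (A i)) ->
    P (\bigcap_i (Y i @^-1` A i)) = (\prod_i P (Y i @^-1` A i))%E) ->
  mutually_independent P Y.
Proof.
move=> H J A mA; pose A' i := if i \in J then A i else setT.
have mA' i : measurable (A' i) by rewrite /A'; case: ifP.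
have := H A' mA'.
have -> : \bigcap_i (Y i @^-1` A' i) = \bigcap_(i in [set` J]) (Y i @^-1` A i).
  apply/seteqP; split => w wA i /=.
    by move=> iJ; have := wA i I; rewrite /A' iJ.
  by move=> _; rewrite /A'; case: ifPn => // iJ; exact: wA.
move=> ->; rewrite (bigID (mem J))/= [X in (_ * X)%E]big1 ?mule1.
  by apply: eq_bigr => i iJ; rewrite /A' iJ.
by move=> i iJ; rewrite /A' (negPf iJ) preimage_setT probability_setT.
Qed.

Definition standard_normal (Z : T -> R) :=
  forall A, measurable A -> P (Z @^-1` A) = N01 A.

Lemma standard_normal_integral (Z : T -> R) (g : R -> \bar R) :
  measurable_fun setT Z -> standard_normal Z ->
  measurable_fun setT g -> (forall x, 0 <= g x)%E ->
  (\int[P]_w g (Z w) = \int[N01]_x g x)%E.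
Proof.
move=> mZ ZN mg g0.
pose Z' : {mfun T >-> measurableTypeR R} :=
  HB.pack (Z : T -> measurableTypeR R)
    (@isMeasurableFun.Build _ _ T (measurableTypeR R) Z mZ).
transitivity (\int[distribution P Z']_x g x)%E.
  exact/esym/(ge0_integral_distribution Z' mg g0).
by apply: (@eq_measure_integral _ _ _ _ N01) => A mA _; exact: ZN.
Qed.

Section rotation.
Variables (Y : 'I_p -> T -> R) (i k : 'I_p) (c s : R).
Hypothesis mY : forall l, measurable_fun setT (Y l).
Hypothesis indepY : mutually_independent P Y.
Hypotheses (iN : standard_normal (Y i)) (kN : standard_normal (Y k)).
Hypotheses (ik : i != k) (cs : c ^+ 2 + s ^+ 2 = 1).

Definition rotate_family (l : 'I_p) (w : T) : R := rotate i k c s (Y ^~ w) l.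
Local Notation Z := rotate_family.

Let ki : (k == i) = false. Proof. by rewrite eq_sym; exact: negbTE. Qed.

Lemma measurable_rotate_family l : measurable_fun setT (Z l).
Proof.
rewrite /Z /rotate; have mZ a (j : 'I_p) : measurable_fun setT (fun w => a * Y j w).
  exact: (measurableT_comp (mulrl_measurable a) (mY j)).
case: eqP => _; first exact: measurable_funD.
by case: eqP => _; [exact: measurable_funB|exact: mY].
Qed.

Let adaptedZ l : l \in [set i; k]%SET -> adapted Y [set i; k]%SET (Z l).
Proof.
have aY a j : j \in [set i; k]%SET -> adapted Y [set i; k]%SET (fun w => a * Y j w).
  move=> jik; have mj : adapted Y [set i; k]%SET (Y j) by exact: adapted_coord.
  exact: (measurableT_comp (mulrl_measurable a) mj).
have iik : i \in [set i; k]%SET by rewrite !inE eqxx.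
have kik : k \in [set i; k]%SET by rewrite !inE eqxx orbT.
move=> lik; rewrite /Z /rotate; case: eqP => _.
  exact: measurable_funD (aY _ _ iik) (aY _ _ kik).
by case: eqP => _; [exact: measurable_funB (aY _ _ kik) (aY _ _ iik)|exact: adapted_coord].
Qed.

Let pairZ A B : measurable A -> measurable B ->
  P (Z i @^-1` A `&` Z k @^-1` B) = (N01 A * N01 B)%E.
Proof.
move=> mA mB.
pose f (z : R * R) : \bar R := (\1_A z.1 * \1_B z.2)%:E.
have mf : measurable_fun setT f.
  apply/measurable_EFinP; apply: measurable_funM.
    exact: (measurableT_comp (measurable_indic mA) measurable_fst).
  exact: (measurableT_comp (measurable_indic mB) measurable_snd).
have f0 z : (0 <= f z)%E by rewrite lee_fin mulr_ge0.
have mfE (z : R * R) : (\1_(A `*` B) z)%:E = f z :> \bar R.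
  rewrite /f !indicE -natrM mulnb; congr (_ %:R%:E); congr nat_of_bool.
  apply/idP/andP => [/set_mem[/= zA zB]|[/set_mem zA /set_mem zB]].
    by split; exact: mem_set.
  exact: mem_set.
pose g (z : R * R) := f (c * z.1 + s * z.2, c * z.2 - s * z.1).
have mg : measurable_fun setT g.
  have ml a (h : R * R -> R) : measurable_fun setT h ->
      measurable_fun setT (fun z => a * h z).
    by move=> mh; exact: (measurableT_comp (mulrl_measurable a) mh).
  apply: (measurableT_comp mf); apply/measurable_fun_pairP; split.
    exact: measurable_funD (ml _ _ measurable_fst) (ml _ _ measurable_snd).
  exact: measurable_funB (ml _ _ measurable_snd) (ml _ _ measurable_fst).
have g0 z : (0 <= g z)%E by exact: f0.
have mZA : measurable (Z i @^-1` A `&` Z k @^-1` B).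
  by apply: measurableI; rewrite -[X in measurable X]setTI;
    exact: measurable_rotate_family.
rewrite -(integral_prob_indic P mZA).
transitivity (\int[P]_w g (Y i w, Y k w))%E.
  apply: eq_integral => w _; rewrite /g -mfE /= !indicE; congr (_ %:R%:E).
  congr nat_of_bool; apply: asbool_equiv_eq.
  by rewrite /= /Z /rotate !eqxx ki.
have dik : [disjoint [set i]%SET & [set k]%SET]%B by rewrite disjoints1 inE.
have a1 l : adapted Y [set l]%SET (Y l) by apply: adapted_coord; rewrite inE.
rewrite (integral_indep_adapted mY indepY dik (a1 i) (a1 k) mg g0).
transitivity (\int[N01]_x \int[N01]_y g (x, y))%E.
  rewrite -(standard_normal_integral (mY i) iN (g := fun x => \int[N01]_y g (x, y))%E).
  - apply: eq_integral => w _.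
    rewrite -(standard_normal_integral (mY k) kN (g := fun y => g (Y i w, y)))//.
    by apply: (measurableT_comp mg); exact: pair1_measurable.
  - exact: (measurable_fun_fubini_tonelli_F (m2 := N01) g).
  - by move=> x; exact: integral_ge0.
rewrite (normal_rotation cs mf f0).
transitivity (\int[N01]_x ((\1_A x)%:E * N01 B))%E.
  apply: eq_integral => x _.
  rewrite -(integral_prob_indic N01 mB) -ge0_integralZl//.
    by apply/measurable_EFinP; exact: measurable_indic.
rewrite ge0_integralZr//; last by apply/measurable_EFinP; exact: measurable_indic.
by rewrite (integral_prob_indic N01 mA).
Qed.

Lemma rotate_family_normal : standard_normal (Z i) /\ standard_normal (Z k).
Proof.
split=> A mA.
  rewrite -[LHS](congr1 P (setIT _)) -(preimage_setT (Z k)) pairZ//.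
  by rewrite (probability_setT N01) mule1.
rewrite -[LHS](congr1 P (setTI _)) -(preimage_setT (Z i)) pairZ//.
by rewrite (probability_setT N01) mul1e.
Qed.

(** Outside {i, k} the family is unchanged and independent of the pair at i and k; inside the
    rotated pair, [pairZ] gives a product of two standard normal laws. *)
Lemma rotate_family_independent : mutually_independent P Z.
Proof.
apply: mutually_independentT => A mA.
have [Zi Zk] := rotate_family_normal.
pose S := [set i; k]%SET.
pose E0 := \bigcap_(l in [set` (~: S)%SET]) (Y l @^-1` A l).
pose F := Z i @^-1` A i `&` Z k @^-1` A k.
have Zother l : l \in (~: S)%SET -> Z l = Y l.
  rewrite !inE negb_or => /andP[/negPf li /negPf lk].
  by apply/funext => w; rewrite /Z /rotate li lk.
have -> : \bigcap_l (Z l @^-1` A l) = E0 `&` F.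
  apply/seteqP; split => [w wA|w [wE [wi wk]] l _].
    split; last by split; exact: wA.
    by move=> l /= lS; rewrite -Zother//; exact: wA.
  have [lS|] := boolP (l \in (~: S)%SET); first by rewrite Zother//; exact: wE.
  by rewrite !inE negbK => /orP[]/eqP->.
have sE0 : <<s cylinders Y (~: S)%SET >> E0.
  by apply: sub_sigma_algebra; exists A.
have sF : <<s cylinders Y S >> F.
  have sI := @measurableI _ (g_sigma_algebraType (cylinders Y S)).
  apply: sI; apply: adapted_preimage => //; apply: adaptedZ;
    by rewrite !inE eqxx ?orbT.
rewrite (indep_groups mY indepY _ sE0 sF); last by rewrite disjoint_sym finset.disjoints_subset finset.setCK.
rewrite pairZ// indepY// [RHS](bigID (mem (~: S)%SET))/=; congr (_ * _)%E.
  by apply: eq_bigr => l lS; rewrite Zother.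
rewrite (eq_bigl (mem S)); last by move=> l; rewrite inE negbK.
by rewrite /S big_setU1 ?inE ?big_set1//= Zi// Zk.
Qed.

End rotation.

(** Rotating the columns of W and the variables together leaves every row combination unchanged, and
    the rotated family satisfies the same hypotheses, since only standard normal coordinates are
    touched. The family is therefore generalized in the induction on W. Once W is triangular, its
    orthogonal rows make it diagonal. *)
Lemma orthogonal_rows_independent (G : {set 'I_p}) (W : 'M[R]_p) Y :
  block_supported G W -> \det W != 0 ->
  (forall a b, a != b -> gram W a b = 0) ->
  (forall l, measurable_fun setT (Y l)) -> mutually_independent P Y ->
  (forall l, l \in G -> standard_normal (Y l)) ->
  mutually_independent P (fun a w => \sum_l W a l * Y l w).
Proof.
move=> sW dW oW mY iY nY; move: W sW Y mY iY nY dW oW.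
apply: rotation_ind => [W _ tri Y mY iY nY dW oW|W i k c s ik iG kG cs IH Y mY iY nY dW oW].
  have diag := triangular_gram_diag tri dW (esym (gram_orthogonal_det oW)).
  have WY a w : \sum_l W a l * Y l w = W a a * Y a w.
    rewrite (bigD1 a)//= big1 ?addr0// => l la.
    by rewrite diag ?mul0r// eq_sym.
  have -> : (fun a w => \sum_l W a l * Y l w) = fun a w => W a a * Y a w.
    by apply/funext => a; apply/funext => w; exact: WY.
  move=> J A mA.
  apply: (iY J (fun a => (fun x => W a a * x) @^-1` A a)) => a.
  rewrite -[X in measurable X]setTI.
  exact: (mulrl_measurable (W a a) measurableT (mA a)).
have [Zi Zk] := rotate_family_normal mY iY (nY i iG) (nY k kG) ik cs.
have -> : (fun a w => \sum_l W a l * Y l w) =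
    fun a w => \sum_l col_rotate i k c s W a l * rotate_family Y i k c s l w.
  apply/funext => a; apply/funext => w; rewrite -(sum_rotate _ _ ik cs).
  by apply: eq_bigr => l _; rewrite mxE.
apply: IH.
- by move=> l; exact: measurable_rotate_family.
- exact: rotate_family_independent (nY i iG) (nY k kG) ik cs.
- move=> l lG; have [->//|li] := eqVneq l i; have [->//|lk] := eqVneq l k.
  have -> : rotate_family Y i k c s l = Y l; last exact: nY.
  apply/funext => w.
  by rewrite /rotate_family /rotate (negPf li) (negPf lk).
- rewrite -sqrf_eq0 det_sqr_gram.
  rewrite (_ : \matrix_(a, b) _ = \matrix_(a, b) gram W a b).
    by rewrite -det_sqr_gram sqrf_eq0.
  by apply/matrixP => a b; rewrite !mxE gram_rotate.
- by move=> a b ab; rewrite gram_rotate//; exact: oW.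
Qed.

End gaussian_rotation.

(** * Almost sure modifications and mean mixing scales *)

Section almost_everywhere.
Context d (T : measurableType d) (R : realType) (P : probability T R).

Lemma ae_measure_eq (A E : set T) :
  measurable A -> measurable E -> {ae P, forall w, A w <-> E w} -> P A = P E.
Proof.
move=> mA mE [N [mN PN sub]]; apply/eqP; rewrite eq_le; apply/andP; split.
  apply: (@le_trans _ _ (P (E `|` N))); last by rewrite (measureU0 mE mN PN).
  apply: le_measure; [exact: mem_set|by apply: mem_set; exact: measurableU|].
  by move=> w Aw; have [Ew|nE] := pselect (E w); [left|right; apply: sub => /= -[/(_ Aw)]].
apply: (@le_trans _ _ (P (A `|` N))); last by rewrite (measureU0 mA mN PN).
apply: le_measure; [exact: mem_set|by apply: mem_set; exact: measurableU|].
by move=> w Ew; have [Aw|nA] := pselect (A w); [left|right; apply: sub => /= -[_ /(_ Ew)]].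
Qed.

Let mpre (Y : T -> R) A : measurable_fun setT Y -> measurable A -> measurable (Y @^-1` A).
Proof. by move=> mY mA; rewrite -[X in measurable X]setTI; exact: mY. Qed.

Lemma ae_eq_probability (Y Z : T -> R) (A : set R) :
  measurable_fun setT Y -> measurable_fun setT Z -> measurable A ->
  {ae P, forall w, Y w = Z w} -> P (Y @^-1` A) = P (Z @^-1` A).
Proof.
move=> mY mZ mA YZ; apply: ae_measure_eq => //; [exact: mpre|exact: mpre|].
by apply: filterS YZ => w /=; rewrite /preimage /= => ->.
Qed.

Lemma ae_gaussian (Y Z : T -> R) : measurable_fun setT Y -> measurable_fun setT Z ->
  {ae P, forall w, Y w = Z w} -> gaussian P Y -> gaussian P Z.
Proof.
move=> mY mZ YZ [m [s [s0 H]]]; exists m, s; split => // A mA.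
by rewrite -H//; apply/esym/ae_eq_probability.
Qed.

Lemma ae_degenerate (Y Z : T -> R) :
  {ae P, forall w, Y w = Z w} -> degenerate P Y -> degenerate P Z.
Proof. by move=> YZ [c Yc]; exists c; apply: filterS2 YZ Yc => w <-. Qed.

Lemma ae_all (I : finType) (Q : I -> T -> Prop) :
  (forall i, {ae P, forall w, Q i w}) -> {ae P, forall w, forall i, Q i w}.
Proof.
move=> H.
suff: {ae P, forall w, forall i, i \in enum I -> Q i w}.
  by apply: filterS => w Qw i; apply: Qw; rewrite mem_enum.
elim: (enum I) => [|i s IH]; first by apply: aeW => w i; rewrite in_nil.
by apply: filterS2 (H i) IH => w Qi Qs j; rewrite inE => /predU1P[->|/Qs].
Qed.

Lemma ae_mutually_independent (I : finType) (Y Z : I -> T -> R) :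
  (forall i, measurable_fun setT (Y i)) -> (forall i, measurable_fun setT (Z i)) ->
  (forall i, {ae P, forall w, Y i w = Z i w}) ->
  mutually_independent P Y -> mutually_independent P Z.
Proof.
move=> mY mZ YZ iY J A mA.
transitivity (P (\bigcap_(i in [set` J]) (Y i @^-1` A i))).
  apply: ae_measure_eq => //.
  - by apply: fin_bigcap_measurable => [|i _]; [exact: finite_finset|exact: mpre].
  - by apply: fin_bigcap_measurable => [|i _]; [exact: finite_finset|exact: mpre].
  - apply: filterS (ae_all YZ) => w YZw; split=> H i /= iJ; have := H i iJ;
      by rewrite /= /preimage /= YZw.
by rewrite iY//; apply: eq_bigr => i _; exact: ae_eq_probability.
Qed.

Lemma ae_independent2 (Y Z Y' Z' : T -> R) :
  measurable_fun setT Y -> measurable_fun setT Z ->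
  measurable_fun setT Y' -> measurable_fun setT Z' ->
  {ae P, forall w, Y w = Y' w} -> {ae P, forall w, Z w = Z' w} ->
  independent2 P Y Z -> independent2 P Y' Z'.
Proof.
move=> mY mZ mY' mZ' YY' ZZ' YZ A B mA mB.
rewrite -(ae_eq_probability mY mY' mA YY') -(ae_eq_probability mZ mZ' mB ZZ') -YZ//.
apply: ae_measure_eq => //; [apply: measurableI; exact: mpre..|].
by apply: filterS2 YY' ZZ' => w Yw Zw; rewrite /= /preimage /= Yw Zw.
Qed.

Lemma mutually_independent_pair (I : finType) (Y : I -> T -> R) i j :
  mutually_independent P Y -> i != j -> independent2 P (Y i) (Y j).
Proof.
move=> iY ij A B mA mB.
have := iY [set i; j]%SET (fun l => if l == i then A else B) (fun l => _).
rewrite big_setU1 ?inE//= big_set1 eqxx eq_sym (negPf ij) => <-.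
  congr (P _); apply/seteqP; split => [w [wA wB] l /=|w wAB].
    by rewrite !inE => /orP[]/eqP->; rewrite ?eqxx// eq_sym (negPf ij).
  split.
    by have /= := wAB i; rewrite !inE eqxx => /(_ isT).
  by have /= := wAB j; rewrite !inE eqxx orbT eq_sym (negPf ij) => /(_ isT).
by move=> l; case: ifP.
Qed.

Lemma scale_mixture_standard (Y L : T -> R) (s : R) :
  measurable_fun setT Y -> measurable_fun setT L -> scale_mixture P Y L ->
  s != 0 -> {ae P, forall w, L w = s} -> standard_normal P (fun w => s^-1 * Y w).
Proof.
move=> mY mL YL s0 Ls A mA.
have mA' : measurable ((fun x : R => s^-1 * x) @^-1` A).
  rewrite -[X in measurable X]setTI.
  exact: (mulrl_measurable s^-1 measurableT mA).
rewrite -[LHS]/(P (Y @^-1` ((fun x => s^-1 * x) @^-1` A))) (scale_mixture_probE mY YL mA').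
have mI : measurable_fun setT (fun x => (\1_((fun x : R => s^-1 * x) @^-1` A) x : R)%:E).
  by apply/measurable_EFinP; exact: measurable_indic.
have I0 (x : R) : (0 <= (\1_((fun x : R => s^-1 * x) @^-1` A) x)%:E :> \bar R)%E.
  by rewrite lee_fin.
transitivity (\int[P]_w (normal_prob 0 1 A))%E; last exact: integral_prob_cst.
apply: ge0_ae_eq_integral => //.
- exact: measurable_scale_integral mL _ mI I0.
- by move=> w _; exact: integral_ge0.
- apply: filterS Ls => w -> _.
  rewrite -[RHS](integral_prob_indic (normal_prob 0 1) mA); apply: eq_integral => y _.
  by rewrite !indicE; congr (_ %:R%:E); congr nat_of_bool; apply: asbool_equiv_eq;
    rewrite /preimage /= mulKf.
Qed.

End almost_everywhere.

(** * Mean of the mixing scale against the mixing scale of the means *)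

Section mean_mixing_scale.
Context d (T : measurableType d) (R : realType) (P : probability T R).
Context (I : finType) (lam : I -> T -> R).
Hypothesis mlam : forall i, measurable_fun setT (lam i).
Hypothesis indep_lam : mutually_independent P lam.
Hypothesis lam_gt0 : forall i, {ae P, forall w, 0 < lam i w}.
Hypothesis int_lam : forall i, P.-integrable setT (EFin \o lam i).

Definition mean_scale i : R := \int[P]_w lam i w.
Local Notation m := mean_scale.
Local Notation M := (mixing_scale lam).

(** [mean_mixing a] is the mean of the mixing scale and gives, up to a constant, the absolute mean
    of the combination; [mixing_mean a] is the mixing scale at the mean scales, a row norm for
    Hadamard's inequality. *)
Definition mean_mixing (a : I -> R) : R := \int[P]_w M a w.
Definition mixing_mean (a : I -> R) : R := Num.sqrt (\sum_i a i ^+ 2 * m i ^+ 2).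

Let lam_ge0 i : {ae P, forall w, 0 <= lam i w}.
Proof. by apply: filterS (lam_gt0 i) => w /ltW. Qed.

Lemma ae_cst_Rint (f : T -> R) (c : R) : measurable_fun setT f ->
  {ae P, forall w, f w = c} -> \int[P]_w f w = c.
Proof.
move=> mf fc; rewrite -[RHS](Rint_cst P); congr fine.
apply: ae_eq_integral => //; first exact/measurable_EFinP.
by apply: filterS fc => w -> _.
Qed.

Lemma degenerate_mean_scale i : degenerate P (lam i) ->
  {ae P, forall w, lam i w = m i}.
Proof.
by move=> [c lc]; apply: filterS (lc) => w ->; rewrite /m (ae_cst_Rint (mlam i) lc).
Qed.

Lemma mean_scale_gt0 i : 0 < m i.
Proof.
have mE : {ae P, forall w, lam i w = `|lam i w|}.
  by apply: filterS (lam_ge0 i) => w l0; rewrite ger0_norm.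
have mabs : measurable_fun setT (fun w => `|lam i w|) by exact: measurableT_comp.
have E : (\int[P]_w (lam i w)%:E = \int[P]_w (`|lam i w|)%:E)%E.
  apply: ae_eq_integral => //; [exact/measurable_EFinP|exact/measurable_EFinP|].
  by apply: filterS mE => w <-.
have m0 : 0 <= m i by rewrite /m /Rintegral E fine_ge0// integral_ge0.
rewrite lt_neqAle m0 andbT; apply/eqP => m_0.
have : (\int[P]_w `|(lam i w)%:E| = 0)%E.
  have := integrable_fin_num measurableT (int_lam i).
  rewrite -[LHS]/(\int[P]_w (`|lam i w|)%:E)%E -E => fin.
  by rewrite -(fineK fin) -[fine _]/(m i) -m_0.
move=> /ae_eq_integral_abs []//; first exact/measurable_EFinP.
move=> N [mN PN sub].
have l0 : {ae P, forall w, lam i w = 0}.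
  exists N; split => // w /= lw; apply: sub => /= H; apply: lw.
  by have /eqP := H Logic.I; rewrite eqe => /eqP.
have [w [lw]] := ae_exists (filterI (lam_gt0 i) l0).
by move=> l0'; rewrite l0' ltxx in lw.
Qed.

Lemma integrable_mixing_scale a : P.-integrable setT (EFin \o M a).
Proof.
have iS : P.-integrable setT (EFin \o (fun w => \sum_i `|a i| * `|lam i w|)).
  rewrite (_ : _ \o _ = fun w => \sum_i (`|a i|%:E * (`|lam i w|)%:E))%E.
    by apply: integrable_sum => // i _; apply: integrableZl => //; exact: integrable_norm.
  by apply/funext => w; rewrite /= -sumEFin.
apply: le_integrable iS => //.
  by apply/measurable_EFinP; exact: measurable_mixing_scale.
move=> w _; rewrite /= lee_fin ger0_norm ?sqrtr_ge0// (le_trans _ (ler_norm _))//.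
rewrite -[leRHS]ger0_norm ?sumr_ge0// -sqrtr_sqr ler_sqrt ?sqr_ge0//.
have sq (r : seq I) (f : I -> R) : (forall i, 0 <= f i) ->
    0 <= \sum_(i <- r) f i /\ \sum_(i <- r) f i ^+ 2 <= (\sum_(i <- r) f i) ^+ 2.
  move=> f0; elim: r => [|i r [IH0 IH]]; first by rewrite !big_nil expr0n.
  rewrite !big_cons addr_ge0//; split => //.
  rewrite sqrrD -addrA lerD2l (le_trans IH)// lerDr mulrn_wge0//.
  by rewrite mulr_ge0.
have := (sq (index_enum I) (fun i => `|a i| * `|lam i w|) _).2.
move=> /(_ (fun i => mulr_ge0 (normr_ge0 _) (normr_ge0 _))).
apply: le_trans; rewrite ler_sum// => i _.
by rewrite -normrM real_normK ?num_real// exprMn.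
Qed.

(** The inner product of the vectors (a i * lam i w) and (a i * m i). Its mean is
    [mixing_mean a ^+ 2], and Cauchy-Schwarz bounds it by [mixing_mean a * M a w]. The mean of the
    gap compares the two means, and a gap that vanishes almost surely makes the vectors
    proportional. *)
Let cross a w := \sum_i a i ^+ 2 * m i * lam i w.

Let integrable_cross a : P.-integrable setT (EFin \o cross a).
Proof.
rewrite (_ : _ \o _ = fun w => \sum_i ((a i ^+ 2 * m i)%:E * (lam i w)%:E))%E.
  by apply: integrable_sum => // i _; exact: (integrableZl measurableT _ (int_lam i)).
by apply/funext => w; rewrite /= /cross -sumEFin.
Qed.

Let mean_cross a : \int[P]_w cross a w = mixing_mean a ^+ 2.
Proof.
rewrite sqr_sqrtr; last by apply: sumr_ge0 => i _; rewrite mulr_ge0 ?sqr_ge0.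
have : (\int[P]_w (cross a w)%:E = (\sum_i a i ^+ 2 * m i ^+ 2)%:E)%E.
  transitivity (\int[P]_w \sum_i ((a i ^+ 2 * m i)%:E * (lam i w)%:E))%E.
    by apply: eq_integral => w _; rewrite /cross -sumEFin.
  rewrite integral_sum//; last by move=> i; exact: (integrableZl measurableT _ (int_lam i)).
  rewrite -sumEFin; apply: eq_bigr => i _.
  rewrite (integralZl measurableT (int_lam i)) -(fineK (integrable_fin_num measurableT (int_lam i))).
  by rewrite -[fine _]/(m i) -EFinM expr2 mulrA.
by rewrite /Rintegral => ->.
Qed.

(** Lagrange's identity with weights [a i ^+ 2]: it yields Cauchy-Schwarz together with its equality
    case, term by term. *)
Let lagrange a (x y : I -> R) :
  \sum_i \sum_k a i ^+ 2 * a k ^+ 2 * (x i * y k - x k * y i) ^+ 2 =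
  2 * ((\sum_i a i ^+ 2 * x i ^+ 2) * (\sum_i a i ^+ 2 * y i ^+ 2) -
       (\sum_i a i ^+ 2 * y i * x i) ^+ 2).
Proof.
have mulS (f g : I -> R) : (\sum_i f i) * (\sum_i g i) = \sum_i \sum_k f i * g k.
  by rewrite mulr_suml; apply: eq_bigr => i _; rewrite mulr_sumr.
rewrite mulr2n mulrDl mul1r {1}(mulrC (\sum_i a i ^+ 2 * x i ^+ 2)) expr2 !mulS.
rewrite addrACA -opprD -!big_split/= -sumrB; apply: eq_bigr => i _.
rewrite -!big_split/= -sumrB; apply: eq_bigr => k _; ring.
Qed.

Let gap_ge0 a w : 0 <= mixing_mean a * M a w - cross a w.
Proof.
rewrite subr_ge0; apply: le_trans (ler_norm _) _.
rewrite -sqrtr_sqr -sqrtrM ?sumr_ge0//; last first.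
  by move=> i _; rewrite mulr_ge0 ?sqr_ge0.
rewrite ler_sqrt; last first.
  by rewrite mulr_ge0// sumr_ge0// => i _; rewrite mulr_ge0 ?sqr_ge0.
have : 0 <= 2 * ((\sum_i a i ^+ 2 * lam i w ^+ 2) * (\sum_i a i ^+ 2 * m i ^+ 2) -
    cross a w ^+ 2).
  rewrite -lagrange.
  by apply: sumr_ge0 => i _; apply: sumr_ge0 => k _; apply: mulr_ge0 (sqr_ge0 _); exact: mulr_ge0 (sqr_ge0 _) (sqr_ge0 _).
by rewrite pmulr_rge0// subr_ge0 mulrC.
Qed.

Let integrable_gap a : P.-integrable setT
  (EFin \o (fun w => mixing_mean a * M a w - cross a w)).
Proof.
rewrite (_ : _ \o _ = (fun w => (mixing_mean a)%:E * (M a w)%:E) \- (EFin \o cross a))%E//.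
apply: integrableB => //; apply: integrableZl => //.
exact: integrable_mixing_scale.
Qed.

Let mean_gap a : \int[P]_w (mixing_mean a * M a w - cross a w) =
  mixing_mean a * mean_mixing a - mixing_mean a ^+ 2.
Proof.
have iM := integrable_mixing_scale a.
rewrite RintegralB//; last first.
  rewrite (_ : _ \o _ = fun w => (mixing_mean a)%:E * (M a w)%:E)%E//.
  exact: integrableZl.
by rewrite mean_cross RintegralZl.
Qed.

Lemma mixing_mean_gt0 a i : a i != 0 -> 0 < mixing_mean a.
Proof.
move=> ai; rewrite sqrtr_gt0 (bigD1 i)//= ltr_wpDr//.
  by apply: sumr_ge0 => k _; rewrite mulr_ge0 ?sqr_ge0.
by apply: mulr_gt0; [rewrite exprn_even_gt0|exact: exprn_gt0 (mean_scale_gt0 i)].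
Qed.

Lemma mixing_mean_le a : mixing_mean a <= mean_mixing a.
Proof.
have [q0|] := eqVneq (mixing_mean a) 0.
  by rewrite q0; apply: Rintegral_ge0 => w _; exact: sqrtr_ge0.
move=> q_neq0; have q0 : 0 < mixing_mean a by rewrite lt_neqAle eq_sym q_neq0 sqrtr_ge0.
rewrite -(ler_pM2l q0) -expr2 -subr_ge0 -mean_gap.
by apply: Rintegral_ge0 => w _; exact: gap_ge0.
Qed.

(** [lam i] is almost surely a multiple of [lam k], hence independent of itself. Splitting K (sqrt 2
    t lam i) into two factors K (t lam i) and taking means gives L (sqrt 2 t) = (L t)^2; two uses
    give L 2 = (L 1)^4. *)
Lemma mixture_char_proportional i k (c : R) : i != k ->
  {ae P, forall w, lam i w = c * lam k w} -> degenerate P (lam i).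
Proof.
move=> ik ikc.
have ind := mutually_independent_pair indep_lam ik.
have K1 (x : R) : `|normal_char x| <= 1.
  by rewrite ger0_norm ?normal_char_ge0 ?normal_char_le1.
have mK (t : R) : measurable_fun setT (fun x : R => normal_char (t * x)).
  exact: (measurableT_comp (@measurable_normal_char R) (mulrl_measurable t)).
have bK t j : bounded_measurable (fun w => normal_char (t * lam j w)).
  exact: bm_normal_char.
have ae_bm (f g : T -> R) : bounded_measurable f -> bounded_measurable g ->
    {ae P, forall w, f w = g w} -> \int[P]_w f w = \int[P]_w g w.
  move=> [mf _] [mg _] fg; congr fine; apply: ae_eq_integral => //;
    [exact/measurable_EFinP|exact/measurable_EFinP|].
  by apply: filterS fg => w ->.
have sqrt2 t : mixture_char P (lam i) (Num.sqrt 2 * t) = mixture_char P (lam i) t ^+ 2.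
  transitivity (\int[P]_w (normal_char (t * lam i w) * normal_char (t * c * lam k w))).
    apply: ae_bm; [exact: bK|exact: bmM|].
    apply: filterS ikc => w ikw; rewrite -mulrA -ikw -normal_charM.
    rewrite -[LHS]normal_char_abs -sqrtr_sqr; congr (normal_char (Num.sqrt _)).
    by rewrite -mulrA !exprMn sqr_sqrtr//; ring.
  rewrite (bm_int_mul_indep (mlam i) (mlam k) ind (mK t) (mK (t * c)) (fun=> K1 _) (fun=> K1 _)).
  rewrite expr2; congr (_ * _); apply: ae_bm; [exact: bK|exact: bK|].
  by apply: filterS ikc => w ->; rewrite mulrA.
apply: mixture_char_eq_degenerate => //.
have -> : 2 = Num.sqrt 2 * (Num.sqrt 2 * 1) :> R.
  by rewrite mulr1 -expr2 sqr_sqrtr.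
by rewrite !sqrt2 -exprM.
Qed.

(** Equal means make the Cauchy-Schwarz gap vanish almost surely; Lagrange's identity then gives lam
    i * m k = lam k * m i, so the scales are proportional. *)
Lemma mixing_mean_eq_degenerate a i k : mean_mixing a = mixing_mean a ->
  a i != 0 -> a k != 0 -> i != k -> degenerate P (lam i).
Proof.
move=> aeq ai ak ik.
have g0 : (\int[P]_w `|(mixing_mean a * M a w - cross a w)%:E| = 0)%E.
  transitivity (\int[P]_w (mixing_mean a * M a w - cross a w)%:E)%E.
    by apply: eq_integral => w _; rewrite gee0_abs// lee_fin.
  rewrite -(fineK (integrable_fin_num measurableT (integrable_gap a))).
  by rewrite -[fine _]/(\int[P]_w _) mean_gap aeq -expr2 subrr.
have := g0; move=> /ae_eq_integral_abs []//; first exact: measurable_int (integrable_gap a).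
move=> N [mN PN sub].
have prop : {ae P, forall w, lam i w * m k = lam k w * m i}.
  exists N; split => // w /= H; apply: sub => /= G; apply: H.
  have /eqP := G Logic.I; rewrite eqe subr_eq0 => /eqP/(congr1 (fun x => x ^+ 2)).
  rewrite exprMn !sqr_sqrtr; last 2 first.
  - by apply: sumr_ge0 => l _; rewrite mulr_ge0 ?sqr_ge0.
  - by apply: sumr_ge0 => l _; rewrite mulr_ge0 ?sqr_ge0.
  rewrite mulrC => /eqP; rewrite -subr_eq0 => /eqP gap0.
  have := lagrange a (lam ^~ w) m; rewrite gap0 mulr0 => /eqP.
  have t0 j l : 0 <= a j ^+ 2 * a l ^+ 2 * (lam j w * m l - lam l w * m j) ^+ 2.
    by apply: mulr_ge0 (sqr_ge0 _); exact: mulr_ge0 (sqr_ge0 _) (sqr_ge0 _).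
  rewrite psumr_eq0 => [/allP/(_ i (mem_index_enum _))/= |j _]; last exact: sumr_ge0.
  rewrite psumr_eq0// => /allP/(_ k (mem_index_enum _))/=.
  by rewrite !mulf_eq0 (negPf ai) (negPf ak) !orbF/= orbb subr_eq0 => /eqP.
apply: (mixture_char_proportional (c := m i / m k) ik).
apply: filterS prop => w H; have mk : m k != 0 by rewrite gt_eqF// mean_scale_gt0.
by rewrite mulrAC (mulrC (m i)) -H mulfK.
Qed.

Lemma mean_mixing_const a :
  (forall i, a i != 0 -> {ae P, forall w, lam i w = m i}) ->
  {ae P, forall w, M a w = mixing_mean a}.
Proof.
move=> H; have : {ae P, forall w, forall i, a i != 0 -> lam i w = m i}.
  apply: (ae_all (Q := fun i w => a i != 0 -> lam i w = m i)) => i; have [a0|ai] := eqVneq (a i) 0.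
    by apply: aeW.
  by apply: filterS (H i ai).
apply: filterS => w Hw; congr Num.sqrt; apply: eq_bigr => i _.
by have [->|/Hw ->//] := eqVneq (a i) 0; rewrite expr0n !mul0r.
Qed.

Lemma mixing_scale_single a i w : (forall k, k != i -> a k = 0) ->
  M a w = `|a i| * `|lam i w|.
Proof.
move=> H; rewrite /M (bigD1 i)//= big1 => [|k ki]; last by rewrite H// expr0n mul0r.
by rewrite addr0 -exprMn sqrtr_sqr normrM.
Qed.

Lemma mean_mixing_eq a :
  (forall i k, a i != 0 -> k != i -> ~ degenerate P (lam i) -> a k = 0) ->
  mean_mixing a = mixing_mean a.
Proof.
move=> H.
have [[i [ai ndi]]|none] := pselect (exists i, a i != 0 /\ ~ degenerate P (lam i)).
  have ak k : k != i -> a k = 0 by move=> ki; exact: H ai ki ndi.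
  have -> : mixing_mean a = `|a i| * m i.
    rewrite /mixing_mean (bigD1 i)//= big1 => [|k ki]; last by rewrite ak// expr0n mul0r.
    by rewrite addr0 -exprMn sqrtr_sqr normrM (gtr0_norm (mean_scale_gt0 i)).
  rewrite /mean_mixing -RintegralZl//; congr fine; apply: ae_eq_integral => //.
  - by apply/measurable_EFinP; exact: measurable_mixing_scale.
  - by apply/measurable_EFinP; exact: measurable_funM.
  - apply: filterS (lam_ge0 i) => w lw _.
    by rewrite (mixing_scale_single _ ak) (ger0_norm lw).
apply: ae_cst_Rint; first exact: measurable_mixing_scale.
apply: mean_mixing_const => i ai; apply: degenerate_mean_scale.
by apply: contrapT => ndi; apply: none; exists i.
Qed.

Lemma mixing_scale_gt0 a i : a i != 0 -> {ae P, forall w, 0 < M a w}.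
Proof.
move=> ai; apply: filterS (lam_gt0 i) => w lw.
rewrite sqrtr_gt0 (bigD1 i)//= ltr_wpDr//.
  by apply: sumr_ge0 => k _; rewrite mulr_ge0 ?sqr_ge0.
by apply: mulr_gt0; [rewrite exprn_even_gt0|exact: exprn_gt0].
Qed.

End mean_mixing_scale.

(** * Residuals and risk *)

Section residual_matrix.
Context {R : realType} {p : nat}.
Implicit Types (g : dag p) (b : 'I_p -> 'I_p -> R).

Definition structural_mx g b : 'M[R]_p :=
  \matrix_(j, k) ((j == k)%:R - (if k \in parents g j then b j k else 0)).

Lemma edge_irrefl g i : edge g i i = false.
Proof.
apply/negP => ii; move: (edges_acyclic g) => /forallP/(_ i)/forallP/(_ i)/implyP/(_ ii).
by rewrite connect0.
Qed.

Lemma structural_mx_unipotent g b : unipotent g (structural_mx g b).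
Proof.
split=> [i|i j ij]; rewrite mxE.
  by rewrite inE edge_irrefl eqxx subr0.
rewrite (negPf ij) sub0r; case: ifPn => [|_]; first by rewrite inE.
by rewrite oppr0 eqxx.
Qed.

Lemma residual_structural_mx g b x j :
  residual g b x j = \sum_k structural_mx g b j k * tnth x k.
Proof.
rewrite /residual; under [RHS]eq_bigr do rewrite mxE mulrBl.
rewrite sumrB [X in _ = X - _](bigD1 j)//= eqxx mul1r [X in _ + X - _]big1 ?addr0; last first.
  by move=> k kj; rewrite eq_sym (negPf kj) mul0r.
congr (_ - _); rewrite big_mkcond; apply: eq_bigr => k _.
by case: ifP => //; rewrite mul0r.
Qed.

Definition error_mx gstar bstar g b : 'M[R]_p :=
  structural_mx g b *m invmx (structural_mx gstar bstar).

Lemma structural_mx_unit g b : structural_mx g b \in unitmx.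
Proof. by rewrite unitmxE (det_unipotent (structural_mx_unipotent g b)) unitr1. Qed.

Lemma error_mxK gstar bstar g b :
  structural_mx g b = error_mx gstar bstar g b *m structural_mx gstar bstar.
Proof. by rewrite mulmxKV// structural_mx_unit. Qed.

Lemma det_error_mx gstar bstar g b : \det (error_mx gstar bstar g b) = 1.
Proof.
have := congr1 (@determinant R p) (error_mxK gstar bstar g b).
by rewrite det_mulmx !(det_unipotent (structural_mx_unipotent _ _)) mulr1.
Qed.

Lemma error_mx_self gstar bstar : error_mx gstar bstar gstar bstar = 1%:M.
Proof. by rewrite /error_mx mulmxV// structural_mx_unit. Qed.

Lemma error_mx_row gstar bstar g b j :
  (forall k, structural_mx g b j k = structural_mx gstar bstar j k) ->
  forall i, error_mx gstar bstar g b j i = (j == i)%:R.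
Proof.
move=> H i; have := error_mx_self gstar bstar.
move=> /matrixP/(_ j i); rewrite [RHS]mxE => <-; rewrite !mxE.
by apply: eq_bigr => k _; rewrite H.
Qed.

Lemma det_row_neq0 (A : 'M[R]_p) j : \det A != 0 -> exists i, A j i != 0.
Proof. by move=> /det_neq0_perm[s /(_ j)]; exists (s j). Qed.

End residual_matrix.

(** * Consequences of the true model *)

Section model.
Context (R : realType) (d : measure_display) (T : measurableType d)
  (P : probability T R) (p : nat) (gstar : dag p) (bstar : 'I_p -> 'I_p -> R)
  (X : {RV P >-> p.-tuple R}) (eps lambda : 'I_p -> {RV P >-> R})
  (Q : 'I_p -> probability R R).
Hypothesis Hmodel : true_model gstar bstar X eps lambda Q.
Local Notation N01 := (normal_prob (0 : R) 1).
Local Notation nG := (nonGaussian_nodes P (fun j => lambda j : T -> R)).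
Local Notation lam := (fun j => lambda j : T -> R).
Local Notation ep := (fun j => eps j : T -> R).
Local Notation m := (mean_scale P lam).

Lemma model_meps i : measurable_fun setT (ep i).
Proof. exact: measurable_funPT. Qed.

Lemma model_mlam i : measurable_fun setT (lam i).
Proof. exact: measurable_funPT. Qed.

Lemma model_lam_gt0 i : {ae P, forall w, 0 < lam i w}.
Proof.
have mI : measurable (`]0, +oo[ : set R) by exact: measurable_itv.
have mL : measurable (lam i @^-1` `]0, +oo[).
  by rewrite -[X in measurable X]setTI; exact: model_mlam.
have P1 : P (lam i @^-1` `]0, +oo[) = 1%E.
  by rewrite -(Q_positive Hmodel i) -(lambda_law Hmodel i mI).
exists (~` (lam i @^-1` `]0, +oo[)); split.
- exact: measurableC.
- by rewrite probability_setC// P1 subee.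
- by move=> w /= H /=; apply: contra_not H; rewrite in_itv/= andbT.
Qed.

Lemma model_int_lam i : P.-integrable setT (EFin \o lam i).
Proof.
apply/integrableP; split; first by apply/measurable_EFinP; exact: model_mlam.
have := lambda_mean Hmodel i; rewrite unlock; apply: le_lt_trans.
rewrite le_eqVlt; apply/orP; left; apply/eqP; apply: ae_eq_integral => //.
- apply/measurable_EFinP; apply: measurableT_comp => //; exact: model_mlam.
- by apply/measurable_EFinP; exact: model_mlam.
- by apply: filterS (model_lam_gt0 i) => w l0 _; rewrite /= gtr0_norm.
Qed.

(** With [lambda i] unrestricted, [eps_given_lambda] presents the law of [eps i] as an average of
    the laws N(0, s^2). Each is the image of N(0, 1) under multiplication by s, so [eps i] has the
    law of lambda i w * y for (w, y) under the product of P and N(0, 1). *)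
Lemma model_mix i : scale_mixture P (ep i) (lam i).
Proof.
have mprod : measurable_fun setT (fun z : T * measurableTypeR R => lam i z.1 * z.2 : measurableTypeR R).
  apply: measurable_funM; last exact: measurable_snd.
  exact: (measurableT_comp (model_mlam i) measurable_fst).
have epsE A : measurable A ->
    P (ep i @^-1` A) = (\int[P]_w \int[N01]_y (\1_A (lam i w * y))%:E)%E.
  move=> mA.
  pose h (s : R) := (\int[N01]_y (\1_A (s * y))%:E)%E.
  have mI : measurable_fun setT (fun x => (\1_A x : R)%:E).
    by apply/measurable_EFinP; exact: measurable_indic.
  have I0 (x : R) : (0 <= (\1_A x)%:E :> \bar R)%E by rewrite lee_fin.
  have mh : measurable_fun setT h.
    apply: (measurable_fun_fubini_tonelli_F (m2 := N01)
      (fun z : R * R => (\1_A (z.1 * z.2))%:E)); last by move=> z; exact: I0.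
    by apply: (measurableT_comp mI); exact: measurable_funM.
  have h0 s : (0 <= h s)%E by exact: integral_ge0.
  have hE s : s != 0 -> normal_prob 0 s A = h s.
    move=> s0; rewrite -[LHS](integral_prob_indic (normal_prob 0 s) mA).
    rewrite (ge0_integral_normal_scale 0 s0 mI I0).
    by apply: eq_integral => y _; rewrite addr0.
  (* The scaling description holds for s != 0. Splitting off the value at 0 gives measurability in
     s; as scales are almost surely positive, that value does not affect the integral. *)
  have nE : (fun s => normal_prob 0 s A) = fun s => if s == 0 then normal_prob 0 0 A else h s.
    by apply/funext => s; case: eqVneq => [->|/hE].
  have mn : measurable_fun [set: R] (fun s => normal_prob 0 s A).
    by rewrite nE; apply: measurable_fun_ifT => //; exact: measurable_fun_eqr.
  have -> : ep i @^-1` A = ep i @^-1` A `&` lam i @^-1` setT.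
    by rewrite preimage_setT setIT.
  rewrite (eps_given_lambda Hmodel)//.
  transitivity (\int[distribution P (lambda i)]_s normal_prob 0 s A)%E.
    by apply: eq_measure_integral => B mB _; exact: esym (lambda_law Hmodel i mB).
  rewrite ge0_integral_distribution//.
  apply: ge0_ae_eq_integral => //.
  - exact: (measurableT_comp mn (model_mlam i)).
  - exact: (measurableT_comp mh (model_mlam i)).
  - by move=> w _; exact: h0.
  - by apply: filterS (model_lam_gt0 i) => w l0 _; apply: hE; rewrite gt_eqF.
move=> f mf f0.
pose E' : {mfun T >-> measurableTypeR R} :=
  HB.pack (ep i : T -> measurableTypeR R)
    (@isMeasurableFun.Build _ _ T (measurableTypeR R) (ep i) (model_meps i)).
pose Z' : {mfun (T * measurableTypeR R)%type >-> measurableTypeR R} :=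
  HB.pack (fun z : T * measurableTypeR R => lam i z.1 * z.2 : measurableTypeR R)
    (isMeasurableFun.Build _ _ _ _ _ mprod).
have mfZ : measurable_fun [set: T * measurableTypeR R] (fun z => f (lam i z.1 * z.2)).
  exact: (measurableT_comp mf mprod).
transitivity (\int[distribution P E']_x f x)%E.
  exact/esym/(ge0_integral_distribution E' mf f0).
transitivity (\int[pushforward (P \x N01) Z']_x f x)%E.
  apply: eq_measure_integral => A mA _.
  rewrite -[LHS]/(P (ep i @^-1` A)) epsE//.
  have mZA : measurable (Z' @^-1` A) by rewrite -[X in measurable X]setTI; exact (mprod measurableT _ mA).
  apply: etrans (_ : (\int[P \x N01]_z (\1_(Z' @^-1` A) z)%:E)%E = _); last first.
    apply: etrans (integral_indic (P \x N01)%E measurableT mZA) _.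
    exact: congr1 (setIT _).
  rewrite fubini_tonelli1//.
  by apply/measurable_EFinP; exact: measurable_indic.
rewrite ge0_integral_pushforward// preimage_setT.
by rewrite (fubini_tonelli1 (fun z : T * measurableTypeR R => f (lam i z.1 * z.2)%R)).
Qed.

Lemma notin_nonGaussian i : i \notin nG -> degenerate P (lam i).
Proof. by rewrite inE => /asboolPn/contrapT. Qed.

Lemma in_nonGaussian i : i \in nG -> ~ degenerate P (lam i).
Proof. by rewrite inE => /asboolP. Qed.

Local Notation A := (error_mx gstar bstar).
Local Notation comb g b j := (combination ep (A g b j)).

Lemma measurable_residual g (b : 'I_p -> 'I_p -> R) j :
  measurable_fun setT (fun w => residual g b (X w) j).
Proof.
have mX k : measurable_fun setT (fun w => tnth (X w) k).
  by apply: (measurableT_comp (measurable_tnth k)); exact: measurable_funPT.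
under eq_fun do rewrite residual_structural_mx.
by apply: measurable_sum => k; exact: (measurableT_comp (mulrl_measurable _) (mX k)).
Qed.

Lemma residual_combination g b j :
  {ae P, forall w, residual g b (X w) j = comb g b j w}.
Proof.
have [_ sem] := true_sem Hmodel; apply: filterS sem => w sem.
have Sx i : \sum_k structural_mx gstar bstar i k * tnth (X w) k = eps i w.
  by rewrite -residual_structural_mx /residual (sem i) addrAC subrr add0r.
rewrite residual_structural_mx (error_mxK gstar bstar g b) /combination.
under [RHS]eq_bigr do rewrite -Sx mulr_sumr.
rewrite exchange_big/=; apply: eq_bigr => k _.
by rewrite mxE mulr_suml; apply: eq_bigr => i _; rewrite mulrA.
Qed.

End model.

(** * The minimal Laplace risk *)

Section risk.
Context (R : realType) (d : measure_display) (T : measurableType d)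
  (P : probability T R) (p : nat) (gstar : dag p) (bstar : 'I_p -> 'I_p -> R)
  (X : {RV P >-> p.-tuple R}) (eps lambda : 'I_p -> {RV P >-> R})
  (Q : 'I_p -> probability R R).
Hypothesis Hmodel : true_model gstar bstar X eps lambda Q.
Local Notation nG := (nonGaussian_nodes P (fun j => lambda j : T -> R)).
Local Notation lam := (fun j => lambda j : T -> R).
Local Notation ep := (fun j => eps j : T -> R).
Local Notation m := (mean_scale P lam).
Local Notation A := (error_mx gstar bstar).
Local Notation kappa := (@normal_mean_abs R).
Let mlam i : measurable_fun setT (lam i). Proof. exact: model_mlam. Qed.
Let mep i : measurable_fun setT (ep i). Proof. exact: model_meps. Qed.
Let lam_gt0 : forall i, {ae P, forall w, 0 < lam i w} := model_lam_gt0 Hmodel.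
Let int_lam : forall i, P.-integrable setT (EFin \o lam i) := model_int_lam Hmodel.
Let indep_lam : mutually_independent P lam := lambda_independent Hmodel.

Definition residual_mean g b j : R := \int[P]_w `|residual g b (X w) j|.

Lemma residual_abs_integral g b j :
  (\int[P]_w (`|residual g b (X w) j|)%:E = (kappa * mean_mixing P lam (A g b j))%:E)%E.
Proof.
have mc := measurable_combination mep (A g b j).
have mS := measurable_mixing_scale mlam (A g b j).
transitivity (\int[P]_w (`|combination ep (A g b j) w|)%:E)%E.
  apply: ge0_ae_eq_integral => //.
  - apply/measurable_EFinP; apply: measurableT_comp => //; exact: measurable_residual.
  - by apply/measurable_EFinP; apply: measurableT_comp.
  - by apply: filterS (residual_combination Hmodel g b j) => w ->.
rewrite (scale_mixture_abs mS (combination_mixture mep mlam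
  (eps_independent Hmodel) indep_lam (model_mix Hmodel) _)) EFinM; congr (_ * _)%E.
rewrite /mean_mixing /Rintegral fineK.
  by apply: eq_integral => w _; rewrite ger0_norm ?sqrtr_ge0.
exact: (integrable_fin_num measurableT (integrable_mixing_scale mlam int_lam _)).
Qed.

Lemma residual_meanE g b j :
  residual_mean g b j = kappa * mean_mixing P lam (A g b j).
Proof. by rewrite /residual_mean /Rintegral residual_abs_integral. Qed.

Lemma residual_integrable g b j :
  P.-integrable setT (EFin \o (fun w => `|residual g b (X w) j|)).
Proof.
apply/integrableP; split.
  by apply/measurable_EFinP; apply: measurableT_comp => //; exact: measurable_residual.
rewrite (eq_integral (fun w => (`|residual g b (X w) j|)%:E)); last first.
  by move=> w _; rewrite /= normr_id.
by rewrite residual_abs_integral ltry.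
Qed.

Definition risk_value g b (theta : 'I_p -> R) : R :=
  \sum_j (ln (2 * theta j) + (theta j)^-1 * residual_mean g b j).

Lemma riskE g b theta : (forall j, 0 < theta j) ->
  (- 'E_P[fun w => ln (laplace_density g b theta (X w))])%E = (risk_value g b theta)%:E.
Proof.
move=> th0; rewrite unlock.
pose r j w := `|residual g b (X w) j|.
have ri j : P.-integrable setT (fun w => (ln (2 * theta j))%:E + (theta j)^-1%:E * (r j w)%:E)%E.
  apply: integrableD => //; first exact: finite_measure_integrable_cst.
  exact: (integrableZl measurableT _ (residual_integrable g b j)).
have -> : (\int[P]_w (ln (laplace_density g b theta (X w)))%:E = \int[P]_w
    - (\sum_j ((ln (2 * theta j))%:E + (theta j)^-1%:E * (r j w)%:E)))%E.
  apply: eq_integral => w _.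
  under [in RHS]eq_bigr do rewrite -EFinM -EFinD.
  rewrite sumEFin -EFinN; congr EFin; rewrite /laplace_density.
  rewrite -[RHS]expRK -sumrN expR_sum; congr ln; apply: eq_bigr => j _.
  rewrite opprD expRD [in RHS]expRN lnK ?posrE ?mulr_gt0//.
have iS : P.-integrable setT (fun w => \sum_j
    ((ln (2 * theta j))%:E + (theta j)^-1%:E * (r j w)%:E))%E.
  by apply: integrable_sum => // j _; exact: ri.
rewrite integralN/=; last exact: integrable_add_def iS.
rewrite oppeK integral_sum// /risk_value -sumEFin; apply: eq_bigr => j _.
rewrite integralD//; last 2 first.
- exact: finite_measure_integrable_cst.
- exact: (integrableZl measurableT _ (residual_integrable g b j)).
rewrite integral_prob_cst (integralZl measurableT (residual_integrable g b j)).
by rewrite /= residual_abs_integral -residual_meanE.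
Qed.

Let mix_row g b j : exists i, A g b j i != 0.
Proof. by apply: det_row_neq0; rewrite det_error_mx oner_neq0. Qed.

Let mean_scale_pos i : 0 < m i.
Proof. exact: mean_scale_gt0 mlam lam_gt0 int_lam i. Qed.

Lemma mean_mixing_gt0 g b j : 0 < mean_mixing P lam (A g b j).
Proof.
have [i Ai] := mix_row g b j.
apply: lt_le_trans (mixing_mean_le mlam int_lam _).
exact: (mixing_mean_gt0 mlam lam_gt0 int_lam Ai).
Qed.

(** Absorbing the weights m into the columns turns weighted orthogonality into plain orthogonality
    of rows and the row norms into [mixing_mean]; the determinant becomes the product of the m i. *)
Let scaled g b : 'M[R]_p := \matrix_(j, i) (A g b j i * m i).

Let gram_scaled g b j k : gram (scaled g b) j k = \sum_i A g b j i * A g b k i * m i ^+ 2.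
Proof. by apply: eq_bigr => i _; rewrite !mxE expr2 mulrACA. Qed.

Let det_scaled g b : \det (scaled g b) = \prod_i m i.
Proof.
have -> : scaled g b = A g b *m diag_mx (\row_i m i).
  by apply/matrixP => j i; rewrite mul_mx_diag !mxE.
by rewrite det_mulmx det_error_mx mul1r det_diag; apply: eq_bigr => i _; rewrite mxE.
Qed.

Let gram_scaled_diag g b j : gram (scaled g b) j j = mixing_mean P lam (A g b j) ^+ 2.
Proof.
rewrite gram_scaled sqr_sqrtr; last by apply: sumr_ge0 => i _; rewrite mulr_ge0 ?sqr_ge0.
by apply: eq_bigr => i _; rewrite expr2.
Qed.

Let det_scaled_neq0 g b : \det (scaled g b) != 0.
Proof. by rewrite det_scaled; apply: lt0r_neq0; apply: prodr_gt0 => i _; exact: mean_scale_pos. Qed.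

Lemma prod_mixing_mean_ge g b : \prod_i m i <= \prod_j mixing_mean P lam (A g b j).
Proof.
have [+ _] := hadamard (det_scaled_neq0 g b).
rewrite det_scaled; under [in leRHS]eq_bigr do rewrite gram_scaled_diag.
rewrite prodrXl ler_sqr// nnegrE; apply: prodr_ge0 => j _; last exact: sqrtr_ge0.
exact/ltW/mean_scale_pos.
Qed.

Lemma prod_mean_mixing_ge g b : \prod_i m i <= \prod_j mean_mixing P lam (A g b j).
Proof.
apply: le_trans (prod_mixing_mean_ge g b) _; apply: ler_prod => j _.
by rewrite sqrtr_ge0 (mixing_mean_le mlam int_lam).
Qed.

Lemma prod_mean_mixing_eq g b : decoupling nG m (A g b) ->
  \prod_j mean_mixing P lam (A g b j) = \prod_i m i.
Proof.
move=> [orth single].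
have -> : \prod_j mean_mixing P lam (A g b j) = \prod_j mixing_mean P lam (A g b j).
  apply: eq_bigr => j _; apply: (mean_mixing_eq mlam lam_gt0 int_lam) => i k Ai ki ndi.
  apply: single ki; last exact: Ai.
  by rewrite inE; exact/asboolP.
apply/eqP; rewrite -(@eqrXn2 _ 2)//; last 2 first.
- by apply: prodr_ge0 => j _; exact: sqrtr_ge0.
- by apply: prodr_ge0 => j _; exact/ltW/mean_scale_pos.
rewrite -prodrXl -(det_scaled g b) gram_orthogonal_det => [|j k jk].
  by apply/eqP/eq_bigr => j _; rewrite gram_scaled_diag.
by rewrite gram_scaled orth.
Qed.

(** The products of the m i, of the row norms and of the mean mixing scales form an increasing
    chain, which the hypothesis collapses. Equality in Hadamard's inequality gives orthogonal rows;
    equality of each mean with its row norm forbids a non-Gaussian error to share a row. *)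
Lemma prod_mean_mixing_le g b :
  \prod_j mean_mixing P lam (A g b j) <= \prod_i m i -> decoupling nG m (A g b).
Proof.
move=> le; have q0 j : 0 < mixing_mean P lam (A g b j).
  by have [i Ai] := mix_row g b j; exact: (mixing_mean_gt0 mlam lam_gt0 int_lam Ai).
have qv j := mixing_mean_le mlam int_lam (A g b j).
have qv_prod : \prod_j mixing_mean P lam (A g b j) <= \prod_j mean_mixing P lam (A g b j).
  by apply: ler_prod => j _; rewrite sqrtr_ge0 qv.
have qm := prod_mixing_mean_ge g b.
have qm_eq : \prod_j mixing_mean P lam (A g b j) = \prod_i m i.
  by apply/eqP; rewrite eq_le qm (le_trans qv_prod le).
have vq_eq : \prod_j mean_mixing P lam (A g b j) = \prod_j mixing_mean P lam (A g b j).
  by apply/eqP; rewrite eq_le qv_prod qm_eq le.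
split=> [j k jk|j i k iG Aji ki].
  have [_ H] := hadamard (det_scaled_neq0 g b); rewrite -gram_scaled; apply: H => //.
  rewrite det_scaled -qm_eq -prodrXl; apply: eq_bigr => l _.
  exact: gram_scaled_diag.
apply/eqP; apply: contraT => Ajk; exfalso; apply: (in_nonGaussian iG).
have vq := eq_prod_le q0 qv vq_eq j.
by apply: (mixing_mean_eq_degenerate mlam indep_lam lam_gt0 int_lam vq Aji Ajk); rewrite eq_sym.
Qed.

Definition optimal_risk : R := \sum_i (ln (2 * (kappa * m i)) + 1).

Let residual_mean_gt0 g b j : 0 < residual_mean g b j.
Proof. by rewrite residual_meanE mulr_gt0 ?normal_mean_abs_gt0 ?mean_mixing_gt0. Qed.

Let sum_ln (I : finType) (f : I -> R) : (forall i, 0 < f i) ->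
  \sum_i ln (f i) = ln (\prod_i f i).
Proof.
move=> f0; rewrite -[LHS]expRK expR_sum; congr ln; apply: eq_bigr => i _.
by rewrite lnK ?posrE.
Qed.

Lemma risk_value_opt g b : risk_value g b (residual_mean g b) =
  \sum_j (ln (2 * residual_mean g b j) + 1).
Proof. by apply: eq_bigr => j _; rewrite mulVf// gt_eqF. Qed.

(** This is 1 + ln x <= x at x = residual_mean g b j / theta j, summed over j: the best theta is the
    mean absolute residual. *)
Lemma risk_value_ge g b theta : (forall j, 0 < theta j) ->
  risk_value g b (residual_mean g b) <= risk_value g b theta.
Proof.
move=> th0; rewrite risk_value_opt; apply: ler_sum => j _.
have r0 := residual_mean_gt0 g b j; have t0 := th0 j.
have x0 : 0 < (theta j)^-1 * residual_mean g b j by rewrite mulr_gt0 ?invr_gt0.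
have := expR_ge1Dx (ln ((theta j)^-1 * residual_mean g b j)).
rewrite [leRHS]lnK ?posrE// !lnM ?posrE ?invr_gt0// lnV ?posrE//.
lra.
Qed.

Let sum_lnE (f : 'I_p -> R) : (forall j, 0 < f j) ->
  \sum_j (ln (2 * (kappa * f j)) + 1) = ln ((2 * kappa) ^+ p * \prod_j f j) + p%:R.
Proof.
move=> f0; have k0 := @normal_mean_abs_gt0 R.
rewrite big_split/= sum_ln => [|j]; last by rewrite !mulr_gt0.
congr (ln _ + _); last by rewrite sumr_const card_ord.
rewrite (eq_bigr (fun j => (2 * kappa) * f j)) => [|j _]; last by rewrite mulrA.
by rewrite big_split/= prodr_const card_ord.
Qed.

Let risk_value_optE g b : risk_value g b (residual_mean g b) =
  ln ((2 * kappa) ^+ p * \prod_j mean_mixing P lam (A g b j)) + p%:R.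
Proof.
rewrite risk_value_opt -sum_lnE => [|j]; last exact: mean_mixing_gt0.
by apply: eq_bigr => j _; rewrite residual_meanE.
Qed.

Let le_prod_ln (x y : R) : 0 < x -> 0 < y ->
  (ln ((2 * kappa) ^+ p * x) + p%:R <= ln ((2 * kappa) ^+ p * y) + p%:R) = (x <= y).
Proof.
move=> x0 y0; have k0 : 0 < (2 * kappa) ^+ p.
  by rewrite exprn_gt0// mulr_gt0// normal_mean_abs_gt0.
by rewrite lerD2r ler_ln ?posrE ?mulr_gt0// ler_pM2l.
Qed.

Let prod_m_gt0 : 0 < \prod_i m i.
Proof. by apply: prodr_gt0 => i _; exact: mean_scale_pos. Qed.

Let prod_mm_gt0 g b : 0 < \prod_j mean_mixing P lam (A g b j).
Proof. by apply: prodr_gt0 => j _; exact: mean_mixing_gt0. Qed.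

Lemma optimal_risk_le g b theta : (forall j, 0 < theta j) ->
  optimal_risk <= risk_value g b theta.
Proof.
move=> th0; apply: le_trans (risk_value_ge g b th0).
rewrite /optimal_risk sum_lnE// risk_value_optE le_prod_ln//.
exact: prod_mean_mixing_ge.
Qed.

Lemma risk_value_le_decoupling g b theta : (forall j, 0 < theta j) ->
  risk_value g b theta <= optimal_risk -> decoupling nG m (A g b).
Proof.
move=> th0 le; apply: prod_mean_mixing_le; rewrite -le_prod_ln//.
by rewrite -risk_value_optE -sum_lnE// (le_trans (risk_value_ge g b th0)).
Qed.

Lemma risk_value_decoupling g b : decoupling nG m (A g b) ->
  risk_value g b (residual_mean g b) = optimal_risk.
Proof.
by move=> dec; rewrite risk_value_optE prod_mean_mixing_eq// /optimal_risk sum_lnE.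
Qed.

Lemma decoupling_error_mx_self : decoupling nG m (A gstar bstar).
Proof.
rewrite error_mx_self; split=> [j k jk|j i k _].
  rewrite big1// => i _; rewrite !mxE.
  by case: (eqVneq j i) => [<-|_]; rewrite ?mul0r// eq_sym (negPf jk) mulr0 mul0r.
by rewrite !mxE; case: (eqVneq j i) => [->|_]; rewrite ?eqxx// => _ /negPf; rewrite eq_sym => ->.
Qed.

Lemma decoupling_min_risk g b : decoupling nG m (A g b) ->
  is_min_risk P X g optimal_risk%:E.
Proof.
move=> dec; split; first exists b, (residual_mean g b); first split.
- by move=> j; exact: residual_mean_gt0.
- by rewrite riskE ?risk_value_decoupling// => j; exact: residual_mean_gt0.
- by move=> _ [b' [theta [th0 ->]]]; rewrite riskE// lee_fin optimal_risk_le.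
Qed.

(** The true model attains [optimal_risk], so no other value can be the common minimum, and any b
    that attains it is in the equality case. *)
Lemma risk_class_decoupling g : risk_class P X gstar g <->
  exists b, decoupling nG m (A g b).
Proof.
split=> [[h [[[b [theta [th0 hE]]] _] [_ hmin]]]|[b dec]]; last first.
  exists optimal_risk%:E; split; first exact: decoupling_min_risk dec.
  exact: decoupling_min_risk decoupling_error_mx_self.
exists b; apply: (risk_value_le_decoupling th0).
have [opt _] := decoupling_min_risk decoupling_error_mx_self.
by have := hmin _ opt; rewrite hE riskE// lee_fin.
Qed.

End risk.

(** * The equivalence classes *)

Lemma dag_eq (p : nat) (g h : dag p) : edges g = edges h -> g = h.
Proof.
case: g h => [E acE] [F acF] /= EF; rewrite {}EF in acE *.
by congr Dag; exact: bool_irrelevance.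
Qed.

Lemma acyclic_sub (p : nat) (E F : {set 'I_p * 'I_p}) :
  E \subset F -> acyclic F -> acyclic E.
Proof.
move=> EF /forallP acF; apply/forallP => i; apply/forallP => j; apply/implyP => ij.
have /forallP/(_ j)/implyP/(_ (fintype.subsetP EF _ ij)) := acF i.
apply: contra; apply: connect_sub => x y xy; apply: connect1.
exact: (fintype.subsetP EF).
Qed.

(** Orthogonal rows make the inverse of W its transpose with rescaled columns, so the columns of W
    are orthogonal for suitable weights. If column i is non-zero in row j only, every other column
    must vanish in row j. *)
Lemma gram_single_column (R : realType) (p : nat) (W : 'M[R]_p) i j k :
  \det W != 0 -> (forall a b, a != b -> gram W a b = 0) ->
  (forall l, l != j -> W l i = 0) -> k != i -> W j k = 0.
Proof.
move=> dW oW Wi ki; have Wu : W \in unitmx by rewrite unitmxE unitfE.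
pose D := \matrix_(a, b) (if a == b then gram W a a else 0).
have WWT : W *m W^T = D.
  by apply/matrixP => a b; rewrite gramE mxE; case: eqVneq => [->|/oW].
have g0 a : gram W a a != 0.
  have := dW; rewrite -sqrf_eq0 (gram_orthogonal_det oW); apply: contraNneq => ga.
  by rewrite (bigD1 a)//= ga mul0r.
pose V := \matrix_(a, b) (W^T a b / gram W b b).
have WV : W *m V = 1%:M.
  apply/matrixP => a b; have /matrixP/(_ a b) := WWT; rewrite !mxE.
  move=> H; transitivity ((\sum_l W a l * W^T l b) / gram W b b).
    by rewrite mulr_suml; apply: eq_bigr => l _; rewrite mxE mulrA.
  by rewrite H; case: (eqVneq a b) => [->|_]; rewrite ?mul0r// divff.
have /matrixP/(_ k i) := mulmx1C WV; rewrite !mxE (negPf ki) (bigD1 j)//=.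
rewrite big1 ?addr0 => [|l lj]; last by rewrite !mxE (Wi l)// mulr0.
have Wji : W j i != 0.
  have [s Ws] := det_neq0_perm dW; have := Ws ((s^-1)%g i); rewrite permKV.
  by have [->//|/Wi ->] := eqVneq ((s^-1)%g i) j; rewrite eqxx.
rewrite !mxE => /eqP; rewrite !mulf_eq0 (negPf Wji) invr_eq0 (negPf (g0 j)) !orbF.
by move/eqP.
Qed.

Section equivalence_class.
Context (R : realType) (d : measure_display) (T : measurableType d)
  (P : probability T R) (p : nat) (gstar : dag p) (bstar : 'I_p -> 'I_p -> R)
  (X : {RV P >-> p.-tuple R}) (eps lambda : 'I_p -> {RV P >-> R})
  (Q : 'I_p -> probability R R).
Hypothesis Hmodel : true_model gstar bstar X eps lambda Q.
Local Notation nG := (nonGaussian_nodes P (fun j => lambda j : T -> R)).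
Local Notation lam := (fun j => lambda j : T -> R).
Local Notation ep := (fun j => eps j : T -> R).
Local Notation m := (mean_scale P lam).
Local Notation A := (error_mx gstar bstar).
Local Notation PX := (distribution P X : probability (p.-tuple R) R).
Let mlam i : measurable_fun setT (lam i). Proof. exact: model_mlam. Qed.
Let mep i : measurable_fun setT (ep i). Proof. exact: model_meps. Qed.
Let lam_gt0 : forall i, {ae P, forall w, 0 < lam i w} := model_lam_gt0 Hmodel.
Let int_lam : forall i, P.-integrable setT (EFin \o lam i) := model_int_lam Hmodel.
Let indep_lam : mutually_independent P lam := lambda_independent Hmodel.
Let indep_eps : mutually_independent P ep := eps_independent Hmodel.
Let mix : forall i, scale_mixture P (ep i) (lam i) := model_mix Hmodel.

Let lam_ge0 i : {ae P, forall w, 0 <= lam i w}.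
Proof. by apply: filterS (lam_gt0 i) => w /ltW. Qed.

Let m_gt0 i : 0 < m i. Proof. exact: mean_scale_gt0 mlam lam_gt0 int_lam i. Qed.
Let m_neq0 i : m i != 0. Proof. exact: lt0r_neq0. Qed.

Let gaussian_scale i : i \notin nG -> {ae P, forall w, lam i w = m i}.
Proof. by move=> /notin_nonGaussian; exact: degenerate_mean_scale. Qed.

Let comb_mix a : scale_mixture P (combination ep a) (mixing_scale lam a).
Proof. exact: combination_mixture. Qed.

Let mcomb a : measurable_fun setT (combination ep a).
Proof. exact: measurable_combination. Qed.

Let mmix a : measurable_fun setT (mixing_scale lam a).
Proof. exact: measurable_mixing_scale. Qed.

Let mres g b j : measurable_fun setT (fun w => residual g b (X w) j).
Proof. exact: measurable_residual. Qed.

Let row_neq0 g b j : exists i, A g b j i != 0.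
Proof. by apply: det_row_neq0; rewrite det_error_mx oner_neq0. Qed.

Definition decoupled g := exists b : 'I_p -> 'I_p -> R,
  (forall j k, k \in parents g j -> b j k != 0) /\ decoupling nG m (A g b).

Lemma combination_gaussian (a : 'I_p -> R) : (exists i, a i != 0) ->
  (forall i, i \in nG -> a i = 0) -> gaussian P (combination ep a).
Proof.
move=> [i ai] anG.
apply: (scale_mixture_gaussian (mcomb a) (mmix a) (comb_mix a)
  (mixing_mean_gt0 mlam lam_gt0 int_lam ai)).
apply: mean_mixing_const => k ak; apply: gaussian_scale.
by apply: contra ak => /anG ->.
Qed.

Lemma combination_nondegenerate (a : 'I_p -> R) i : a i != 0 ->
  ~ degenerate P (combination ep a).
Proof.
move=> ai; apply: (scale_mixture_nondegenerate (mcomb a) (mmix a) (comb_mix a)).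
exact: mixing_scale_gt0 ai.
Qed.

Lemma independent_orthogonal (a b : 'I_p -> R) :
  independent2 P (combination ep a) (combination ep b) ->
  (forall i, i \in nG -> a i * b i = 0) /\ \sum_i a i * b i * m i ^+ 2 = 0.
Proof.
move=> ind; have H i : a i * b i != 0 -> degenerate P (lam i).
  exact: (darmois_skitovich_degenerate mep mlam indep_eps indep_lam mix ind lam_ge0).
split.
  move=> i /in_nonGaussian ndi; apply/eqP; apply: contraT => /H.
  by move=> /ndi.
apply: (darmois_skitovich_orthogonal mep mlam indep_eps indep_lam mix ind) => i /H.
exact: degenerate_mean_scale.
Qed.

Lemma decoupled_risk_class g' : risk_class P X gstar g' <->
  exists g, supergraphs g g' /\ decoupled g.
Proof.
rewrite (risk_class_decoupling Hmodel); split=> [[b dec]|[g [gg' [b [b0 dec]]]]].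
  (* Edges are pairs (parent, child), whereas coefficients are indexed by child then parent.
     Dropping the edges on which b vanishes does not change the structural matrix. *)
  pose E := [set e in edges g' | b e.2 e.1 != 0]%SET.
  have EE : E \subset edges g' by apply/fintype.subsetP => e; rewrite inE => /andP[].
  exists (Dag (acyclic_sub EE (edges_acyclic g'))); split; first exact: EE.
  exists b; split=> [j k|]; first by rewrite inE /edge inE => /andP[].
  rewrite /error_mx (_ : structural_mx _ b = structural_mx g' b)//.
  apply/matrixP => j k; rewrite !mxE !inE /edge inE /=; congr (_ - _).
  by case: ifPn => //=; case: (eqVneq (b j k) 0) => [->|//]; case: ifP.
(* Conversely, the coefficients of g are extended by 0 to the additional edges of g'. *)
exists (fun j k => if k \in parents g j then b j k else 0).
rewrite /error_mx (_ : structural_mx g' _ = structural_mx g b)//.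
apply/matrixP => j k; rewrite !mxE; congr (_ - _).
case: ifPn => // kg'; case: ifPn => // kg; move: kg'.
by rewrite inE /edge (fintype.subsetP gg')//; move: kg; rewrite inE.
Qed.

Lemma decoupled_gstar : decoupled gstar.
Proof.
have [b0 _] := true_sem Hmodel; exists bstar; split => //.
exact: decoupling_error_mx_self.
Qed.

(** Both structural matrices are unipotent for g, so A = 1 and they coincide; an edge of g outside
    [gstar] would carry the coefficient 0. *)
Lemma decoupled_supergraph g : supergraphs gstar g -> decoupled g -> g = gstar.
Proof.
move=> sg [b [b0 dec]]; have [bs0 _] := true_sem Hmodel.
have uS : unipotent g (structural_mx gstar bstar).
  have [S1 S2] := structural_mx_unipotent gstar bstar; split => // i j ij /(S2 _ _ ij).
  exact: (fintype.subsetP sg).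
have A1 := decoupling_supergraph m_neq0 (structural_mx_unipotent g b) uS
  (error_mxK gstar bstar g b) dec.
have DS : structural_mx g b = structural_mx gstar bstar.
  by rewrite (error_mxK gstar bstar g b) A1 mul1mx.
apply: dag_eq; apply/eqP; rewrite finset.eqEsubset sg andbT; apply/fintype.subsetP => -[k j] e.
have kj : k \in parents g j by rewrite inE.
have /matrixP/(_ j k) := DS; rewrite !mxE kj => /addrI/oppr_inj bE.
have := b0 j k kj; rewrite bE; case: ifPn => [|_]; last by rewrite eqxx.
by rewrite inE.
Qed.

Let nonGaussian_rows g b : decoupling nG m (A g b) -> forall i, i \in nG ->
  A g b i i = 1 /\ forall k, k != i -> A g b i k = 0 /\ A g b k i = 0.
Proof.
exact: decoupling_nonGaussian m_neq0 (structural_mx_unipotent g b)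
  (structural_mx_unipotent gstar bstar) (error_mxK gstar bstar g b).
Qed.

(** The residuals are W Y with Y = eps / m and W = A diag(m). By [decoupling_nonGaussian] W is
    diagonal along the rows and columns of non-Gaussian nodes, so it mixes standard normal
    coordinates only. *)
Lemma decoupled_independent g b : decoupling nG m (A g b) ->
  mutually_independent P (fun j w => residual g b (X w) j).
Proof.
move=> dec; have rows := nonGaussian_rows dec; have [orth _] := dec.
pose W := \matrix_(j, i) (A g b j i * m i) : 'M[R]_p.
have sW : block_supported (~: nG)%SET W.
  move=> j i ji; rewrite mxE mulf_eq0 negb_or => /andP[Aji _].
  rewrite !finset.in_setC -negb_or; apply/negP => /orP[jG|iG].
    by have := ((rows j jG).2 i _).1; rewrite eq_sym => /(_ ji) Aji0; rewrite Aji0 eqxx in Aji.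
  by have := ((rows i iG).2 j ji).2 => Aji0; rewrite Aji0 eqxx in Aji.
have dW : \det W != 0.
  have -> : W = A g b *m diag_mx (\row_i m i).
    by apply/matrixP => j i; rewrite mul_mx_diag !mxE.
  rewrite det_mulmx det_error_mx mul1r det_diag.
  by apply: lt0r_neq0; apply: prodr_gt0 => i _; rewrite mxE.
have oW j k : j != k -> gram W j k = 0.
  move=> jk; rewrite -[RHS](orth j k jk); apply: eq_bigr => i _.
  by rewrite !mxE expr2 mulrACA.
pose Y i w := (m i)^-1 * eps i w.
have mY i : measurable_fun setT (Y i).
  exact: (measurableT_comp (mulrl_measurable _) (mep i)).
have iY : mutually_independent P Y.
  move=> J B mB.
  have mB' i : measurable ((fun x : R => (m i)^-1 * x) @^-1` B i).
    rewrite -[X in measurable X]setTI.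
    exact: (mulrl_measurable (m i)^-1 measurableT (mB i)).
  exact: (indep_eps J mB').
have nY i : i \in (~: nG)%SET -> standard_normal P (Y i).
  rewrite finset.in_setC => iG; exact: (scale_mixture_standard (mep i) (mlam i) (mix i) (m_neq0 i)
    (gaussian_scale iG)).
apply: (ae_mutually_independent _ _ _ (orthogonal_rows_independent sW dW oW mY iY nY)).
- move=> j; apply: measurable_sum => i.
  exact: (measurableT_comp (mulrl_measurable _) (mY i)).
- by move=> j; exact: mres.
- move=> j; apply: filterS (residual_combination Hmodel g b j) => w ->.
  by apply: eq_bigr => i _; rewrite mxE /Y mulrA mulfK.
Qed.

(** X itself, with its residuals as errors, is the representation. A residual outside [nG] combines
    Gaussian errors only; for j in [nG] it is [eps j] almost surely, and were it Gaussian, its scale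
    would be degenerate. *)
Lemma decoupled_represented g : decoupled g -> represented_laws g nG PX.
Proof.
move=> [b [b0 dec]]; have rows := nonGaussian_rows dec.
pose eta j : {RV P >-> R} := HB.pack (fun w => residual g b (X w) j)
  (isMeasurableFun.Build _ _ _ _ _ (mres g b j)).
have res j := residual_combination Hmodel g b j.
have res' j : {ae P, forall w, combination ep (A g b j) w = residual g b (X w) j}.
  by apply: filterS (res j).
exists d, T, P, X, eta, b; split => //.
- split => //; apply: aeW => w j; rewrite /= /residual addrC subrK//.
- exact: decoupled_independent.
- move=> j /(ae_degenerate (res j)); have [i Ai] := row_neq0 g b j.
  exact: combination_nondegenerate Ai.
- move=> j; split.
    move=> ng; apply: contrapT => /negP jG; apply: ng.
    apply: (ae_gaussian (mcomb _) _ (res' j)); first exact: mres.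
    apply: combination_gaussian; first exact: row_neq0.
    by move=> i iG; apply: ((rows i iG).2 j _).2; apply: contraNneq jG => ->.
  move=> jG gau; apply: (in_nonGaussian jG).
  have [Ajj Ajk] := rows j jG.
  have /(scale_mixture_gaussian_degenerate (mcomb _) (mmix _) (comb_mix _)) :
      gaussian P (combination ep (A g b j)).
    by apply: (ae_gaussian _ (mcomb _) (res j)) gau; exact: mres.
  move=> /(_ (aeW _ (fun w => sqrtr_ge0 _))).
  apply: ae_degenerate; apply: filterS (lam_ge0 j) => w l0.
  rewrite (@mixing_scale_single _ _ _ _ _ _ j) => [|k kj]; last exact: (Ajk k kj).1.
  by rewrite Ajj normr1 mul1r ger0_norm.
Qed.

Lemma decoupled_minimal_risk_class g : decoupled g ->
  minimal_risk_class P X ep gstar nG g.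
Proof.
move=> [b [b0 dec]]; have rows := nonGaussian_rows dec.
have [bs0 _] := true_sem Hmodel.
split.
  move=> j jG; have [Ajj Ajk] := rows j jG.
  (* Row j of A is a unit vector, so row j of the structural matrix is the true one; as coefficients
     are non-zero on both sides, the parent sets agree. *)
  have DS k : structural_mx g b j k = structural_mx gstar bstar j k.
    rewrite (error_mxK gstar bstar g b) mxE (bigD1 j)//= Ajj mul1r big1 ?addr0// => l lj.
    by rewrite (Ajk l lj).1 mul0r.
  apply/setP => k; have := DS k; rewrite !mxE => /addrI/oppr_inj.
  have := b0 j k; have := bs0 j k.
  case: (k \in parents g j); case: (k \in parents gstar j) => //.
  - by move=> _ /(_ isT)/eqP + H; rewrite H.
  - by move=> /(_ isT)/eqP + _ H; rewrite H.
exists b; split.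
- by move=> j k _; exact: b0.
- move=> j jG; exists (A g b j).
  apply: filterS (residual_combination Hmodel g b j) => w ->.
  rewrite /combination (bigID (mem nG))/= big1 ?add0r// => i iG.
  by rewrite ((rows i iG).2 j _).2 ?mul0r//; apply: contraNneq jG => ->.
- move=> i j _ _ ij.
  exact: (mutually_independent_pair (decoupled_independent dec) ij).
Qed.

Lemma minimal_risk_class_decoupled g : minimal_risk_class P X ep gstar nG g ->
  decoupled g.
Proof.
move=> [paE [b [b0 lin ind]]]; have [bs0 sem] := true_sem Hmodel.
(* On [nG] the class prescribes the parents but no coefficients; the true ones are taken there. *)
pose b' j k := if j \in nG then bstar j k else b j k.
have resE j w : j \notin nG -> residual g b' (X w) j = residual g b (X w) j.
  by move=> jG; rewrite /residual /b' (negPf jG).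
have rowG j : j \in nG -> forall i, A g b' j i = (j == i)%:R.
  by move=> jG; apply: error_mx_row => k; rewrite !mxE paE// /b' jG.
have rowN j i : j \notin nG -> i \in nG -> A g b' j i = 0.
  move=> jG iG; apply/eqP; apply: contraT => Aji.
  have [c cE] := lin j jG.
  (* [a] is the difference of two expressions of one residual in the errors, so its combination is
     almost surely 0. Yet its entry at i is A g b' j i, since c only weighs Gaussian errors; a
     non-zero entry contradicts non-degeneracy. *)
  pose a k := A g b' j k - (if k \notin nG then c k else 0).
  have ai : a i != 0 by rewrite /a iG subr0.
  exfalso; apply: (combination_nondegenerate ai); exists 0.
  apply: filterS2 (residual_combination Hmodel g b' j) cE => w rw cw.
  rewrite /combination /a; under eq_bigr do rewrite mulrBl.
  rewrite sumrB -/(combination ep _ w) -rw resE// cw big_mkcond/=.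
  apply/eqP; rewrite subr_eq0; apply/eqP; apply: eq_bigr => k _.
  by case: ifP => //; rewrite mul0r.
exists b'; split=> [j k kj|].
  rewrite /b'; case: ifPn => jG; last exact: b0.
  by apply: bs0; rewrite -paE.
have orthG j k : j \in nG -> j != k -> \sum_i A g b' j i * A g b' k i * m i ^+ 2 = 0.
  move=> jG jk; rewrite (bigD1 j)//= big1 ?addr0 => [|l lj]; last first.
    by rewrite rowG// eq_sym (negPf lj) !mul0r.
  have [kG|kG] := boolP (k \in nG); first by rewrite (rowG k)// eq_sym (negPf jk) mulr0 mul0r.
  by rewrite (rowN k)// mulr0 mul0r.
split=> [j k jk|j i k iG Aji ki].
  have [jG|jG] := boolP (j \in nG); first exact: orthG.
  have [kG|kG] := boolP (k \in nG).
    by rewrite -[RHS](orthG k j kG); [apply: eq_bigr => i _; rewrite (mulrC (A g b' j i))|rewrite eq_sym].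
  apply: (independent_orthogonal _).2.
  apply: (ae_independent2 (mres g b j) (mres g b k) (mcomb _) (mcomb _) _ _ (ind j k jG kG jk)).
  - by apply: filterS (residual_combination Hmodel g b' j) => w <-; rewrite resE.
  - by apply: filterS (residual_combination Hmodel g b' k) => w <-; rewrite resE.
have [jG|jG] := boolP (j \in nG); last by rewrite rowN// eqxx in Aji.
move: Aji; rewrite (rowG j jG i) (rowG j jG k).
case: (eqVneq j i) => [-> _|_]; last by rewrite eqxx.
by rewrite eq_sym (negPf ki).
Qed.

(* By Darmois-Skitovich a non-Gaussian error enters a single residual; since the
   rows are orthogonal, this residual then contains no other error. *)
Lemma represented_decoupled g : represented_laws g nG PX -> decoupled g.
Proof.
move=> [d' [T' [P' [Y [eta [b [muY [b0 sem] indeta _ _]]]]]]].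
exists b; split => //.
pose rho j (x : p.-tuple R) := residual g b x j.
have mrho j : measurable_fun setT (rho j).
  rewrite /rho; under eq_fun do rewrite residual_structural_mx.
  apply: measurable_sum => k.
  exact: (measurableT_comp (mulrl_measurable _) (measurable_tnth k)).
have mYrho j : measurable_fun setT (fun w => rho j (Y w)).
  by apply: (measurableT_comp (mrho j)); exact: measurable_funPT.
have meta j : measurable_fun setT (eta j : T' -> R) by exact: measurable_funPT.
have etaE j : {ae P', forall w, (eta j : T' -> R) w = rho j (Y w)}.
  by apply: filterS sem => w semw; rewrite /rho /residual (semw j) addrAC subrr add0r.
have XY (B : set (p.-tuple R)) : measurable B -> P (X @^-1` B) = P' (Y @^-1` B).
  by move=> mB; exact: muY.
have mpre j (B : set R) : measurable B -> measurable (rho j @^-1` B).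
  by move=> mB; rewrite -[X in measurable X]setTI; exact: mrho.
(* Residuals are measurable functions [rho] of the vector, and X and Y have the same law, so the
   independence of the errors of Y carries over to the residuals of X. *)
have indA j k : j != k -> independent2 P (combination ep (A g b j)) (combination ep (A g b k)).
  move=> jk; apply: (ae_independent2 (mres g b j) (mres g b k) (mcomb _) (mcomb _)
    (residual_combination Hmodel g b j) (residual_combination Hmodel g b k)).
  move=> B C mB mC.
  have indY := ae_independent2 (meta j) (meta k) (mYrho j) (mYrho k) (etaE j) (etaE k)
    (mutually_independent_pair indeta jk).
  apply: etrans (XY _ (measurableI _ _ (mpre j B mB) (mpre k C mC))) _.
  apply: etrans (indY B C mB mC) _.
  have XYrho l (D : set R) : measurable D ->
      P ((fun w => residual g b (X w) l) @^-1` D) = P' ((fun w => rho l (Y w)) @^-1` D).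
    by move=> mD; exact: XY (mpre l D mD).
  by rewrite !XYrho.
have orth j k : j != k -> \sum_i A g b j i * A g b k i * m i ^+ 2 = 0.
  by move=> /indA/independent_orthogonal[].
split=> // j i k iG Aji ki.
pose W := \matrix_(j, i) (A g b j i * m i) : 'M[R]_p.
have dW : \det W != 0.
  have -> : W = A g b *m diag_mx (\row_i m i).
    by apply/matrixP => l l'; rewrite mul_mx_diag !mxE.
  rewrite det_mulmx det_error_mx mul1r det_diag.
  by apply: lt0r_neq0; apply: prodr_gt0 => l _; rewrite mxE.
have oW l l' : l != l' -> gram W l l' = 0.
  move=> ll'; rewrite -[RHS](orth l l' ll'); apply: eq_bigr => n _.
  by rewrite !mxE expr2 mulrACA.
have Wi l : l != j -> W l i = 0.
  move=> /indA/independent_orthogonal[/(_ i iG)/eqP + _].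
  by rewrite mulf_eq0 (negPf Aji) orbF => /eqP Ali; rewrite mxE Ali mul0r.
have := gram_single_column dW oW Wi ki.
by rewrite mxE => /eqP; rewrite mulf_eq0 (negPf (m_neq0 k)) orbF => /eqP.
Qed.

End equivalence_class.

Theorem corollary4p2 (R : realType) (d : measure_display) (T : measurableType d)
    (P : probability T R) (p : nat) (gstar : dag p) (bstar : 'I_p -> 'I_p -> R)
    (X : {RV P >-> p.-tuple R}) (eps lambda : 'I_p -> {RV P >-> R})
    (Q : 'I_p -> probability R R)
    (Hmodel : true_model gstar bstar X eps lambda Q) :
  let PX : probability (p.-tuple R) R := distribution P X in
  let nG := nonGaussian_nodes P (fun j => lambda j : T -> R) in
  let E := risk_class P X gstar in
  let ER := minimal_risk_class P X (fun j => eps j : T -> R) gstar nG in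
  (E `\` supergraphs gstar !=set0 -> faithful PX gstar) ->
  [/\ E = [set g' | exists g : dag p,
             supergraphs g g' /\ represented_laws g nG PX],
      [set g' | exists g : dag p, supergraphs g g' /\ represented_laws g nG PX]
        = \bigcup_(g in ER) supergraphs g &
      E = supergraphs gstar <-> ER = [set gstar]].
Proof.
move=> PX nG E ER _.
pose D := decoupled gstar bstar lambda.
have reprE g : represented_laws g nG PX <-> D g.
  split; [exact: (represented_decoupled Hmodel)|exact: (decoupled_represented Hmodel)].
have ERE g : ER g <-> D g.
  split; [exact: (minimal_risk_class_decoupled Hmodel)|
          exact: (decoupled_minimal_risk_class Hmodel)].
have EE g' : E g' <-> exists g, supergraphs g g' /\ D g.
  exact: (decoupled_risk_class Hmodel).
split.
- apply/seteqP; split => g' /=.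
    by move=> /EE[g [gg' /reprE Dg]]; exists g.
  by move=> [g [gg' /reprE Dg]]; apply/EE; exists g.
- apply/seteqP; split => g' /=.
    by move=> [g [gg' /reprE/ERE Dg]]; exists g.
  by move=> [g /ERE/reprE Dg gg']; exists g.
split=> [EgS|ERg].
  apply/seteqP; split => g /=; last by move=> ->; apply/ERE; exact: (decoupled_gstar Hmodel).
  (* As a supergraph of itself, g lies in E, hence contains [gstar]; a decoupled supergraph of
     [gstar] is [gstar]. *)
  move=> /ERE Dg; apply: (decoupled_supergraph Hmodel) => //.
  by rewrite -EgS; apply/EE; exists g; split => //; exact: subxx.
apply/seteqP; split => g'.
  by move=> /EE[g [gg' /ERE]]; rewrite ERg => /= <-.
by move=> gg'; apply/EE; exists gstar; split => //; exact: (decoupled_gstar Hmodel).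
Qed.
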